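(* Let $\beta\in\mathbb{R}$, $t,s\in(0,\infty)$ and $\vec{u},\vec{v}\in(1,\infty)^n$. The dual space of the homogeneous mixed-norm Herz-slice space $(\dot{K}E_{\vec{u},\vec{v}}^{\beta,s})_t(\mathbb{R}^n)$ is $$\left((\dot{K}E_{\vec{u},\vec{v}}^{\beta,s})_t(\mathbb{R}^n)\right)^*=\begin{cases}(\dot{K}E_{\vec{u}',\vec{v}'}^{-\beta,s'})_t(\mathbb{R}^n), & 1<s<\infty,\\ (\dot{K}E_{\vec{u}',\vec{v}'}^{-\beta,\infty})_t(\mathbb{R}^n), & 0<s\le 1.\end{cases}$$
   Context: For $\vec{u}=(u_1,\dots,u_n)\in(1,\infty)^n$ and measurable $f$ on $\mathbb{R}^n$, the mixed Lebesgue norm is $\|f\|_{L^{\vec{u}}}=\left\{\int_{\mathbb{R}}\cdots\left[\int_{\mathbb{R}}|f(x_1,\dots,x_n)|^{u_1}dx_1\right]^{u_2/u_1}\cdots dx_n\right\}^{1/u_n}$. For $t\in(0,\infty)$ and $\vec{u},\vec{v}\in(1,\infty)^n$, put $\|f\|_{(E_{\vec{v}}^{\vec{u}})_t(\mathbb{R}^n)}=\left\|\,x\mapsto \frac{\|f\mathbf{1}_{B(x,t)}\|_{L^{\vec{v}}}}{\|\mathbf{1}_{B(x,t)}\|_{L^{\vec{v}}}}\right\|_{L^{\vec{u}}}$, where $B(x,t)$ is the open ball of center $x$ and radius $t$. Let $B_k=\{x\in\mathbb{R}^n:|x|\le 2^k\}$ and $S_k=B_k\setminus B_{k-1}$ for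 $k\in\mathbb{Z}$. For $\beta\in\mathbb{R}$ and $s\in(0,\infty]$, the space $(\dot{K}E_{\vec{u},\vec{v}}^{\beta,s})_t(\mathbb{R}^n)$ is the set of $f\in L^1_{\mathrm{loc}}(\mathbb{R}^n)$ with $\|f\|_{(\dot{K}E_{\vec{u},\vec{v}}^{\beta,s})_t(\mathbb{R}^n)}=\left[\sum_{k=-\infty}^{\infty}2^{k\beta s}\|f\mathbf{1}_{S_k}\|_{(E_{\vec{v}}^{\vec{u}})_t(\mathbb{R}^n)}^s\right]^{1/s}<\infty$ (with the sum replaced by $\sup_k 2^{k\beta}\|f\mathbf{1}_{S_k}\|_{(E_{\vec{v}}^{\vec{u}})_t}$ when $s=\infty$). Here $\vec{u}'=(u_1',\dots,u_n')$ with $u_i'=u_i/(u_i-1)$, similarly $\vec{v}'$, and $s'=s/(s-1)$ for $1<s<\infty$. $X^*$ denotes the space of continuous linear functionals on $X$, and a function $L$ is identified with the functional $g\mapsto (L,g)=\int_{\mathbb{R}^n}L(x)g(x)\,dx$.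
   Formalization: Functions are required to be locally integrable on R^n minus the origin instead of on R^n, in both spaces: with L^1_loc(R^n) the claim fails for β ≤ -Σ1/v_i, e.g. L(x)=|x|^{-n}1_{|x|≤1} (β < -Σ1/v_i) gives a continuous functional but is not locally integrable at 0. *)

(* Defs.v *)
From HB Require Import structures.
From mathcomp Require Import all_boot all_order all_algebra.
From mathcomp Require Import all_classical all_reals all_analysis.

Set Implicit Arguments.
Unset Strict Implicit.
Unset Printing Implicit Defensive.

Import Order.TTheory GRing.Theory Num.Theory.
Import numFieldNormedType.Exports.

Local Open Scope classical_set_scope.
Local Open Scope ring_scope.

(* Tuples carry the product of the Borel sigma-algebras, so "measurable" below
   is Borel measurability; every Lebesgue measurable function has a Borel
   representative. *)
Notation rn R n := (n.-tuple (measurableTypeR R)).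

Section lebesgue_rn.
Context {R : realType}.
Local Open Scope ereal_scope.

Definition rn_cons n (z : measurableTypeR R * rn R n) : rn R n.+1 :=
  [tuple of z.1 :: z.2].

Lemma measurable_rn_cons n : measurable_fun setT (@rn_cons n).
Proof. exact: measurable_cons. Qed.

(* The image of dx_1 \x m under (x_1, (x_2, .., x_n+1)) |-> (x_1, .., x_n+1). *)
Definition leb_cons n (m : {sigma_finite_measure set (rn R n) -> \bar R}) :
    set (rn R n.+1) -> \bar R :=
  pushforward (product_measure1 (@lebesgue_measure R) m) (@rn_cons n).

Section leb_cons_measure.
Variables (n : nat) (m : {sigma_finite_measure set (rn R n) -> \bar R}).

Let leb_cons0 : leb_cons m set0 = 0.
Proof. by rewrite /leb_cons /pushforward preimage_set0 measure0. Qed.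

Let leb_cons_ge0 A : 0 <= leb_cons m A.
Proof. by apply: integral_ge0 => x _; exact: measure_ge0. Qed.

Let leb_cons_sigma_additive : semi_sigma_additive (leb_cons m).
Proof.
move=> F mF tF mUF; rewrite /leb_cons /pushforward preimage_bigcup.
apply: measure_semi_sigma_additive.
- by move=> i; rewrite -[X in measurable X]setTI; exact: measurable_rn_cons.
- apply/trivIsetP => /= i j _ _ ij; rewrite -preimage_setI.
  by move/trivIsetP : tF => /(_ _ _ _ _ ij) ->//; rewrite preimage_set0.
- by rewrite -preimage_bigcup -[X in measurable X]setTI;
    exact: measurable_rn_cons.
Qed.

HB.instance Definition _ := isMeasure.Build _ _ _ (leb_cons m)
  leb_cons0 leb_cons_ge0 leb_cons_sigma_additive.

Let leb_cons_sigma_finite : sigma_finite setT (leb_cons m).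
Proof.
have /sigma_finiteP[G [TG ndG Goo]] := sigma_finiteT m.
have /sigma_finiteP[F [TF ndF Foo]] := sigma_finiteT (@lebesgue_measure R).
pose g (x : rn R n.+1) : measurableTypeR R * rn R n :=
  (tnth x ord0, [tuple of behead x]).
have mg : measurable_fun setT g.
  apply/measurable_fun_pair => /=; first exact: measurable_tnth.
  exact: measurable_behead.
exists (fun i => g @^-1` (F i `*` G i)).
  rewrite -preimage_bigcup; apply/esym; rewrite -subTset => x _ /=.
  have [i _ Fi] : (\bigcup_i F i) (g x).1 by rewrite -TF.
  have [j _ Gj] : (\bigcup_j G j) (g x).2 by rewrite -TG.
  exists (maxn i j) => //; split.
  - by move: Fi; exact/subsetPset/ndF/leq_maxl.
  - by move: Gj; exact/subsetPset/ndG/leq_maxr.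
move=> i; have [mFi Fioo] := Foo i; have [mGi Gioo] := Goo i; split.
  by rewrite -[X in measurable X]setTI; apply: mg => //; exact: measurableX.
rewrite /leb_cons /pushforward -comp_preimage.
rewrite (_ : g \o @rn_cons n = id).
  by rewrite preimage_id product_measure1E// lte_mul_pinfty// ge0_fin_numE.
by apply/funext => -[a x]; congr pair; exact/val_inj.
Qed.

HB.instance Definition _ := Measure_isSigmaFinite.Build _ _ _ (leb_cons m)
  leb_cons_sigma_finite.

End leb_cons_measure.

Fixpoint leb n : {sigma_finite_measure set (rn R n) -> \bar R} :=
  match n with
  | 0%N => \d_([tuple] : rn R 0)
  | k.+1 => leb_cons (leb k)
  end.

End lebesgue_rn.

Section herz_slice.
Context {R : realType}.

(* The exponent u_1 and the innermost integration variable x_1 are the heads of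
   the tuples; [Lnorm] contributes the power 1/u_1, and the next application
   raises the result to the power u_2. *)
Fixpoint mixed_norm n : n.-tuple R -> (rn R n -> \bar R) -> \bar R :=
  match n with
  | 0%N => fun _ f => `|f [tuple]|%E
  | k.+1 => fun u f =>
      mixed_norm (behead_tuple u) (fun y : rn R k =>
        Lnorm (@lebesgue_measure R) (thead u)%:E
          (fun x => f (rn_cons (x, y))))
  end.

Context {n : nat}.
Implicit Types (f g L : rn R n -> R) (u v : n.-tuple R) (x y : rn R n).

Definition euclid_dist x y : R :=
  Num.sqrt (\sum_(i < n) (tnth x i - tnth y i) ^+ 2).

Definition origin : rn R n := [tuple 0 | _ < n].

Definition oball x (r : R) : set (rn R n) := [set y | euclid_dist x y < r].

Definition dyadic_ball (k : int) : set (rn R n) :=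
  [set x | euclid_dist origin x <= 2 ^ k].

Definition dyadic_shell (k : int) : set (rn R n) :=
  dyadic_ball k `\` dyadic_ball (k - 1).

Definition slice_norm u v (t : R) f : \bar R :=
  mixed_norm u (fun x =>
    mixed_norm v (fun y => (f y * \1_(oball x t) y)%:E) /
    mixed_norm v (fun y => (\1_(oball x t) y)%:E))%E.

(* [s] is meant to range over ]0, +oo]. *)
Definition herz_slice_norm u v (t beta : R) (s : \bar R) f : \bar R :=
  let shell_norm k := slice_norm u v t (f \* \1_(dyadic_shell k)) in
  if s is r%:E then
    ((\esum_(k in [set: int])
        ((2 `^ (k%:~R * beta * r))%:E * shell_norm k `^ r)) `^ r^-1)%E
  else
    ereal_sup [set ((2 `^ (k%:~R * beta))%:E * shell_norm k)%E | k in [set: int]].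

(* Functions locally integrable on the complement of the origin, as is usual
   for homogeneous Herz spaces: for extreme values of beta a finite Herz norm
   does not force integrability at the origin, and the dual space contains
   functions that are not integrable there. *)
Definition loc_integrable_off0 f : Prop :=
  measurable_fun setT f /\
  forall x, x != origin -> exists2 r : R, 0 < r &
    (leb n).-integrable (oball x r) (EFin \o f).

Definition herz_slice u v (t beta : R) (s : \bar R) : set (rn R n -> R) :=
  [set f | loc_integrable_off0 f /\
           (herz_slice_norm u v t beta s f < +oo)%E].

Definition conj_exp (p : R) : R := p / (p - 1).

Definition conj_exps u : n.-tuple R := map_tuple conj_exp u.

Section dual.
Variables (X : set (rn R n -> R)) (NX : (rn R n -> R) -> \bar R).

(* Elements of X* are functions on [rn R n -> R] of which only the values on X
   matter; continuity makes them constant on classes of functions equal almost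
   everywhere. *)
Definition continuous_linear_functional (T : (rn R n -> R) -> R) : Prop :=
  (forall (a : R) f g, X f -> X g -> T (a \*o f \+ g) = a * T f + T g) /\
  (forall f, X f -> forall e : R, 0 < e -> exists2 d : R, 0 < d &
     forall g, X g -> (NX (g \- f)%R < d%:E)%E -> `|T g - T f| < e).

Definition dual_norm (T : (rn R n -> R) -> R) : \bar R :=
  ereal_sup [set `|T g|%:E | g in [set g | X g /\ (NX g <= 1)%E]].

Definition pairing L g : R := \int[leb n]_x (L x * g x).

(* X* = Y under the identification of L with (L, .), with equivalent norms. *)
Definition dual_space_is (Y : set (rn R n -> R))
    (NY : (rn R n -> R) -> \bar R) : Prop :=
  [/\ forall L, Y L ->
        (forall g, X g -> (leb n).-integrable setT (EFin \o (L \* g))) /\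
        continuous_linear_functional (pairing L),
      forall T, continuous_linear_functional T ->
        exists2 L, Y L & forall g, X g -> T g = pairing L g,
      forall L L', Y L -> Y L' ->
        (forall g, X g -> pairing L g = pairing L' g) ->
        {ae leb n, forall x, L x = L' x} &
      exists c C : R, [/\ 0 < c, 0 < C & forall L, Y L ->
        (c%:E * NY L <= dual_norm (pairing L))%E /\
        (dual_norm (pairing L) <= C%:E * NY L)%E]].

End dual.

End herz_slice.

(* Main.v *)
Require Import Defs.
From HB Require Import structures.
From mathcomp Require Import all_boot all_order all_algebra.
From mathcomp Require Import all_classical all_reals all_analysis measurable_realfun.
From mathcomp Require Import ring lra.

(**
Every norm here is an iterated Lebesgue norm, so Hoelder's inequality and its equality
case (with an extremal function depending measurably on parameters) pass from [Lnorm]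
to [mixed_norm] by induction on the dimension, and Minkowski's integral inequality for
[mixed_norm] follows from the two.

For the slice norms, integrating over the center of the ball gives
|B(0,t)| * int f g <= |f| * |g|'.  Conversely, if Phi(x, y) is extremal for
(x, y) |-> g(y) 1_B(x,t)(y), then f(y) = int Phi(x, y) 1_B(x,t)(y) dx has slice norm at
most |B(0,2t)|, by Minkowski's inequality, and int f g = |g|'.  Gluing such functions
over the dyadic shells with the coefficients of an extremal sequence for l^s gives the
converse Hoelder inequality for the Herz norms.

A continuous functional T is represented through a positive weight g0 of finite norm:
because the norm is order continuous, A |-> T (g0 1_A) is a finite signed measure; it is
absolutely continuous, and L is its Radon-Nikodym derivative divided by g0.  The converse
Hoelder inequality puts L in the dual space, and truncation extends T = (L, .) from
bounded multiples of g0 to the whole space.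
*)

(** The equality case of Hoelder's inequality asks for a finite norm. Extremal functions are
    therefore built only for functions bounded by a multiple of the indicator of a cube, and general
    functions follow by monotone convergence along truncations; this is why the norms are studied on
    nonnegative extended-real functions, where suprema exist. The denominator of a slice norm does
    not depend on the center of the ball. It moves into the weights of the shells, and in the
    product of the weights of a space and of its dual the opposite powers of 2 cancel, which leaves
    one constant for all shells. For s < 1 the Herz norm is only a quasi-norm, so the abstract
    duality argument uses monotonicity, homogeneity and order continuity of the norm and never a
    triangle inequality. The supremum norm on the dual side is not order continuous: order
    continuity is asked of the predual norm, monotone convergence of the dual norm. *)

Set Implicit Arguments.
Unset Strict Implicit.
Unset Printing Implicit Defensive.

Import Order.TTheory GRing.Theory Num.Theory.
Import numFieldNormedType.Exports.

Local Open Scope classical_set_scope.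
Local Open Scope ring_scope.

Local Open Scope ereal_scope.

(** * Lebesgue norms of nonnegative functions *)

Section poweR_facts.
Context {R : realType}.
Implicit Types (x y : \bar R) (r : R).

Lemma le_poweR x y r : (0 <= r)%R -> 0 <= x -> x <= y -> x `^ r <= y `^ r.
Proof.
move=> r0 x0 xy; apply: (gt0_ler_poweR r0) => //; rewrite in_itv/= leey andbT//.
exact: le_trans xy.
Qed.

Lemma poweRK x r : r != 0%R -> 0 <= x -> (x `^ r) `^ r^-1 = x.
Proof. by move=> r0 x0; rewrite -poweRrM divff// poweRe1. Qed.

Lemma poweRVK x r : r != 0%R -> 0 <= x -> (x `^ r^-1) `^ r = x.
Proof. by move=> r0 x0; rewrite -poweRrM mulVf// poweRe1. Qed.

(** Each bound is monotonicity of a power, the second one after applying the power [r^-1]. *)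
Lemma poweR_ereal_sup (a : nat -> \bar R) r : (0 < r)%R -> (forall m, 0 <= a m) ->
  ereal_sup (range (fun m => a m `^ r)) = ereal_sup (range a) `^ r.
Proof.
move=> r0 a0; apply/eqP; rewrite eq_le; apply/andP; split.
  apply: ge_ereal_sup => _ [m _ <-]; apply: le_poweR => //; first exact: ltW.
  by apply: ereal_sup_ubound; exists m.
have sup0 : 0 <= ereal_sup (range (fun m => a m `^ r)).
  by apply: (le_trans (poweR_ge0 (a 0%N) r)); apply: ereal_sup_ubound; exists 0%N.
rewrite -[leRHS](@poweRVK _ r) ?gt_eqF//; apply: le_poweR; first exact: ltW.
  by apply: (le_trans (a0 0%N)); apply: ereal_sup_ubound; exists 0%N.
apply: ge_ereal_sup => _ [m _ <-].
rewrite -[leLHS](@poweRK _ r) ?gt_eqF//; apply: le_poweR.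
- by rewrite invr_ge0 ltW.
- exact: poweR_ge0.
- by apply: ereal_sup_ubound; exists m.
Qed.

End poweR_facts.

(* Convergence to 0, for sequences of nonnegative extended reals. *)
Definition vanishes {R : realType} (a : nat -> \bar R) :=
  forall e : R, (0 < e)%R -> exists M, forall m, (M <= m)%N -> a m <= e%:E.

Section vanishes_facts.
Context {R : realType}.
Implicit Types a b : nat -> \bar R.

Lemma le_vanishes a b : (forall m, a m <= b m) -> vanishes b -> vanishes a.
Proof.
by move=> ab vb e /vb[M bM]; exists M => m /bM; exact: le_trans.
Qed.

Lemma vanishes_poweR a r : (0 < r)%R -> (forall m, 0 <= a m) ->
  vanishes a -> vanishes (fun m => a m `^ r).
Proof.
move=> r0 a0 va e e0; have [|M aM] := va (e `^ r^-1)%R; first exact: powR_gt0.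
exists M => m /aM ame; rewrite -[leRHS](@poweRVK _ _ r) ?gt_eqF//.
  by apply: le_poweR => //; exact: ltW.
by rewrite lee_fin ltW.
Qed.

Lemma vanishesZ a (c : R) : (0 <= c)%R -> (forall m, 0 <= a m) ->
  vanishes a -> vanishes (fun m => c%:E * a m).
Proof.
(* The denominator is [c + 1] rather than [c] because [c] may be 0. *)
move=> c0 a0 va e e0; have [|M aM] := va (e / (c + 1))%R.
  by rewrite divr_gt0// ltr_wpDl.
exists M => m /aM ame; apply: (@le_trans _ _ (c%:E * (e / (c + 1))%:E)).
  exact: lee_wpmul2l.
rewrite -EFinM lee_fin mulrCA ger_pMr// ler_pdivrMr ?mul1r ?ltr_wpDl//.
by rewrite lerDl.
Qed.

(** [vanishes] speaks of bounds only; this is its link with the limits of dominated convergence. *)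
Lemma vanishes_cvg0 a : (forall m, 0 <= a m) -> vanishes a <-> a @ \oo --> 0.
Proof.
move=> a0; split => [va|/fine_cvgP[[N _ aN] /cvgrPdist_le ca] e e0].
  apply/fine_cvgP; split.
    have [M aM] := va 1%R ltr01; exists M => // m /= /aM am.
    by rewrite ge0_fin_numE// (le_lt_trans am)// ltry.
  apply/cvgrPdist_le => e e0; have [M aM] := va _ e0; exists M => // m /= /aM am.
  rewrite sub0r normrN ger0_norm ?fine_ge0// -lee_fin fineK//.
  by rewrite ge0_fin_numE// (le_lt_trans am)// ltry.
have [M _ aM] := ca _ e0; exists (maxn N M) => m /=; rewrite geq_max => /andP[Nm Mm].
have := aM m Mm; rewrite /= sub0r normrN ger0_norm ?fine_ge0//.
by rewrite -lee_fin fineK//; apply: aN.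
Qed.

End vanishes_facts.

Section Lnorm_ge0.
Context d (T : measurableType d) {R : realType} (mu : {measure set T -> \bar R}).
Implicit Types (f g : T -> \bar R) (p q : R).

Lemma Lnorm_ge0E p f : (forall x, 0 <= f x) ->
  Lnorm mu p%:E f = (\int[mu]_x (f x `^ p)) `^ p^-1.
Proof.
move=> f0; rewrite unlock; congr (_ `^ _).
by apply: eq_integral => x _; rewrite gee0_abs.
Qed.

Lemma measurable_poweR_fun p f : measurable_fun setT f ->
  measurable_fun setT (fun x => f x `^ p).
Proof. by move=> mf; apply: (measurableT_comp (measurable_poweR p)). Qed.

Lemma le_Lnorm p f g : (0 < p)%R -> measurable_fun setT f -> measurable_fun setT g ->
  (forall x, 0 <= f x) -> (forall x, f x <= g x) ->
  Lnorm mu p%:E f <= Lnorm mu p%:E g.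
Proof.
move=> p0 mf mg f0 fg; have g0 x : 0 <= g x by exact: le_trans (fg x).
rewrite !Lnorm_ge0E//; apply: le_poweR.
- by rewrite invr_ge0 ltW.
- by apply: integral_ge0 => x _; exact: poweR_ge0.
- apply: ge0_le_integral => //.
  + by move=> x _; exact: poweR_ge0.
  + exact: measurable_poweR_fun.
  + exact: measurable_poweR_fun.
  + by move=> x _; apply: le_poweR => //; exact: ltW.
Qed.

Lemma Lnorm_ge0Z p c f : (0 < p)%R -> 0 <= c -> measurable_fun setT f ->
  (forall x, 0 <= f x) ->
  Lnorm mu p%:E (fun x => c * f x) = c * Lnorm mu p%:E f.
Proof.
move=> p0 c0 mf f0; rewrite !Lnorm_ge0E//; last by move=> x; rewrite mule_ge0.
under eq_integral do rewrite poweRM//.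
rewrite ge0_integralZl//; last 3 first.
- exact: measurable_poweR_fun.
- by move=> x _; exact: poweR_ge0.
- exact: poweR_ge0.
rewrite poweRM; last 2 first.
- exact: poweR_ge0.
- by apply: integral_ge0 => x _; exact: poweR_ge0.
by rewrite poweRK ?gt_eqF.
Qed.

Lemma Lnorm_lty_ae p f : (0 < p)%R -> measurable_fun setT f ->
  (forall x, 0 <= f x) -> Lnorm mu p%:E f < +oo ->
  {ae mu, forall x, f x < +oo}.
Proof.
move=> p0 mf f0; rewrite Lnorm_ge0E// => /lty_poweRy.
rewrite invr_eq0 gt_eqF// => /(_ isT) foo.
have : mu.-integrable setT (fun x => f x `^ p).
  apply/integrableP; split; first exact: measurable_poweR_fun.
  by under eq_integral do rewrite gee0_abs ?poweR_ge0//.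
move/(integrable_ae measurableT); apply: filterS => x /(_ I).
rewrite ge0_fin_numE ?poweR_ge0// => /lty_poweRy; apply.
by rewrite gt_eqF.
Qed.

(** Dominated convergence for the p-th powers. Convergence is asked only where the majorant is
    finite, which is almost everywhere; in this form the lemma can be iterated, since an inner norm
    of the majorant may be infinite at some points. *)
Lemma Lnorm_dominated p (h : nat -> T -> \bar R) f : (0 < p)%R ->
  (forall m, measurable_fun setT (h m)) -> measurable_fun setT f ->
  (forall m x, 0 <= h m x) -> (forall m x, h m x <= f x) ->
  Lnorm mu p%:E f < +oo ->
  (forall x, f x < +oo -> vanishes (h ^~ x)) ->
  vanishes (fun m => Lnorm mu p%:E (h m)).
Proof.
move=> p0 mh mf h0 hf foo hv.
have f0 x : 0 <= f x by exact: le_trans (hf 0%N x).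
have -> : (fun m => Lnorm mu p%:E (h m)) = (fun m => (\int[mu]_x (h m x `^ p)) `^ p^-1).
  by apply/funext => m; rewrite Lnorm_ge0E.
have i0 m : 0 <= \int[mu]_x (h m x `^ p).
  by apply: integral_ge0 => x _; exact: poweR_ge0.
apply: vanishes_poweR => //; first by rewrite invr_gt0.
apply/vanishes_cvg0 => //.
suff [_ _] : [/\ mu.-integrable setT (cst 0),
    \int[mu]_x `|h m x `^ p - cst 0 x| @[m --> \oo] --> 0 &
    \int[mu]_x (h m x `^ p) @[m --> \oo] --> \int[mu]_x (cst 0 x)].
  by rewrite integral0.
apply: (@dominated_convergence _ _ _ mu setT measurableT
  (fun m x => h m x `^ p) (cst 0) (fun x => f x `^ p)).
- by move=> m; exact: measurable_poweR_fun.
- exact: measurable_cst.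
- have := Lnorm_lty_ae p0 mf f0 foo; apply: filterS => x fx _.
  apply/vanishes_cvg0; first by move=> m; exact: poweR_ge0.
  by apply: vanishes_poweR => //; exact: hv.
- apply/integrableP; split; first exact: measurable_poweR_fun.
  under eq_integral do rewrite gee0_abs ?poweR_ge0//.
  move: foo; rewrite Lnorm_ge0E// => /lty_poweRy; apply.
  by rewrite invr_eq0 gt_eqF.
- apply: aeW => x m _; rewrite gee0_abs ?poweR_ge0//.
  by apply: le_poweR => //; exact: ltW.
Qed.

(** Monotone convergence, phrased with [ereal_sup] so that it passes through powers and further
    integrals. *)
Lemma integral_ereal_sup (f : nat -> T -> \bar R) :
  (forall m, measurable_fun setT (f m)) -> (forall m x, 0 <= f m x) ->
  (forall x, nondecreasing_seq (f ^~ x)) ->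
  \int[mu]_x ereal_sup (range (f ^~ x)) = ereal_sup (range (fun m => \int[mu]_x f m x)).
Proof.
move=> mf f0 ndf.
under eq_integral => x _.
  rewrite -(cvg_lim _ (ereal_nondecreasing_cvgn (ndf x)))//; over.
rewrite monotone_convergence//.
apply/cvg_lim => //; apply: ereal_nondecreasing_cvgn => m n mn.
by apply: ge0_le_integral => // x _; exact: ndf.
Qed.

Lemma Lnorm_ereal_sup p (f : nat -> T -> \bar R) : (0 < p)%R ->
  (forall m, measurable_fun setT (f m)) -> (forall m x, 0 <= f m x) ->
  (forall x, nondecreasing_seq (f ^~ x)) ->
  Lnorm mu p%:E (fun x => ereal_sup (range (f ^~ x))) =
  ereal_sup (range (fun m => Lnorm mu p%:E (f m))).
Proof.
move=> p0 mf f0 ndf; rewrite Lnorm_ge0E; last first.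
  by move=> x; apply: (le_trans (f0 0%N x)); apply: ereal_sup_ubound; exists 0%N.
under eq_integral do rewrite -poweR_ereal_sup//.
rewrite (@integral_ereal_sup (fun m x => f m x `^ p)); last 3 first.
- by move=> m; exact: measurable_poweR_fun.
- by move=> m x; exact: poweR_ge0.
- by move=> x m n mn; apply: le_poweR => //; [exact: ltW|exact: ndf].
rewrite -poweR_ereal_sup ?invr_gt0//; last first.
  by move=> m; apply: integral_ge0 => x _; exact: poweR_ge0.
by congr ereal_sup; apply: eq_imagel => m _; rewrite Lnorm_ge0E.
Qed.

(* Reduces to [hoelder]: when both norms are finite, the functions are finite almost
   everywhere. *)
Lemma ehoelder p q f g : (0 < p)%R -> (0 < q)%R -> (p^-1 + q^-1 = 1)%R ->
  measurable_fun setT f -> measurable_fun setT g ->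
  (forall x, 0 <= f x) -> (forall x, 0 <= g x) ->
  \int[mu]_x (f x * g x) <= Lnorm mu p%:E f * Lnorm mu q%:E g.
Proof.
move=> p0 q0 pq mf mg f0 g0.
have zero r h : (0 < r)%R -> measurable_fun setT h -> (forall x, 0 <= h x) ->
    Lnorm mu r%:E h = 0 -> ae_eq mu setT h (cst 0).
  by move=> r0 mh h0 /Lnorm_eq0_eq0; apply => //; rewrite lte_fin.
(* As [0 * +oo] is 0, the integral has to be shown null when one norm vanishes, even if the other
   norm is infinite. *)
have [F0|F0] := eqVneq (Lnorm mu p%:E f) 0.
  rewrite F0 mul0e.
  rewrite (ae_eq_integral (cst 0)) ?integral0//; first exact: emeasurable_funM.
  by have := zero _ _ p0 mf f0 F0; apply: filterS => x /(_ I)-> _; rewrite mul0e.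
have [G0|G0] := eqVneq (Lnorm mu q%:E g) 0.
  rewrite G0 mule0.
  rewrite (ae_eq_integral (cst 0)) ?integral0//; first exact: emeasurable_funM.
  by have := zero _ _ q0 mg g0 G0; apply: filterS => x /(_ I)-> _; rewrite mule0.
have [Foo|Foo] := eqVneq (Lnorm mu p%:E f) +oo.
  by rewrite Foo gt0_mulye ?leey// lt0e G0 Lnorm_ge0.
have [Goo|Goo] := eqVneq (Lnorm mu q%:E g) +oo.
  by rewrite Goo gt0_muley ?leey// lt0e F0 Lnorm_ge0.
have aef := Lnorm_lty_ae p0 mf f0 _.
have aeg := Lnorm_lty_ae q0 mg g0 _.
move: aef aeg; rewrite !ltey => /(_ Foo) aef /(_ Goo) aeg.
have mff : measurable_fun setT (fine \o f) by exact: measurableT_comp.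
have mfg : measurable_fun setT (fine \o g) by exact: measurableT_comp.
have eqf : ae_eq mu setT f (EFin \o (fine \o f)).
  by apply: filterS aef => x fx _ /=; rewrite fineK// ge0_fin_numE.
have eqg : ae_eq mu setT g (EFin \o (fine \o g)).
  by apply: filterS aeg => x gx _ /=; rewrite fineK// ge0_fin_numE.
have nrm r h : (0 < r)%R -> measurable_fun setT h -> (forall x, 0 <= h x) ->
    ae_eq mu setT h (EFin \o (fine \o h)) ->
    Lnorm mu r%:E h = Lnorm mu r%:E (EFin \o (fine \o h)).
  move=> r0 mh h0 hE; rewrite !Lnorm_ge0E//; last by move=> x; rewrite lee_fin fine_ge0.
  congr (_ `^ _); apply: ae_eq_integral => //.
  - exact: measurable_poweR_fun.
  - by apply: measurable_poweR_fun; apply/measurable_EFinP; exact: measurableT_comp.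
  - by apply: filterS hE => x /(_ I) {1}-> _.
rewrite (nrm p f)// (nrm q g)//.
apply: le_trans (hoelder mu mff mfg p0 q0 pq).
rewrite Lnorm1 le_eqVlt; apply/orP; left; apply/eqP.
apply: ae_eq_integral => //.
- exact: emeasurable_funM.
- by apply: measurableT_comp => //; apply/measurable_EFinP; exact: measurable_funM.
- apply: filterS2 eqf eqg => x /(_ I)fx /(_ I)gx _ /=.
  by rewrite {1}fx {1}gx -EFinM /= ger0_norm// mulr_ge0// fine_ge0.
Qed.

End Lnorm_ge0.

Section Lnorm_parameter.
Context d d' (S : measurableType d') (T : measurableType d) {R : realType}.
Variable mu : {sigma_finite_measure set T -> \bar R}.
Implicit Types (F : S * T -> \bar R) (p q : R).

Lemma measurable_integral_parameter F :
  measurable_fun setT F -> (forall z, 0 <= F z) ->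
  measurable_fun setT (fun s => \int[mu]_t F (s, t)).
Proof. by move=> mF F0; exact: (measurable_fun_fubini_tonelli_F (m2 := mu)). Qed.

Lemma measurable_Lnorm p F : measurable_fun setT F -> (forall z, 0 <= F z) ->
  measurable_fun setT (fun s => Lnorm mu p%:E (fun t => F (s, t))).
Proof.
move=> mF F0; under eq_fun do rewrite Lnorm_ge0E//.
apply: measurable_poweR_fun.
apply: (@measurable_integral_parameter (fun z => F z `^ p)).
- exact: measurable_poweR_fun.
- by move=> z; exact: poweR_ge0.
Qed.

(* The equality case of Hoelder's inequality, [phi = (F / |F|_q) ^ (q - 1)], is
   measurable in the parameter. *)
Lemma Lnorm_extremal p q F : (0 < p)%R -> (1 < q)%R -> (p^-1 + q^-1 = 1)%R ->
  measurable_fun setT F -> (forall z, 0 <= F z) ->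
  (forall s, Lnorm mu q%:E (fun t => F (s, t)) < +oo) ->
  exists phi : S * T -> \bar R, [/\ measurable_fun setT phi,
    forall z, 0 <= phi z,
    forall s, Lnorm mu p%:E (fun t => phi (s, t)) <= 1 &
    forall s, \int[mu]_t (phi (s, t) * F (s, t)) =
              Lnorm mu q%:E (fun t => F (s, t))].
Proof.
move=> p0 q1 pq mF F0 Foo; have q0 : (0 < q)%R by exact: lt_trans q1.
have q10 : (0 < q - 1)%R by rewrite subr_gt0.
(* Because of this, for each parameter both [phi ^ p] and [phi * F] are constant multiples of
   [F ^ q]. *)
have q1p : ((q - 1) * p = q)%R.
  move: pq => /(congr1 (fun x => x * (p * q)))%R; rewrite mulrDl mul1r.
  rewrite mulKf ?gt_eqF// [(p * q)%R]mulrC mulKf ?gt_eqF//.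
  by rewrite mulrBl mul1r => <-; rewrite addrK.
pose N s := Lnorm mu q%:E (fun t => F (s, t)).
have N0 s : 0 <= N s by exact: Lnorm_ge0.
have Nfin s : N s \is a fin_num by rewrite ge0_fin_numE; [exact: Foo|exact: N0].
have mN : measurable_fun setT N by exact: measurable_Lnorm.
(* Since [0^-1] is 0, [phi] vanishes at the parameters where the norm is 0; there the norm of [phi]
   is 0 instead of 1. *)
pose k s := (fine (N s))^-1%R.
have k0 s : (0 <= k s)%R by rewrite invr_ge0 fine_ge0.
have mk : measurable_fun setT k.
  rewrite (_ : k = fun s => (fine (N s) `^ (- 1))%R); last first.
    by apply/funext => s; rewrite /k powRN powRr1// fine_ge0.
  by apply: measurableT_comp (measurable_powR _) _; exact: measurableT_comp.
pose phi z := (F z * (k z.1)%:E) `^ (q - 1).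
have mFs s : measurable_fun setT (fun t => F (s, t)).
  by apply: (measurableT_comp mF); exact: pair1_measurable.
have mphi : measurable_fun setT phi.
  apply: measurable_poweR_fun; apply: emeasurable_funM => //.
  by apply/measurable_EFinP; apply: (measurableT_comp mk); exact: measurable_fst.
have intF s : \int[mu]_t (F (s, t) `^ q) = (N s) `^ q.
  rewrite /N Lnorm_ge0E// poweRVK ?gt_eqF//.
  by apply: integral_ge0 => t _; exact: poweR_ge0.
exists phi; split => //.
- by move=> z; exact: poweR_ge0.
- move=> s; rewrite Lnorm_ge0E; last by move=> t; exact: poweR_ge0.
  have -> : \int[mu]_t (phi (s, t) `^ p) =
      \int[mu]_t ((k s)%:E `^ q * F (s, t) `^ q).
    apply: eq_integral => t _.
    by rewrite /phi -poweRrM q1p poweRM ?lee_fin//= muleC.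
  rewrite ge0_integralZl//; last 3 first.
  + exact: measurable_poweR_fun.
  + by move=> t _; exact: poweR_ge0.
  + exact: poweR_ge0.
  rewrite intF -poweRM// ?lee_fin//.
  rewrite -[leRHS](poweR1r p^-1) -[in leRHS](poweR1r q).
  apply: le_poweR; [by rewrite invr_ge0 ltW|exact: poweR_ge0|].
  apply: le_poweR; [exact: ltW|by rewrite mule_ge0// lee_fin|].
  rewrite -[N s]fineK// -EFinM lee_fin /k.
  by have [->|] := eqVneq (fine (N s)) 0%R; rewrite ?mulr0// => ?; rewrite mulVf.
- move=> s; rewrite /phi.
  transitivity (\int[mu]_t ((k s)%:E `^ (q - 1) * F (s, t) `^ q)).
    apply: eq_integral => t _; rewrite poweRM ?lee_fin// muleAC muleC; congr (_ * _).
    rewrite -[X in _ * X]poweRe1// -[in RHS](subrK 1%R q) [RHS]poweRD//.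
    by apply: add_neq0_poweRD_def; rewrite subrK gt_eqF.
  rewrite ge0_integralZl//; last 3 first.
  + exact: measurable_poweR_fun.
  + by move=> t _; exact: poweR_ge0.
  + exact: poweR_ge0.
  rewrite intF -/(N s) -[N s]fineK// !poweR_EFin -EFinM; congr (_%:E).
  have [N00|N00] := eqVneq (fine (N s)) 0%R.
    by rewrite N00 powR0 ?gt_eqF// mulr0.
  have Nge0 : (0 <= fine (N s))%R by rewrite fine_ge0.
  rewrite -[X in (_ * X `^ _)%R]invrK -/(k s) -[((k s)^-1)%R]powR_inv1//.
  rewrite -powRrM mulN1r -powRD; last first.
    by apply/implyP => _; rewrite invr_eq0.
  by rewrite addrAC subrr add0r powR_inv1// invrK.
Qed.

End Lnorm_parameter.

(** * Lebesgue measure on tuples *)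

Section rn_structure.
Context {R : realType}.
Implicit Types n : nat.

Lemma thead_rn_cons n (x : R) (y : rn R n) : thead (rn_cons (x, y)) = x.
Proof. by []. Qed.

Lemma behead_rn_cons n (x : R) (y : rn R n) : behead_tuple (rn_cons (x, y)) = y.
Proof. exact: val_inj. Qed.

Lemma tnth_behead_tuple n T (z : n.+1.-tuple T) i :
  tnth (behead_tuple z) i = tnth z (lift ord0 i).
Proof. by rewrite [in RHS](tuple_eta z) tnthS. Qed.

Lemma tuple_cons_gt0 n (u : n.+1.-tuple R) : (forall i, 0 < tnth u i)%R ->
  (0 < thead u)%R /\ forall i, (0 < tnth (behead_tuple u) i)%R.
Proof. by move=> Pu; split => [|i]; rewrite ?tnth_behead_tuple; exact: Pu. Qed.

Lemma measurable_fun_rn_cons d (S : measurableType d) n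
    (f : S -> measurableTypeR R) (g : S -> rn R n) :
  measurable_fun setT f -> measurable_fun setT g ->
  measurable_fun setT (fun s => rn_cons (f s, g s)).
Proof. by move=> mf mg; exact: measurable_cons. Qed.

Lemma measurable_thead n : measurable_fun setT (fun z : rn R n.+1 => thead z).
Proof. exact: (measurable_tnth ord0). Qed.

Lemma measurable_behead_tuple n :
  measurable_fun setT (fun z : rn R n.+1 => behead_tuple z : rn R n).
Proof. exact: measurable_behead. Qed.

Lemma rn0_eq (y : rn R 0) : y = [tuple].
Proof. by rewrite (tuple0 y). Qed.

Lemma integral_leb0 (f : rn R 0 -> \bar R) : (forall y, 0 <= f y) ->
  \int[leb 0]_y f y = f [tuple].
Proof.
move=> f0; rewrite integral_dirac//; first by rewrite diracT mul1e.
by rewrite (_ : f = cst (f [tuple])); [|apply/funext => y; rewrite (rn0_eq y)].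
Qed.

(** Tonelli's theorem for the image of a product measure, in the order of [mixed_norm]: the head
    variable is innermost. *)
Lemma integral_leb_cons n (f : rn R n.+1 -> \bar R) :
  measurable_fun setT f -> (forall y, 0 <= f y) ->
  \int[leb n.+1]_z f z =
  \int[leb n]_y \int[lebesgue_measure]_x f (rn_cons (x, y)).
Proof.
move=> mf f0.
transitivity (\int[product_measure1 (@lebesgue_measure R) (leb n)]_z (f \o @rn_cons R n) z).
  by rewrite ge0_integral_pushforward//; exact: measurable_rn_cons.
have mg : measurable_fun setT (f \o @rn_cons R n).
  exact: (measurableT_comp mf (@measurable_rn_cons R n)).
rewrite fubini_tonelli2//; move=> z; exact: f0.
Qed.

End rn_structure.

(** * Translation invariance of Lebesgue measure on the line *)

Section lebesgue_translation.
Context {R : realType}.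
Local Notation mu := (@lebesgue_measure R).

Lemma measurable_addr (a : R) :
  measurable_fun setT (fun x : measurableTypeR R => (x + a)%R : measurableTypeR R).
Proof. by apply: measurable_funD. Qed.

(** The image of Lebesgue measure under the shift has the same values on half-open intervals, and
    these determine the measure. *)
Lemma integral_lebesgue_addr (a : R) (f : measurableTypeR R -> \bar R) :
  measurable_fun setT f -> (forall x, 0 <= f x) ->
  \int[mu]_x f (x + a)%R = \int[mu]_x f x.
Proof.
move=> mf f0; pose phi (x : measurableTypeR R) : measurableTypeR R := (x + a)%R.
have mphi : measurable_fun setT phi by exact: measurable_addr.
pose nu := measure_function_pushforward__canonical__measure_function_Measure mu mphi.
transitivity (\int[nu]_x f x); first by rewrite ge0_integral_pushforward.
apply: eq_measure_integral => A mA _; apply/esym.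
apply: lebesgue_measure_unique => // _ [[c b] _ <-].
rewrite [RHS](_ : _ = mu `](c - a)%R, (b - a)%R]); last first.
  congr (mu _); apply/seteqP; split => x /=;
    by rewrite /phi !in_itv/= ltrBlDr lerBrDr.
by rewrite !lebesgue_measure_itv/= !lte_fin ltrD2r -!EFinB opprB addrA subrK.
Qed.

End lebesgue_translation.

(** * Mixed norms *)

Section mixed_norm_ge0.
Context {R : realType}.
Local Notation mu := (@lebesgue_measure R).
Implicit Types n : nat.

(** One step of the recursion in [mixed_norm]. The inductions on the dimension treat it by a fact
    about [Lnorm] and leave the other coordinates to the induction hypothesis. *)
Definition inner_norm n (p : R) (f : rn R n.+1 -> \bar R) (y : rn R n) : \bar R :=
  Lnorm mu p%:E (fun x => f (rn_cons (x, y))).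

Lemma mixed_normS n (u : n.+1.-tuple R) f :
  mixed_norm u f = mixed_norm (behead_tuple u) (inner_norm (thead u) f).
Proof. by []. Qed.

Lemma inner_norm_ge0 n p (f : rn R n.+1 -> \bar R) y : 0 <= inner_norm p f y.
Proof. exact: Lnorm_ge0. Qed.

Lemma measurable_section n (f : rn R n.+1 -> \bar R) y : measurable_fun setT f ->
  measurable_fun setT (fun x => f (rn_cons (x, y))).
Proof.
by move=> mf; apply: (measurableT_comp mf); exact: measurable_fun_rn_cons.
Qed.

Lemma measurable_inner_norm n p (f : rn R n.+1 -> \bar R) :
  measurable_fun setT f -> (forall z, 0 <= f z) ->
  measurable_fun setT (inner_norm p f).
Proof.
move=> mf f0; apply: (@measurable_Lnorm _ _ _ _ _ mu p
  (fun z : rn R n * measurableTypeR R => f (rn_cons (z.2, z.1)))) => //.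
apply: (measurableT_comp mf); apply: measurable_fun_rn_cons.
  exact: measurable_snd.
exact: measurable_fst.
Qed.

Lemma mixed_norm_ge0 n (u : n.-tuple R) f : 0 <= mixed_norm u f.
Proof. by elim: n u f => [|n IH] u f /=; [exact: abse_ge0|exact: IH]. Qed.

Lemma mixed_norm_abse n (u : n.-tuple R) f : mixed_norm u (abse \o f) = mixed_norm u f.
Proof.
elim: n u f => [|n IH] u f /=; first by rewrite abse_id.
by congr mixed_norm; apply/funext => y; rewrite -[RHS]Lnorm_abse.
Qed.

Lemma le_mixed_norm n (u : n.-tuple R) f g : (forall i, 0 < tnth u i)%R ->
  measurable_fun setT f -> measurable_fun setT g ->
  (forall x, 0 <= f x) -> (forall x, f x <= g x) ->
  mixed_norm u f <= mixed_norm u g.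
Proof.
elim: n u f g => [|n IH] u f g u0 mf mg f0 fg.
  by rewrite /= !gee0_abs//; exact: le_trans (fg _).
have g0 x : 0 <= g x by exact: le_trans (fg x).
have [uh ut] := tuple_cons_gt0 u0; rewrite !mixed_normS; apply: IH => //.
- exact: measurable_inner_norm.
- exact: measurable_inner_norm.
- by move=> y; exact: inner_norm_ge0.
- by move=> y; apply: le_Lnorm => //; exact: measurable_section.
Qed.

Lemma mixed_norm_ge0Z n (u : n.-tuple R) c f : (forall i, 0 < tnth u i)%R ->
  0 <= c -> measurable_fun setT f -> (forall x, 0 <= f x) ->
  mixed_norm u (fun x => c * f x) = c * mixed_norm u f.
Proof.
elim: n u f => [|n IH] u f u0 c0 mf f0.
  by rewrite /= !gee0_abs// mule_ge0.
have [uh ut] := tuple_cons_gt0 u0; rewrite !mixed_normS -IH//.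
- congr mixed_norm; apply/funext => y; apply: Lnorm_ge0Z => //.
  exact: measurable_section.
- exact: measurable_inner_norm.
- by move=> y; exact: inner_norm_ge0.
Qed.

(** The parameter space is arbitrary so that, in the induction, the coordinates not yet integrated
    can join the parameter. *)
Lemma measurable_mixed_norm d (S : measurableType d) n (u : n.-tuple R)
    (F : S * rn R n -> \bar R) :
  measurable_fun setT F -> (forall z, 0 <= F z) ->
  measurable_fun setT (fun s => mixed_norm u (fun y => F (s, y))).
Proof.
elim: n u F => [|n IH] u F mF F0.
  apply: measurableT_comp => //; apply: (measurableT_comp mF).
  exact: measurable_pair2.
apply: (IH _ (fun z => inner_norm (thead u) (fun y => F (z.1, y)) z.2)); last first.
  by move=> z; exact: inner_norm_ge0.
apply: (@measurable_Lnorm _ _ _ _ _ mu (thead u)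
  (fun z : (S * rn R n) * measurableTypeR R => F (z.1.1, rn_cons (z.2, z.1.2)))) => //.
apply: (measurableT_comp mF); apply/measurable_fun_pair => /=.
  by apply: measurableT_comp; exact: measurable_fst.
apply: measurable_fun_rn_cons; first exact: measurable_snd.
by apply: measurableT_comp; [exact: measurable_snd|exact: measurable_fst].
Qed.

Lemma mixed_norm_ereal_sup n (u : n.-tuple R) (f : nat -> rn R n -> \bar R) :
  (forall i, 0 < tnth u i)%R ->
  (forall m, measurable_fun setT (f m)) -> (forall m x, 0 <= f m x) ->
  (forall x, nondecreasing_seq (f ^~ x)) ->
  mixed_norm u (fun x => ereal_sup (range (f ^~ x))) =
  ereal_sup (range (fun m => mixed_norm u (f m))).
Proof.
elim: n u f => [|n IH] u f u0 mf f0 ndf.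
  rewrite /= gee0_abs; last first.
    by apply: (le_trans (f0 0%N [tuple])); apply: ereal_sup_ubound; exists 0%N.
  by congr ereal_sup; apply: eq_imagel => m _; rewrite gee0_abs.
have [uh ut] := tuple_cons_gt0 u0; rewrite mixed_normS.
rewrite (_ : inner_norm _ _ =
    fun y => ereal_sup (range (fun m => inner_norm (thead u) (f m) y))); last first.
  apply/funext => y; apply: (Lnorm_ereal_sup _ uh).
  - by move=> m; exact: measurable_section.
  - by move=> m x; exact: f0.
  - by move=> x; exact: ndf.
apply: IH => //.
- by move=> m; exact: measurable_inner_norm.
- by move=> m y; exact: inner_norm_ge0.
- move=> y m k mk; apply: le_Lnorm => //; try exact: measurable_section.
  by move=> x; exact: ndf.
Qed.

Lemma mixed_norm_dominated n (u : n.-tuple R) (h : nat -> rn R n -> \bar R) f :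
  (forall i, 0 < tnth u i)%R ->
  (forall m, measurable_fun setT (h m)) -> measurable_fun setT f ->
  (forall m x, 0 <= h m x) -> (forall m x, h m x <= f x) ->
  mixed_norm u f < +oo ->
  (forall x, f x < +oo -> vanishes (h ^~ x)) ->
  vanishes (fun m => mixed_norm u (h m)).
Proof.
elim: n u h f => [|n IH] u h f u0 mh mf h0 hf foo hv.
  have f0 x : 0 <= f x by exact: le_trans (hf 0%N x).
  move: foo; rewrite /= gee0_abs// => /hv.
  by apply: le_vanishes => m; rewrite gee0_abs.
have f0 x : 0 <= f x by exact: le_trans (hf 0%N x).
have [uh ut] := tuple_cons_gt0 u0.
apply: (IH _ (fun m => inner_norm (thead u) (h m)) (inner_norm (thead u) f)) => //.
- by move=> m; exact: measurable_inner_norm.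
- exact: measurable_inner_norm.
- by move=> m y; exact: inner_norm_ge0.
- by move=> m y; apply: le_Lnorm => //; exact: measurable_section.
- move=> y fy; apply: (Lnorm_dominated uh _ _ _ _ fy) => //.
  + by move=> m; exact: measurable_section.
  + exact: measurable_section.
  + by move=> x fx; exact: hv.
Qed.

(** Unlike the function [conj_exps], this relation is symmetric, so the two spaces can exchange
    roles in every inequality. *)
Definition conjugate_exponents n (u w : n.-tuple R) := forall i,
  [/\ (1 < tnth u i)%R, (1 < tnth w i)%R & ((tnth u i)^-1 + (tnth w i)^-1 = 1)%R].

Lemma conjugate_exponents_sym n (u w : n.-tuple R) :
  conjugate_exponents u w -> conjugate_exponents w u.
Proof. by move=> uw i; have [u1 w1 e] := uw i; split => //; rewrite addrC. Qed.

Lemma conjugate_exponents_gt0 n (u w : n.-tuple R) : conjugate_exponents u w ->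
  forall i, (0 < tnth u i)%R.
Proof. by move=> uw i; have [u1 _ _] := uw i; exact: lt_trans u1. Qed.

Lemma conjugate_exponents_cons n (u w : n.+1.-tuple R) : conjugate_exponents u w ->
  [/\ (1 < thead u)%R, (1 < thead w)%R, ((thead u)^-1 + (thead w)^-1 = 1)%R &
      conjugate_exponents (behead_tuple u) (behead_tuple w)].
Proof.
move=> uw; have [uh wh e] := uw ord0; split => // i.
by rewrite !tnth_behead_tuple; exact: uw.
Qed.

Lemma mixed_hoelder n (u w : n.-tuple R) f g : conjugate_exponents u w ->
  measurable_fun setT f -> measurable_fun setT g ->
  (forall x, 0 <= f x) -> (forall x, 0 <= g x) ->
  \int[leb n]_x (f x * g x) <= mixed_norm u f * mixed_norm w g.
Proof.
elim: n u w f g => [|n IH] u w f g uw mf mg f0 g0.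
  by rewrite integral_leb0 /= ?gee0_abs// => y; exact: mule_ge0.
have [uh wh e uwt] := conjugate_exponents_cons uw.
have u0 : (0 < thead u)%R by exact: lt_trans uh.
have w0 : (0 < thead w)%R by exact: lt_trans wh.
have mfg : measurable_fun setT (fun x => f x * g x) by exact: emeasurable_funM.
rewrite integral_leb_cons//; last by move=> y; rewrite mule_ge0.
rewrite !mixed_normS; apply: le_trans (IH _ _ _ _ uwt _ _ _ _).
- apply: ge0_le_integral => //.
  + by move=> y _; apply: integral_ge0 => x _; rewrite mule_ge0.
  + apply: (@measurable_integral_parameter _ _ _ _ _ mu
      (fun z : rn R n * measurableTypeR R => f (rn_cons (z.2, z.1)) * g (rn_cons (z.2, z.1)))).
      apply: (measurableT_comp mfg); apply: measurable_fun_rn_cons.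
        exact: measurable_snd.
      exact: measurable_fst.
    by move=> z; rewrite mule_ge0.
  + by apply: emeasurable_funM; exact: measurable_inner_norm.
  + move=> y _; apply: ehoelder => //; exact: measurable_section.
- exact: measurable_inner_norm.
- exact: measurable_inner_norm.
- by move=> y; exact: inner_norm_ge0.
- by move=> y; exact: inner_norm_ge0.
Qed.

End mixed_norm_ge0.

(** * Cubes, extremal functions and translations *)

Section mixed_norm_box.
Context {R : realType}.
Local Notation mu := (@lebesgue_measure R).
Implicit Types n : nat.

(** The indicator of a cube of half-side [a], written as a product so that one coordinate splits
    off, as in [box_rn_cons]. *)
Definition box n (a : R) (y : rn R n) : R := \prod_(i < n) \1_(`[- a, a]) (tnth y i).

Lemma box_rn_cons n (a x : R) (y : rn R n) :
  box a (rn_cons (x, y)) = (\1_(`[(- a)%R, a]) x * box a y)%R.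
Proof.
by rewrite /box big_ord_recl; congr (_ * _)%R; apply: eq_bigr => i _; rewrite tnthS.
Qed.

Lemma box_ge0 n (a : R) (y : rn R n) : (0 <= box a y)%R.
Proof. by apply: prodr_ge0 => i _; rewrite indicE. Qed.

Lemma box1 n (a : R) (y : rn R n) : (forall i, `|tnth y i| <= a)%R -> box a y = 1%R.
Proof.
move=> ya; apply: big1 => i _; rewrite indicE mem_set//= in_itv/=.
by rewrite -ler_norml.
Qed.

Lemma measurable_box n (a : R) : measurable_fun setT (@box n a).
Proof.
apply: measurable_prod => i _; apply: (measurableT_comp _ (measurable_tnth i)).
exact: measurable_indic.
Qed.

Lemma Lnorm_itv (p a : R) : (0 < p)%R -> (0 <= a)%R ->
  Lnorm mu p%:E (fun x => (\1_(`[(- a)%R, a]) x)%:E) = ((a *+ 2) `^ p^-1)%:E.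
Proof.
move=> p0 a0; rewrite Lnorm_ge0E; last by move=> x; rewrite lee_fin indicE.
under eq_integral => x _.
  rewrite (_ : _ `^ p = (\1_(`[(- a)%R, a]) x)%:E); last first.
    by rewrite poweR_EFin indicE; case: (_ \in _); rewrite ?powR1 ?powR0// gt_eqF.
  over.
rewrite integral_indic// setIT -poweR_EFin; congr (_ `^ _).
rewrite [LHS](lebesgue_measure_itv `[(- a)%R, a])/= lte_fin; case: ltP => aa; last first.
  by have -> : a = 0%R; [apply/eqP; rewrite eq_le a0 andbT; lra|rewrite mul0rn].
by rewrite -EFinB opprK mulr2n.
Qed.

(** A bound by a multiple of [box] survives an inner norm with another constant. This stability
    feeds the inductions below. *)
Lemma inner_norm_box n p (a M : R) (f : rn R n.+1 -> \bar R) y : (0 < p)%R ->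
  (0 <= a)%R -> (0 <= M)%R -> measurable_fun setT f -> (forall z, 0 <= f z) ->
  (forall z, f z <= (M * box a z)%:E) ->
  inner_norm p f y <= (M * (a *+ 2) `^ p^-1 * box a y)%:E.
Proof.
move=> p0 a0 M0 mf f0 fM.
apply: (@le_trans _ _ (Lnorm mu p%:E (fun x => (M * box a y)%:E * (\1_(`[(- a)%R, a]) x)%:E))).
  apply: le_Lnorm => //.
  - exact: measurable_section.
  - by apply: emeasurable_funM => //; apply/measurable_EFinP; exact: measurable_indic.
  - by move=> x; rewrite -EFinM -mulrA (mulrC (box _ _)) -box_rn_cons.
have c0 : 0 <= (M * box a y)%:E by rewrite lee_fin mulr_ge0// box_ge0.
have mi : measurable_fun setT (fun x => (\1_(`[(- a)%R, a]) x)%:E : \bar R).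
  by apply/measurable_EFinP; exact: measurable_indic.
have i0 x : 0 <= (\1_(`[(- a)%R, a]) x)%:E :> \bar R by rewrite lee_fin indicE.
by rewrite Lnorm_ge0Z// Lnorm_itv// -EFinM mulrAC.
Qed.

Lemma mixed_norm_box_lty n (u : n.-tuple R) (a M : R) f : (forall i, 0 < tnth u i)%R ->
  (0 <= a)%R -> (0 <= M)%R -> measurable_fun setT f -> (forall z, 0 <= f z) ->
  (forall z, f z <= (M * box a z)%:E) -> mixed_norm u f < +oo.
Proof.
elim: n u f M => [|n IH] u f M u0 a0 M0 mf f0 fM.
  by rewrite /= gee0_abs// (le_lt_trans (fM _))// ltry.
have [uh ut] := tuple_cons_gt0 u0.
apply: (IH _ _ (M * (a *+ 2) `^ (thead u)^-1)%R) => //.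
- by rewrite mulr_ge0// powR_ge0.
- exact: measurable_inner_norm.
- by move=> y; exact: inner_norm_ge0.
- by move=> y; exact: inner_norm_box.
Qed.

(** The extremal function is a product: [phi] is extremal in the first coordinate, with all other
    variables as parameters, and [psi] comes from the induction hypothesis for the inner norms [N].
    The bound by [box] ensures the finite norms that [Lnorm_extremal] asks for. The parameter [s]
    will be, among others, the center of a ball. *)
Lemma mixed_extremal d (S : measurableType d) n (u w : n.-tuple R) (a M : R)
    (F : S * rn R n -> \bar R) : conjugate_exponents u w ->
  (0 <= a)%R -> (0 <= M)%R ->
  measurable_fun setT F -> (forall z, 0 <= F z) ->
  (forall s y, F (s, y) <= (M * box a y)%:E) ->
  exists phi : S * rn R n -> \bar R, [/\ measurable_fun setT phi,
    forall z, 0 <= phi z,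
    forall s, mixed_norm u (fun y => phi (s, y)) <= 1 &
    forall s, \int[leb n]_y (phi (s, y) * F (s, y)) =
              mixed_norm w (fun y => F (s, y))].
Proof.
elim: n u w M F => [|n IH] u w M F uw a0 M0 mF F0 FM.
  exists (cst 1); split => //.
  - by move=> s; rewrite /= normr1.
  - move=> s; rewrite integral_leb0; last by move=> y; rewrite mul1e.
    by rewrite /= gee0_abs// mul1e.
have [uh wh e uwt] := conjugate_exponents_cons uw.
have u0 : (0 < thead u)%R by exact: lt_trans uh.
have w0 : (0 < thead w)%R by exact: lt_trans wh.
have mFs s : measurable_fun setT (fun y => F (s, y)).
  by apply: (measurableT_comp mF); exact: pair1_measurable.
pose G (z : (S * rn R n) * measurableTypeR R) := F (z.1.1, rn_cons (z.2, z.1.2)).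
have mG : measurable_fun setT G.
  apply: (measurableT_comp mF); apply/measurable_fun_pair => /=.
    by apply: measurableT_comp; exact: measurable_fst.
  apply: measurable_fun_rn_cons; first exact: measurable_snd.
  by apply: measurableT_comp; [exact: measurable_snd|exact: measurable_fst].
pose N (z : S * rn R n) := Lnorm mu (thead w)%:E (fun x => G (z, x)).
have NM s y : N (s, y) <= (M * (a *+ 2) `^ (thead w)^-1 * box a y)%:E.
  by apply: (@inner_norm_box _ _ _ _ (fun z => F (s, z))).
have [psi [mpsi psi0 psi1 psiN]] := IH _ _ _ N uwt a0
  (mulr_ge0 M0 (powR_ge0 _ _)) (measurable_Lnorm mu _ mG (fun z => F0 _))
  (fun z => Lnorm_ge0 _ _ _) NM.
have [phi [mphi phi0 phi1 phiN]] := @Lnorm_extremal _ _ _ _ _ mu _ _ G u0 wh e mG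
  (fun z => F0 _) (fun z => le_lt_trans (NM z.1 z.2) (ltry _)).
pose Phi (z : S * rn R n.+1) :=
  phi ((z.1, behead_tuple z.2), thead z.2) * psi (z.1, behead_tuple z.2).
have mpb : measurable_fun setT (fun z : S * rn R n.+1 => (z.1, behead_tuple z.2) : S * rn R n).
  apply/measurable_fun_pair => /=; first exact: measurable_fst.
  by apply: (measurableT_comp (@measurable_behead_tuple R n)); exact: measurable_snd.
have PhiE s x y : Phi (s, rn_cons (x, y)) = phi ((s, y), x) * psi (s, y).
  by rewrite /Phi /= behead_rn_cons thead_rn_cons.
have Phi0 z : 0 <= Phi z by rewrite mule_ge0.
have mPhi : measurable_fun setT Phi.
  apply: emeasurable_funM; last exact: (measurableT_comp mpsi).
  apply: (measurableT_comp mphi); apply/measurable_fun_pair => //=.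
  by apply: (measurableT_comp (@measurable_thead R n)); exact: measurable_snd.
have mphis s y : measurable_fun setT (fun x => phi ((s, y), x)).
  by apply: (measurableT_comp mphi); exact: pair1_measurable.
have mpsis s : measurable_fun setT (fun y => psi (s, y)).
  by apply: (measurableT_comp mpsi); exact: pair1_measurable.
have mPhis s : measurable_fun setT (fun y => Phi (s, y)).
  by apply: (measurableT_comp mPhi); exact: pair1_measurable.
exists Phi; split => //.
- move=> s; rewrite mixed_normS; apply: le_trans (psi1 s).
  have [u'0 ut0] := tuple_cons_gt0 (conjugate_exponents_gt0 uw).
  apply: le_mixed_norm => //.
  + exact: measurable_inner_norm.
  + by move=> y; exact: inner_norm_ge0.
  + move=> y; rewrite /inner_norm.
    under eq_Lnorm do rewrite PhiE muleC.
    rewrite Lnorm_ge0Z// -[leRHS]mule1.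
    by apply: lee_wpmul2l.
- move=> s; rewrite integral_leb_cons; last 2 first.
  + exact: emeasurable_funM.
  + by move=> y; rewrite mule_ge0.
  rewrite mixed_normS -psiN; apply: eq_integral => y _.
  under eq_integral do rewrite PhiE muleAC muleC.
  rewrite ge0_integralZl//.
  + by congr (_ * _); exact: phiN.
  + apply: emeasurable_funM => //.
    exact: (@measurable_section R n (fun z => F (s, z)) y (mFs s)).
  + by move=> x _; rewrite mule_ge0.
Qed.

Definition translate n (z y : rn R n) : rn R n := [tuple (tnth y i + tnth z i)%R | i < n].

Lemma translate_rn_cons n (z : rn R n.+1) x (y : rn R n) :
  translate z (rn_cons (x, y)) = rn_cons ((x + thead z)%R, translate (behead_tuple z) y).
Proof.
apply: eq_from_tnth => i; rewrite tnth_mktuple.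
case: (unliftP ord0 i) => [j ->|->]; last by rewrite !tnth0.
by rewrite !tnthS tnth_mktuple tnth_behead_tuple.
Qed.

Lemma measurable_translate d (S : measurableType d) n (f g : S -> rn R n) :
  measurable_fun setT f -> measurable_fun setT g ->
  measurable_fun setT (fun s => translate (f s) (g s)).
Proof.
move=> mf mg; apply/measurable_fun_tnthP => i.
rewrite (_ : _ \o _ = fun s => (tnth (g s) i + tnth (f s) i)%R); last first.
  by apply/funext => s /=; rewrite tnth_mktuple.
by apply: measurable_funD; apply: (measurableT_comp (measurable_tnth i)).
Qed.

Lemma measurable_translatel n (z : rn R n) : measurable_fun setT (translate z).
Proof. by apply: measurable_translate. Qed.

Lemma mixed_norm_translate n (u : n.-tuple R) (z : rn R n) f : (forall i, 0 < tnth u i)%R ->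
  measurable_fun setT f -> (forall y, 0 <= f y) ->
  mixed_norm u (fun y => f (translate z y)) = mixed_norm u f.
Proof.
elim: n u z f => [|n IH] u z f u0 mf f0.
  by rewrite /= (rn0_eq (translate z _)).
have [uh ut] := tuple_cons_gt0 u0; rewrite !mixed_normS.
rewrite -[RHS](IH _ (behead_tuple z)) => //; last 2 first.
- exact: measurable_inner_norm.
- by move=> y; exact: inner_norm_ge0.
congr mixed_norm; apply/funext => y; rewrite /inner_norm !Lnorm_ge0E//.
congr (_ `^ _); under eq_integral do rewrite translate_rn_cons.
apply: (@integral_lebesgue_addr _ _
  (fun x => f (rn_cons (x, translate (behead_tuple z) y)) `^ thead u)).
- by apply: measurable_poweR_fun; exact: measurable_section.
- by move=> x; exact: poweR_ge0.
Qed.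

Lemma integral_leb_translate n (z : rn R n) (f : rn R n -> \bar R) :
  measurable_fun setT f -> (forall y, 0 <= f y) ->
  \int[leb n]_y f (translate z y) = \int[leb n]_y f y.
Proof.
elim: n z f => [|n IH] z f mf f0.
  by rewrite !integral_leb0// (rn0_eq (translate z _)).
rewrite integral_leb_cons//; last exact: (measurableT_comp mf (measurable_translatel z)).
have mi : measurable_fun setT (fun y : rn R n => \int[mu]_x f (rn_cons (x, y))).
  apply: (@measurable_integral_parameter _ _ _ _ _ mu
    (fun z : rn R n * measurableTypeR R => f (rn_cons (z.2, z.1)))) => //.
  apply: (measurableT_comp mf); apply: measurable_fun_rn_cons.
    exact: measurable_snd.
  exact: measurable_fst.
rewrite integral_leb_cons// -[RHS](IH (behead_tuple z))//; last first.
  by move=> y; apply: integral_ge0 => x _.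
apply: eq_integral => y _; under eq_integral do rewrite translate_rn_cons.
apply: (@integral_lebesgue_addr _ _
  (fun x => f (rn_cons (x, translate (behead_tuple z) y)))) => //.
exact: measurable_section.
Qed.

End mixed_norm_box.

(** * Truncation in height and in support *)

Section truncation.
Context {R : realType} {n : nat}.
Implicit Types f : rn R n -> \bar R.

(** Bounded by a multiple of a [box], hence within reach of [mixed_extremal], and increasing to [f],
    hence within reach of monotone convergence. *)
Definition truncation f (m : nat) (y : rn R n) := mine (f y) m%:R%:E * (box m%:R y)%:E.

Lemma le_box (a b : R) (y : rn R n) : (a <= b)%R -> (box a y <= box b y)%R.
Proof.
move=> ab; apply: ler_prod => i _; rewrite !indicE ler0n/= ler_nat.
have [|] := boolP (tnth y i \in `[(- a)%R, a]%classic); last by [].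
rewrite inE/= in_itv/= => /andP[ya yb]; rewrite mem_set//= in_itv/=.
by rewrite (le_trans _ ya) ?lerN2//= (le_trans yb).
Qed.

Lemma box_le1 (a : R) (y : rn R n) : (box a y <= 1)%R.
Proof. by apply: prodr_ile1 => i _; rewrite indicE ler0n lern1 leq_b1. Qed.

Lemma truncation_ge0 f m y : (forall y, 0 <= f y) -> 0 <= truncation f m y.
Proof. by move=> f0; rewrite mule_ge0// ?lee_fin ?box_ge0// le_min f0 lee_fin /=. Qed.

Lemma measurable_truncation f m : measurable_fun setT f ->
  measurable_fun setT (truncation f m).
Proof.
move=> mf; apply: emeasurable_funM.
  by apply: measurable_mine => //; exact: measurable_cst.
by apply/measurable_EFinP; exact: measurable_box.
Qed.

Lemma truncation_le_box f m y : (truncation f m y <= (m%:R * box m%:R y)%:E).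
Proof.
rewrite EFinM /truncation muleC [leRHS]muleC; apply: lee_wpmul2l.
  by rewrite lee_fin box_ge0.
by rewrite ge_min lexx orbT.
Qed.

Lemma truncation_le f m y : (forall y, 0 <= f y) -> truncation f m y <= f y.
Proof.
move=> f0; rewrite -[leRHS]mule1; apply: lee_pmul.
- by rewrite le_min f0 lee_fin /=.
- by rewrite lee_fin box_ge0.
- by rewrite ge_min lexx.
- by rewrite lee_fin box_le1.
Qed.

Lemma nondecreasing_truncation f y : (forall y, 0 <= f y) ->
  nondecreasing_seq (truncation f ^~ y).
Proof.
move=> f0 m k mk; apply: lee_pmul.
- by rewrite le_min f0 lee_fin /=.
- by rewrite lee_fin box_ge0.
- by rewrite le_min ge_min lexx /= ge_min lee_fin ler_nat mk orbT.
- by rewrite lee_fin le_box// ler_nat.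
Qed.

Lemma truncation_sup f y : (forall y, 0 <= f y) ->
  ereal_sup (range (truncation f ^~ y)) = f y.
Proof.
move=> f0; apply/eqP; rewrite eq_le; apply/andP; split.
  by apply: ge_ereal_sup => _ [m _ <-]; exact: truncation_le.
have [N yN] : exists N : nat, forall i, (`|tnth y i| <= N%:R)%R.
  (* A sum of integer bounds for the coordinates bounds each of them. *)
  exists (\sum_(i < n) (Num.truncn `|tnth y i|).+1)%N => i.
  apply: (@le_trans _ _ (Num.truncn `|tnth y i|).+1%:R); first by rewrite ltW// truncnS_gt.
  by rewrite ler_nat (bigD1 i)//= leq_addr.
have trE m : (N <= m)%N -> truncation f m y = mine (f y) m%:R%:E.
  move=> Nm; rewrite /truncation box1 ?mule1// => i.
  by rewrite (le_trans (yN i))// ler_nat.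
case fyE : (f y) => [r| |]; last by have := f0 y; rewrite fyE.
- pose m := maxn N (Num.truncn r).+1.
  apply: (@le_trans _ _ (truncation f m y)); last by apply: ereal_sup_ubound; exists m.
  rewrite trE ?leq_maxl// fyE le_min lexx/= lee_fin.
  by rewrite (le_trans (ltW (truncnS_gt r)))// ler_nat leq_maxr.
- rewrite leye_eq; apply/eqP/eq_infty => r.
  pose m := maxn N (Num.truncn r).+1.
  apply: (@le_trans _ _ (truncation f m y)); last by apply: ereal_sup_ubound; exists m.
  rewrite trE ?leq_maxl// fyE le_min leey/= lee_fin.
  by rewrite (le_trans (ltW (truncnS_gt r)))// ler_nat leq_maxr.
Qed.

End truncation.

(** * Minkowski's integral inequality *)

Section mixed_minkowski.
Context d (W : measurableType d) {R : realType} {n : nat}.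
Variable kappa : {sigma_finite_measure set W -> \bar R}.

(* The norm of the truncated function is attained against some [phi] of norm at most
   1 in the conjugate space; Tonelli then moves the integral outside. *)
Lemma mixed_minkowski (u w : n.-tuple R) (G : W * rn R n -> \bar R) :
  conjugate_exponents u w -> measurable_fun setT G -> (forall z, 0 <= G z) ->
  mixed_norm u (fun y => \int[kappa]_s G (s, y)) <=
  \int[kappa]_s mixed_norm u (fun y => G (s, y)).
Proof.
move=> uw mG G0; pose A y := \int[kappa]_s G (s, y).
have A0 y : 0 <= A y by apply: integral_ge0.
have mA : measurable_fun setT A.
  exact: (measurable_fun_fubini_tonelli_G (m1 := kappa)).
rewrite (_ : (fun y => _) = fun y => ereal_sup (range (truncation A ^~ y))); last first.
  by apply/funext => y; rewrite truncation_sup.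
rewrite mixed_norm_ereal_sup; last 4 first.
- exact: conjugate_exponents_gt0 uw.
- by move=> m; exact: measurable_truncation.
- by move=> m y; exact: truncation_ge0.
- by move=> y; exact: nondecreasing_truncation.
apply: ge_ereal_sup => _ [m _ <-].
(* There is a single function to test, so the parameter space is [unit]; [phi] has norm at most 1
   for the exponents [w], conjugate to [u]. *)
have [|phi [mphi phi0 phi1 phiE]] := @mixed_extremal R _ unit _ w u m%:R m%:R
  (fun z => truncation A m z.2) (conjugate_exponents_sym uw) (ler0n _ _) (ler0n _ _) _
  (fun z => truncation_ge0 m z.2 A0) (fun _ y => truncation_le_box A m y).
  by apply: measurableT_comp => //; exact: measurable_truncation.
rewrite -(phiE tt) /=.
have mphit : measurable_fun setT (fun y => phi (tt, y)).
  by apply: (measurableT_comp mphi); exact: pair1_measurable.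
have mGs s : measurable_fun setT (fun y => G (s, y)).
  by apply: (measurableT_comp mG); exact: pair1_measurable.
have mGy y : measurable_fun setT (fun s => G (s, y)).
  by apply: (measurableT_comp mG); exact: pair2_measurable.
have mPG : measurable_fun setT (fun z : W * rn R n => phi (tt, z.2) * G z).
  apply: emeasurable_funM => //; apply: (measurableT_comp mphit).
  exact: measurable_snd.
apply: (@le_trans _ _ (\int[leb n]_y \int[kappa]_s (phi (tt, y) * G (s, y)))).
  apply: ge0_le_integral => //.
  - by move=> y _; rewrite mule_ge0// truncation_ge0.
  - by apply: emeasurable_funM => //; exact: measurable_truncation.
  - apply: (measurable_fun_fubini_tonelli_G (m1 := kappa)) mPG _.
    by move=> z; rewrite mule_ge0.
  - move=> y _; rewrite ge0_integralZl//; apply: lee_wpmul2l => //.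
    exact: truncation_le.
rewrite -(@fubini_tonelli _ _ _ _ _ kappa (leb n) (fun z => phi (tt, z.2) * G z))//=; last first.
  by move=> z; rewrite mule_ge0.
apply: ge0_le_integral => //.
- by move=> s _; apply: integral_ge0 => y _; rewrite mule_ge0.
- apply: (measurable_fun_fubini_tonelli_F (m2 := leb n)) mPG _.
  by move=> z; rewrite mule_ge0.
- exact: measurable_mixed_norm.
- move=> s _; apply: le_trans (mixed_hoelder (conjugate_exponents_sym uw) _ _ _ _) _ => //.
  rewrite -[leRHS]mul1e; apply: lee_wpmul2r => //; exact: mixed_norm_ge0.
Qed.

End mixed_minkowski.

(** * Balls *)

Section balls.
Context {R : realType} {n : nat}.
Local Notation rn := (rn R n).
Implicit Types (x y : rn) (t : R).

Lemma euclid_distC x y : euclid_dist x y = euclid_dist y x.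
Proof.
by rewrite /euclid_dist; congr Num.sqrt; apply: eq_bigr => i _; rewrite -sqrrN opprB.
Qed.

Lemma euclid_dist_translate (z : rn) x y : euclid_dist (translate z x) (translate z y) = euclid_dist x y.
Proof.
rewrite /euclid_dist; congr Num.sqrt; apply: eq_bigr => i _.
by rewrite !tnth_mktuple opprD addrACA subrr addr0.
Qed.

Lemma translateC x y : translate x y = translate y x.
Proof. by apply: eq_from_tnth => i; rewrite !tnth_mktuple addrC. Qed.

Lemma translate_origin x : translate x (@origin R n) = x.
Proof. by apply: eq_from_tnth => i; rewrite !tnth_mktuple add0r. Qed.

Lemma euclid_dist_lt t x y : (0 < t)%R ->
  (euclid_dist x y < t)%R = (\sum_(i < n) (tnth x i - tnth y i) ^+ 2 < t ^+ 2)%R.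
Proof.
move=> t0; rewrite -[in RHS](@sqr_sqrtr _ (\sum_(i < n) _)%R); last first.
  by apply: sumr_ge0 => i _; exact: sqr_ge0.
by rewrite ltr_pXn2r// ?nnegrE ?sqrtr_ge0// ltW.
Qed.

Lemma measurable_euclid_dist :
  measurable_fun setT (fun z : rn * rn => euclid_dist z.1 z.2).
Proof.
have ms : measurable_fun setT (fun z : rn * rn =>
    \sum_(i < n) (tnth z.1 i - tnth z.2 i) ^+ 2)%R.
  apply: measurable_sum => i; apply: measurable_funX; apply: measurable_funB.
    by apply: (measurableT_comp (measurable_tnth i)); exact: measurable_fst.
  by apply: (measurableT_comp (measurable_tnth i)); exact: measurable_snd.
rewrite (_ : (fun z => _) = fun z : rn * rn =>
    ((\sum_(i < n) (tnth z.1 i - tnth z.2 i) ^+ 2) `^ 2^-1)%R).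
  exact: (measurableT_comp (measurable_powR _) ms).
apply/funext => z; rewrite powR12_sqrt//.
by apply: sumr_ge0 => i _; exact: sqr_ge0.
Qed.

Lemma measurable_oball t : measurable [set z : rn * rn | oball z.1 t z.2].
Proof.
rewrite -[X in measurable X]setTI.
exact: (measurable_fun_ltr measurable_euclid_dist (measurable_cst t)).
Qed.

(** Taken as a function of the pair of center and point, so that it is jointly measurable and
    Tonelli's theorem applies. *)
Definition ball_ind t (z : rn * rn) : \bar R := (\1_(oball z.1 t) z.2)%:E.

Lemma ball_ind_ge0 t z : 0 <= ball_ind t z.
Proof. by rewrite lee_fin indicE. Qed.

Lemma ball_indE t x y : ball_ind t (x, y) = ((euclid_dist x y < t)%R : nat)%:R%:E.
Proof.
rewrite /ball_ind indicE; congr (_%:R%:E); congr nat_of_bool.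
by apply/idP/idP; rewrite inE.
Qed.

Lemma ball_ind_le1 t z : ball_ind t z <= 1.
Proof. by case: z => x y; rewrite ball_indE lee_fin lern1 leq_b1. Qed.

Lemma ball_indC t x y : ball_ind t (x, y) = ball_ind t (y, x).
Proof. by rewrite !ball_indE euclid_distC. Qed.

Lemma ball_ind_translate t (z : rn) x y : ball_ind t (translate z x, translate z y) = ball_ind t (x, y).
Proof. by rewrite !ball_indE euclid_dist_translate. Qed.

Lemma measurable_ball_ind t : measurable_fun setT (ball_ind t).
Proof.
apply/measurable_EFinP.
rewrite (_ : (fun z => _) = \1_[set z : rn * rn | oball z.1 t z.2]).
  by apply: measurable_indic; exact: measurable_oball.
by apply/funext => z; rewrite !indicE; congr (_%:R).
Qed.

Lemma measurable_ball_ind1 t x : measurable_fun setT (fun y => ball_ind t (x, y)).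
Proof. by apply: (measurableT_comp (measurable_ball_ind t)); exact: pair1_measurable. Qed.

(** In each coordinate [(p + q)^2 <= 2 p^2 + 2 q^2]. Summing gives a squared distance below [4 t^2],
    which does the work of the triangle inequality. *)
Lemma ball_ind_mul t x y (z : rn) :
  ball_ind t (x, y) * ball_ind t (z, y) <= ball_ind (t *+ 2) (z, x).
Proof.
rewrite !ball_indE -EFinM lee_fin -natrM mulnb ler_nat.
have [/andP[xy zy]|] := boolP ((euclid_dist x y < t) && (euclid_dist z y < t))%R;
  last by [].
have t0 : (0 < t)%R by apply: le_lt_trans xy; exact: sqrtr_ge0.
rewrite lt0b; move: xy zy; rewrite !euclid_dist_lt ?pmulrn_lgt0// => xy zy.
apply: (@le_lt_trans _ _ (\sum_(i < n) ((tnth x i - tnth y i) ^+ 2 *+ 2 +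
    (tnth z i - tnth y i) ^+ 2 *+ 2))%R).
  apply: ler_sum => i _; set a := tnth x i; set b := tnth y i; set c := tnth z i.
  rewrite -subr_ge0 (_ : (_ - _ = ((a - b) + (c - b)) ^+ 2)%R) ?sqr_ge0//; ring.
rewrite big_split/= !sumrMnl.
rewrite -mulr_natl -[X in (_ + X < _)%R]mulr_natl; nra.
Qed.

Lemma ball_ind_le_box t y : ball_ind t (@origin R n, y) <= (box t y)%:E.
Proof.
rewrite ball_indE lee_fin; case: ltP => [yt|_]; last by rewrite box_ge0.
rewrite box1// => i; have t0 : (0 < t)%R by apply: le_lt_trans yt; exact: sqrtr_ge0.
apply: ltW; move: yt; rewrite euclid_dist_lt// => yt.
rewrite -(@ltr_pXn2r _ 2) ?nnegrE ?(ltW t0)// real_normK ?num_real//.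
apply: le_lt_trans yt; rewrite (bigD1 i)//= tnth_mktuple sub0r sqrrN lerDl.
by apply: sumr_ge0 => j _; exact: sqr_ge0.
Qed.

(** With half-side [t / n.+1] the squared distance to the origin is at most [n t^2 / (n + 1)^2],
    which is less than [t^2], also for [n = 0]. *)
Lemma box_le_ball_ind t y : (0 < t)%R ->
  (box (t / n.+1%:R) y)%:E <= ball_ind t (@origin R n, y).
Proof.
move=> t0; have d0 : (0 < t / n.+1%:R)%R by rewrite divr_gt0.
have [yb|nb] := boolP [forall i, (`|tnth y i| <= t / n.+1%:R)%R].
  rewrite box1; last by move=> i; exact: (forallP yb).
  rewrite ball_indE; suff -> : (euclid_dist (@origin R n) y < t)%R by [].
  rewrite euclid_dist_lt//; apply: (@le_lt_trans _ _ (\sum_(i < n) (t / n.+1%:R) ^+ 2)%R).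
    apply: ler_sum => i _; rewrite tnth_mktuple sub0r sqrrN.
    rewrite -real_normK ?num_real// ler_sqr ?nnegrE ?(ltW d0)//.
    exact: (forallP yb).
  rewrite sumr_const card_ord -[ltLHS]mulr_natl expr_div_n mulrCA gtr_pMr ?exprn_gt0//.
  rewrite ltr_pdivrMr ?exprn_gt0// mul1r -natrX ltr_nat.
  by rewrite -mulnn mulSn leq_addr.
move: nb; rewrite negb_forall => /existsP[i yi].
rewrite (_ : box _ _ = 0%R) ?ball_ind_ge0//.
rewrite /box (bigD1 i)//= indicE memNset ?mul0r//= in_itv/= -ler_norml.
exact/negP.
Qed.

Lemma integral_box (a : R) : (0 <= a)%R ->
  \int[leb n]_y (box a y)%:E = ((a *+ 2) ^+ n)%:E.
Proof.
move=> a0; elim: n => [|k IH].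
  by rewrite integral_leb0 ?/box ?big_ord0// => y; rewrite lee_fin box_ge0.
rewrite integral_leb_cons; last 2 first.
- by apply/measurable_EFinP; exact: measurable_box.
- by move=> y; rewrite lee_fin box_ge0.
have mi : measurable_fun setT (fun x : R => (\1_(`[(- a)%R, a]) x)%:E : \bar R).
  by apply/measurable_EFinP; exact: measurable_indic.
have i0 (x : R) : 0 <= (\1_(`[(- a)%R, a]) x)%:E :> \bar R by rewrite lee_fin indicE.
have b0 (y : Defs.rn R k) : 0 <= (box a y)%:E by rewrite lee_fin box_ge0.
under eq_integral => y _.
  under eq_integral do rewrite box_rn_cons EFinM muleC.
  rewrite ge0_integralZl//.
  have := @Lnorm_itv R 1 a ltr01 a0; rewrite Lnorm1 invr1 powRr1 ?mulrn_wge0//.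
  under eq_integral do rewrite gee0_abs//.
  move=> ->; over.
have mb : measurable_fun setT (fun y : Defs.rn R k => (box a y)%:E).
  by apply/measurable_EFinP; exact: measurable_box.
rewrite ge0_integralZr// ?lee_fin ?mulrn_wge0//.
by rewrite IH -EFinM exprSr.
Qed.

Definition ball_volume t := \int[leb n]_y ball_ind t (@origin R n, y).

Lemma integral_ball_ind t x : \int[leb n]_y ball_ind t (x, y) = ball_volume t.
Proof.
rewrite -(integral_leb_translate x); last 2 first.
- exact: measurable_ball_ind1.
- by move=> y; exact: ball_ind_ge0.
by apply: eq_integral => y _; rewrite -[X in ball_ind _ (X, _)]translate_origin ball_ind_translate.
Qed.

Lemma ball_volume_lty t : (0 < t)%R -> ball_volume t < +oo.
Proof.
move=> t0; apply: (@le_lt_trans _ _ (\int[leb n]_y (box t y)%:E)).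
  apply: ge0_le_integral => //.
  - by move=> y _; exact: ball_ind_ge0.
  - exact: measurable_ball_ind1.
  - by apply/measurable_EFinP; exact: measurable_box.
  - by move=> y _; exact: ball_ind_le_box.
by rewrite integral_box ?ltry// ltW.
Qed.

Lemma ball_volume_gt0 t : (0 < t)%R -> 0 < ball_volume t.
Proof.
move=> t0; have d0 : (0 < t / n.+1%:R)%R by rewrite divr_gt0.
apply: (@lt_le_trans _ _ (\int[leb n]_y (box (t / n.+1%:R) y)%:E)).
  by rewrite integral_box ?ltW// lte_fin exprn_gt0// pmulrn_lgt0.
apply: ge0_le_integral => //.
- by move=> y _; rewrite lee_fin box_ge0.
- by apply/measurable_EFinP; exact: measurable_box.
- exact: measurable_ball_ind1.
- by move=> y _; exact: box_le_ball_ind.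
Qed.

Definition ball_norm (v : n.-tuple R) t :=
  mixed_norm v (fun y => ball_ind t (@origin R n, y)).

Lemma mixed_norm_ball_ind (v : n.-tuple R) t x : (forall i, 0 < tnth v i)%R ->
  mixed_norm v (fun y => ball_ind t (x, y)) = ball_norm v t.
Proof.
move=> v0; rewrite -(mixed_norm_translate x v0); last 2 first.
- exact: measurable_ball_ind1.
- by move=> y; exact: ball_ind_ge0.
congr mixed_norm; apply/funext => y.
by rewrite -[X in ball_ind _ (X, _)]translate_origin ball_ind_translate.
Qed.

Lemma ball_norm_lty (v : n.-tuple R) t : (forall i, 0 < tnth v i)%R -> (0 < t)%R ->
  ball_norm v t < +oo.
Proof.
move=> v0 t0; apply: (@mixed_norm_box_lty _ _ _ t 1) => //.
- exact: ltW.
- exact: measurable_ball_ind1.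
- by move=> y; exact: ball_ind_ge0.
- by move=> y; rewrite mul1r; exact: ball_ind_le_box.
Qed.

(** Hoelder's inequality bounds the volume of the ball by the product of the norms of its indicator
    for [v] and for [w], so a zero norm would force a zero volume. *)
Lemma ball_norm_gt0 (v w : n.-tuple R) t : conjugate_exponents v w -> (0 < t)%R ->
  0 < ball_norm v t.
Proof.
move=> vw t0; rewrite lt0e mixed_norm_ge0 andbT; apply/eqP => v0.
have : ball_volume t <= ball_norm v t * ball_norm w t.
  apply: le_trans (mixed_hoelder vw _ _ _ _).
  - apply: ge0_le_integral => //.
    + by move=> y _; exact: ball_ind_ge0.
    + exact: measurable_ball_ind1.
    + by apply: emeasurable_funM; exact: measurable_ball_ind1.
    + move=> y _; rewrite ball_indE -EFinM lee_fin -natrM mulnb andbb.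
      by [].
  - exact: measurable_ball_ind1.
  - exact: measurable_ball_ind1.
  - by move=> y; exact: ball_ind_ge0.
  - by move=> y; exact: ball_ind_ge0.
by rewrite v0 mul0e leNgt ball_volume_gt0.
Qed.

End balls.

(** * Slice norms *)

Section slice.
Context {R : realType} {n : nat}.
Local Notation rn := (rn R n).
Local Notation ball_volume := (@ball_volume R n).
Implicit Types (t : R) (u v : n.-tuple R) (f g : rn -> \bar R).

Definition local_norm v t f (x : rn) := mixed_norm v (fun y => f y * ball_ind t (x, y)).

(* The slice norm without its normalizing denominator, which does not depend on x. *)
Definition slice u v t f := mixed_norm u (local_norm v t f).

Lemma local_norm_ge0 v t f x : 0 <= local_norm v t f x.
Proof. exact: mixed_norm_ge0. Qed.

Lemma slice_ge0 u v t f : 0 <= slice u v t f.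
Proof. exact: mixed_norm_ge0. Qed.

Lemma measurable_ball_section f t x : measurable_fun setT f ->
  measurable_fun setT (fun y => f y * ball_ind t (x, y)).
Proof. by move=> mf; apply: emeasurable_funM => //; exact: measurable_ball_ind1. Qed.

Lemma ball_section_ge0 f t x y : (forall y, 0 <= f y) -> 0 <= f y * ball_ind t (x, y).
Proof. by move=> f0; rewrite mule_ge0// ball_ind_ge0. Qed.

Lemma measurable_local_norm_parameter d (S : measurableType d) v t (F : S * rn -> \bar R) :
  measurable_fun setT F -> (forall z, 0 <= F z) ->
  measurable_fun setT (fun z : S * rn => local_norm v t (fun y => F (z.1, y)) z.2).
Proof.
move=> mF F0; apply: (@measurable_mixed_norm R _ (S * rn)%type n v
  (fun z => F (z.1.1, z.2) * ball_ind t (z.1.2, z.2))); last first.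
  by move=> z; rewrite mule_ge0// ball_ind_ge0.
have m11 : measurable_fun setT (fun z : (S * rn) * rn => z.1.1).
  by apply: measurableT_comp; exact: measurable_fst.
have m12 : measurable_fun setT (fun z : (S * rn) * rn => z.1.2).
  by apply: measurableT_comp; [exact: measurable_snd|exact: measurable_fst].
have m2 : measurable_fun setT (fun z : (S * rn) * rn => z.2) by exact: measurable_snd.
apply: emeasurable_funM.
  by apply: (measurableT_comp mF); apply/measurable_fun_pair.
by apply: (measurableT_comp (measurable_ball_ind t)); apply/measurable_fun_pair.
Qed.

Lemma measurable_local_norm v t f : measurable_fun setT f -> (forall y, 0 <= f y) ->
  measurable_fun setT (local_norm v t f).
Proof.
move=> mf f0.
have mF : measurable_fun setT (fun z : unit * rn => f z.2).
  by apply: (measurableT_comp mf); exact: measurable_snd.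
exact: (measurableT_comp (measurable_local_norm_parameter v t mF (fun z => f0 _))
  (pair1_measurable tt)).
Qed.

Lemma le_local_norm v t f g x : (forall i, 0 < tnth v i)%R ->
  measurable_fun setT f -> measurable_fun setT g ->
  (forall x, 0 <= f x) -> (forall x, f x <= g x) ->
  local_norm v t f x <= local_norm v t g x.
Proof.
move=> v0 mf mg f0 fg; apply: le_mixed_norm => //.
- exact: measurable_ball_section.
- exact: measurable_ball_section.
- by move=> y; exact: ball_section_ge0.
- by move=> y; apply: lee_wpmul2r => //; exact: ball_ind_ge0.
Qed.

Lemma le_slice u v t f g : (forall i, 0 < tnth u i)%R -> (forall i, 0 < tnth v i)%R ->
  measurable_fun setT f -> measurable_fun setT g ->
  (forall x, 0 <= f x) -> (forall x, f x <= g x) ->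
  slice u v t f <= slice u v t g.
Proof.
move=> u0 v0 mf mg f0 fg; have g0 x : 0 <= g x by exact: le_trans (fg x).
apply: le_mixed_norm => //; try exact: measurable_local_norm.
- by move=> x; exact: local_norm_ge0.
- by move=> x; exact: le_local_norm.
Qed.

Lemma slice_ge0Z u v t c f : (forall i, 0 < tnth u i)%R -> (forall i, 0 < tnth v i)%R ->
  0 <= c -> measurable_fun setT f -> (forall x, 0 <= f x) ->
  slice u v t (fun x => c * f x) = c * slice u v t f.
Proof.
move=> u0 v0 c0 mf f0; rewrite /slice -mixed_norm_ge0Z//; last 2 first.
- exact: measurable_local_norm.
- by move=> x; exact: local_norm_ge0.
congr mixed_norm; apply/funext => x; rewrite -mixed_norm_ge0Z//.
- by congr mixed_norm; apply/funext => y; rewrite muleA.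
- exact: measurable_ball_section.
- by move=> y; exact: ball_section_ge0.
Qed.

Lemma slice_ereal_sup u v t (f : nat -> rn -> \bar R) :
  (forall i, 0 < tnth u i)%R -> (forall i, 0 < tnth v i)%R ->
  (forall m, measurable_fun setT (f m)) -> (forall m x, 0 <= f m x) ->
  (forall x, nondecreasing_seq (f ^~ x)) ->
  slice u v t (fun x => ereal_sup (range (f ^~ x))) =
  ereal_sup (range (fun m => slice u v t (f m))).
Proof.
move=> u0 v0 mf f0 ndf; rewrite /slice -mixed_norm_ereal_sup//.
- congr mixed_norm; apply/funext => x; rewrite -mixed_norm_ereal_sup//.
  + congr mixed_norm; apply/funext => y.
    rewrite ball_indE; case: (euclid_dist _ _ < _)%R.
      by rewrite mule1; congr ereal_sup; apply: eq_imagel => m _; rewrite mule1.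
    rewrite mule0; apply/esym/eqP; rewrite eq_le; apply/andP; split.
      by apply: ge_ereal_sup => _ [m _ <-]; rewrite mule0.
    by apply: ereal_sup_ubound; exists 0%N => //; rewrite mule0.
  + by move=> m; exact: measurable_ball_section.
  + by move=> m y; exact: ball_section_ge0.
  + by move=> y m k mk; apply: lee_wpmul2r; [exact: ball_ind_ge0|exact: ndf].
- by move=> m; exact: measurable_local_norm.
- by move=> m x; exact: local_norm_ge0.
- move=> x m k mk; apply: le_local_norm => // y; exact: ndf.
Qed.

Lemma slice_dominated u v t (h : nat -> rn -> \bar R) f :
  (forall i, 0 < tnth u i)%R -> (forall i, 0 < tnth v i)%R ->
  (forall m, measurable_fun setT (h m)) -> measurable_fun setT f ->
  (forall m x, 0 <= h m x) -> (forall m x, h m x <= f x) ->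
  slice u v t f < +oo -> (forall x, f x < +oo -> vanishes (h ^~ x)) ->
  vanishes (fun m => slice u v t (h m)).
Proof.
move=> u0 v0 mh mf h0 hf foo hv.
have f0 x : 0 <= f x by exact: le_trans (hf 0%N x).
apply: (mixed_norm_dominated u0 _ _ _ _ foo).
- by move=> m; exact: measurable_local_norm.
- exact: measurable_local_norm.
- by move=> m x; exact: local_norm_ge0.
- by move=> m x; apply: le_local_norm.
move=> x fx; apply: (mixed_norm_dominated v0 _ _ _ _ fx).
- by move=> m; exact: measurable_ball_section.
- exact: measurable_ball_section.
- by move=> m y; exact: ball_section_ge0.
- by move=> m y; apply: lee_wpmul2r => //; exact: ball_ind_ge0.
move=> y; rewrite /= ball_indE; case: (_ < _)%R => [|_].
  by rewrite mule1 => /hv; apply: le_vanishes => m; rewrite mule1.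
by move=> e e0; exists 0%N => m _; rewrite mule0 lee_fin ltW.
Qed.

(** By symmetry of the distance, the centers whose ball contains [y] form the ball around [y], and
    its volume does not depend on [y]. *)
Lemma integral_ball_indM t f : measurable_fun setT f -> (forall x, 0 <= f x) ->
  ball_volume t * \int[leb n]_y f y =
  \int[leb n]_x \int[leb n]_y (f y * ball_ind t (x, y)).
Proof.
move=> mf f0.
have mF : measurable_fun setT (fun z : rn * rn => f z.2 * ball_ind t z).
  apply: emeasurable_funM; last exact: measurable_ball_ind.
  by apply: (measurableT_comp mf); exact: measurable_snd.
have F0 (z : rn * rn) : 0 <= f z.2 * ball_ind t z by rewrite mule_ge0// ball_ind_ge0.
rewrite (@fubini_tonelli _ _ _ _ _ (leb n) (leb n) _ mF F0)/=.
have vol0 : 0 <= ball_volume t.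
  by apply: integral_ge0 => y _; exact: ball_ind_ge0.
rewrite -ge0_integralZl//; apply: eq_integral => y _.
under [RHS]eq_integral do rewrite ball_indC.
rewrite ge0_integralZl//.
- by rewrite (integral_ball_ind) muleC.
- exact: measurable_ball_ind1.
- by move=> x _; exact: ball_ind_ge0.
Qed.

Lemma slice_hoelder u w v z t f g : conjugate_exponents u w -> conjugate_exponents v z ->
  measurable_fun setT f -> measurable_fun setT g ->
  (forall x, 0 <= f x) -> (forall x, 0 <= g x) ->
  ball_volume t * \int[leb n]_y (f y * g y) <= slice u v t f * slice w z t g.
Proof.
move=> uw vz mf mg f0 g0.
have mfg : measurable_fun setT (fun y => f y * g y) by exact: emeasurable_funM.
rewrite integral_ball_indM//; last by move=> x; rewrite mule_ge0.
apply: le_trans (mixed_hoelder uw _ _ _ _); try exact: measurable_local_norm;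
  try (by move=> x; exact: local_norm_ge0).
have mF : measurable_fun setT (fun p : rn * rn => f p.2 * g p.2 * ball_ind t p).
  apply: emeasurable_funM; last exact: measurable_ball_ind.
  by apply: (measurableT_comp mfg); exact: measurable_snd.
apply: ge0_le_integral => //.
- by move=> x _; apply: integral_ge0 => y _; rewrite !mule_ge0// ball_ind_ge0.
- apply: (@measurable_integral_parameter _ _ _ _ _ (leb n) _ mF).
  by move=> p; rewrite !mule_ge0// ball_ind_ge0.
- by apply: emeasurable_funM; exact: measurable_local_norm.
move=> x _; apply: le_trans (mixed_hoelder vz _ _ _ _); try exact: measurable_ball_section;
  try (by move=> y; exact: ball_section_ge0).
rewrite le_eqVlt; apply/orP; left; apply/eqP; apply: eq_integral => y _.
by rewrite muleACA; congr (_ * _); rewrite ball_indE -EFinM -natrM mulnb andbb.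
Qed.

(* Minkowski's inequality in y and then in x, where the product of the two ball
   indicators confines x to the ball of radius 2t. *)
Lemma slice_average u w v z t (Phi : rn * rn -> \bar R) : (0 < t)%R ->
  conjugate_exponents u w -> conjugate_exponents v z ->
  measurable_fun setT Phi -> (forall p, 0 <= Phi p) ->
  slice u v t (fun y => \int[leb n]_x (Phi (x, y) * ball_ind t (x, y))) <=
  ball_volume (t *+ 2) * mixed_norm u (fun x => mixed_norm v (fun y => Phi (x, y))).
Proof.
move=> t0 uw vz mPhi Phi0.
have u0 := conjugate_exponents_gt0 uw; have v0 := conjugate_exponents_gt0 vz.
have mPhis x : measurable_fun setT (fun y => Phi (x, y)).
  by apply: (measurableT_comp mPhi); exact: pair1_measurable.
pose H x := mixed_norm v (fun y => Phi (x, y)).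
have mH : measurable_fun setT H by exact: measurable_mixed_norm.
have H0 x : 0 <= H x by exact: mixed_norm_ge0.
pose B (x : rn) := ball_ind (t *+ 2) (@origin R n, x).
have mB : measurable_fun setT B by exact: measurable_ball_ind1.
have B0 x : 0 <= B x by exact: ball_ind_ge0.
(* Here [p.2] is the center [c] and [p.1] the offset from it. In this variable the weight [B] is
   independent of [c], and the second use of Minkowski's inequality leaves translates of [H], all of
   the same norm. *)
pose G (p : rn * rn) := B p.1 * H (translate p.1 p.2).
have mG : measurable_fun setT G.
  apply: emeasurable_funM; first by apply: (measurableT_comp mB); exact: measurable_fst.
  apply: (measurableT_comp mH); apply: measurable_translate.
    exact: measurable_fst.
  exact: measurable_snd.
have G0 p : 0 <= G p by rewrite mule_ge0.
have mPb : measurable_fun setT (fun p => Phi p * ball_ind t p).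
  by apply: emeasurable_funM => //; exact: measurable_ball_ind.
have Pb0 p : 0 <= Phi p * ball_ind t p by rewrite mule_ge0// ball_ind_ge0.
have mA : measurable_fun setT (fun y => \int[leb n]_x (Phi (x, y) * ball_ind t (x, y))).
  exact: (measurable_fun_fubini_tonelli_G (m1 := leb n) _ mPb).
apply: (@le_trans _ _ (mixed_norm u (fun c => \int[leb n]_x G (x, c)))).
  apply: le_mixed_norm => //.
  - by apply: measurable_local_norm => // y; exact: integral_ge0.
  - exact: (measurable_fun_fubini_tonelli_G (m1 := leb n) _ mG).
  - by move=> x; exact: local_norm_ge0.
  move=> c.
  pose K (p : rn * rn) := Phi p * ball_ind t p * ball_ind t (c, p.2).
  have mK : measurable_fun setT K.
    apply: emeasurable_funM => //; apply: (measurableT_comp (measurable_ball_ind1 t c)).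
    exact: measurable_snd.
  have K0 p : 0 <= K p by rewrite mule_ge0// ball_ind_ge0.
  rewrite /local_norm (_ : (fun y => _ * _) = fun y => \int[leb n]_x K (x, y)); last first.
    apply/funext => y; rewrite -ge0_integralZr//.
    - by apply: (measurableT_comp mPb); exact: pair2_measurable.
    - exact: ball_ind_ge0.
  apply: le_trans (mixed_minkowski _ vz mK K0) _.
  rewrite -[leLHS](integral_leb_translate c); last 2 first.
  - exact: measurable_mixed_norm.
  - by move=> x; exact: mixed_norm_ge0.
  have mGc : measurable_fun setT (fun x => G (x, c)).
    by apply: (measurableT_comp mG); exact: pair2_measurable.
  apply: ge0_le_integral => //.
  - by move=> x _; exact: mixed_norm_ge0.
  - exact: (measurableT_comp (measurable_mixed_norm v mK K0) (measurable_translatel c)).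
  move=> x _; rewrite /G /= translateC /H -mixed_norm_ge0Z//.
  apply: le_mixed_norm => //.
  - by apply: (measurableT_comp mK); exact: pair1_measurable.
  - exact: emeasurable_funM.
  move=> y; rewrite /K /= -muleA muleC; apply: lee_wpmul2r => //.
  apply: le_trans (ball_ind_mul _ _ _ _) _.
  by rewrite /B -[leRHS](ball_ind_translate _ c) translate_origin translateC.
apply: le_trans (mixed_minkowski _ uw mG G0) _.
rewrite -ge0_integralZr//; [|by move=> x _; exact: B0|exact: mixed_norm_ge0].
rewrite le_eqVlt; apply/orP; left; apply/eqP; apply: eq_integral => x _.
rewrite /G /= mixed_norm_ge0Z//; last first.
  by apply: (measurableT_comp mH); exact: measurable_translatel.
by congr (_ * _); rewrite (@mixed_norm_translate R n u x H).
Qed.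

(** A ball of radius [t] reaches at most [t] beyond the cube in each coordinate, so local norms are
    again bounded by a multiple of a [box], and [mixed_extremal] applies to them too. *)
Lemma local_norm_box v t a M f x : (forall i, 0 < tnth v i)%R -> (0 < t)%R ->
  (0 <= a)%R -> (0 <= M)%R -> measurable_fun setT f -> (forall y, 0 <= f y) ->
  (forall y, f y <= (M * box a y)%:E) ->
  local_norm v t f x <=
  (fine (mixed_norm v (fun y => (M * box a y)%:E)) * box (a + t) x)%:E.
Proof.
move=> v0 t0 a0 M0 mf f0 fM.
have mb : measurable_fun setT (fun y : rn => (M * box a y)%:E).
  by apply/measurable_EFinP; apply: measurable_funM => //; exact: measurable_box.
have b0 (y : rn) : 0 <= (M * box a y)%:E by rewrite lee_fin mulr_ge0// box_ge0.
have finN : mixed_norm v (fun y => (M * box a y)%:E) \is a fin_num.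
  rewrite ge0_fin_numE ?mixed_norm_ge0//.
  exact: (@mixed_norm_box_lty _ _ _ a M).
have [xb|nb] := boolP [forall i, (`|tnth x i| <= a + t)%R].
  rewrite (@box1 _ _ (a + t)%R) ?mulr1 ?fineK//; last by move=> i; exact: (forallP xb).
  apply: le_mixed_norm => //.
  - exact: measurable_ball_section.
  - by move=> y; exact: ball_section_ge0.
  - move=> y; apply: le_trans (fM y); rewrite -[leRHS]mule1.
    by apply: lee_wpmul2l => //; exact: ball_ind_le1.
(* Centers off the larger cube have balls that miss the support of [f]; the form [0 * f y] lets
   homogeneity give norm 0. *)
rewrite /local_norm (_ : (fun y => _) = fun y => 0 * f y); last first.
  apply/funext => y; rewrite mul0e.
  move: nb; rewrite negb_forall => /existsP[i xi].
  have [yb|nyb] := boolP (`|tnth y i| <= a)%R; last first.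
    suff -> : f y = 0 by rewrite mul0e.
    apply/eqP; rewrite eq_le f0 andbT (le_trans (fM y))// (_ : box a y = 0%R) ?mulr0//.
    rewrite /box (bigD1 i)//= indicE memNset ?mul0r//= in_itv/= -ler_norml.
    exact/negP.
  rewrite ball_indE; case: ltP => xy; last by rewrite mule0.
  exfalso; move/negP : xi; apply; rewrite -(subrK (tnth y i) (tnth x i)) addrC.
  apply: (le_trans (ler_normD _ _)); apply: lerD => //; apply: ltW.
  rewrite -(@ltr_pXn2r _ 2) ?nnegrE ?(ltW t0)// real_normK ?num_real//.
  move: xy; rewrite euclid_dist_lt//; apply: le_lt_trans.
  by rewrite (bigD1 i)//= lerDl; apply: sumr_ge0 => j _; exact: sqr_ge0.
by rewrite mixed_norm_ge0Z// mul0e lee_fin mulr_ge0 ?box_ge0 ?fine_ge0 ?mixed_norm_ge0.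
Qed.

Lemma slice_box_lty u v t a M f : (forall i, 0 < tnth u i)%R ->
  (forall i, 0 < tnth v i)%R -> (0 < t)%R ->
  (0 <= a)%R -> (0 <= M)%R -> measurable_fun setT f -> (forall y, 0 <= f y) ->
  (forall y, f y <= (M * box a y)%:E) -> slice u v t f < +oo.
Proof.
move=> u0 v0 t0 a0 M0 mf f0 fM.
apply: (@mixed_norm_box_lty _ _ _ (a + t)
    (fine (mixed_norm v (fun y => (M * box a y)%:E)))) => //.
- by rewrite addr_ge0// ltW.
- by rewrite fine_ge0// mixed_norm_ge0.
- exact: measurable_local_norm.
- by move=> x; exact: local_norm_ge0.
- by move=> x; exact: local_norm_box.
Qed.

(** Two extremal functions are multiplied: [phi] for the norm on each ball, with the center as a
    parameter, and [psi] for the outer norm in the center. Integrating the product over the centers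
    gives [h]; [slice_average] bounds it, and Tonelli's theorem turns its pairing with [F] back into
    the iterated norm. *)
Lemma slice_extremal d (S : measurableType d) u w v z t a M (F : S * rn -> \bar R) :
  (0 < t)%R -> conjugate_exponents u w -> conjugate_exponents v z ->
  (0 <= a)%R -> (0 <= M)%R -> measurable_fun setT F -> (forall p, 0 <= F p) ->
  (forall s y, F (s, y) <= (M * box a y)%:E) ->
  exists h : S * rn -> \bar R, [/\ measurable_fun setT h, forall p, 0 <= h p,
    forall s, slice u v t (fun y => h (s, y)) <= ball_volume (t *+ 2) &
    forall s, \int[leb n]_y (h (s, y) * F (s, y)) = slice w z t (fun y => F (s, y))].
Proof.
move=> t0 uw vz a0 M0 mF F0 FM.
have u0 := conjugate_exponents_gt0 uw; have v0 := conjugate_exponents_gt0 vz.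
have z0 := conjugate_exponents_gt0 (conjugate_exponents_sym vz).
have mFs s : measurable_fun setT (fun y => F (s, y)).
  by apply: (measurableT_comp mF); exact: pair1_measurable.
pose G (p : (S * rn) * rn) := F (p.1.1, p.2) * ball_ind t (p.1.2, p.2).
have m11 : measurable_fun setT (fun z : (S * rn) * rn => z.1.1).
  by apply: measurableT_comp; exact: measurable_fst.
have m12 : measurable_fun setT (fun z : (S * rn) * rn => z.1.2).
  by apply: measurableT_comp; [exact: measurable_snd|exact: measurable_fst].
have m2 : measurable_fun setT (fun z : (S * rn) * rn => z.2) by exact: measurable_snd.
have mG : measurable_fun setT G.
  apply: emeasurable_funM.
    by apply: (measurableT_comp mF); apply/measurable_fun_pair.
  by apply: (measurableT_comp (measurable_ball_ind t)); apply/measurable_fun_pair.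
have G0 p : 0 <= G p by rewrite mule_ge0// ball_ind_ge0.
have GM p y : G (p, y) <= (M * box a y)%:E.
  apply: le_trans (FM p.1 y); rewrite -[leRHS]mule1.
  by apply: lee_wpmul2l => //; exact: ball_ind_le1.
have [phi [mphi phi0 phi1 phiE]] := mixed_extremal vz a0 M0 mG G0 GM.
pose N (p : S * rn) := mixed_norm z (fun y => G (p, y)).
have mN : measurable_fun setT N by exact: measurable_mixed_norm.
have N0 p : 0 <= N p by exact: mixed_norm_ge0.
pose K := fine (mixed_norm z (fun y => (M * box a y)%:E)).
have K0 : (0 <= K)%R by rewrite fine_ge0// mixed_norm_ge0.
have NK s x : N (s, x) <= (K * box (a + t) x)%:E.
  exact: (@local_norm_box _ _ _ _ (fun y => F (s, y))).
have at0 : (0 <= a + t)%R by rewrite addr_ge0// ltW.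
have [psi [mpsi psi0 psi1 psiE]] := mixed_extremal uw at0 K0 mN N0 NK.
pose Phi (q : S * (rn * rn)) := psi (q.1, q.2.1) * phi ((q.1, q.2.1), q.2.2).
have n1 : measurable_fun setT (fun q : S * (rn * rn) => q.1) by exact: measurable_fst.
have n21 : measurable_fun setT (fun q : S * (rn * rn) => q.2.1).
  by apply: measurableT_comp; [exact: measurable_fst|exact: measurable_snd].
have n22 : measurable_fun setT (fun q : S * (rn * rn) => q.2.2).
  by apply: measurableT_comp; exact: measurable_snd.
have mPhi : measurable_fun setT Phi.
  apply: emeasurable_funM.
    by apply: (measurableT_comp mpsi); apply/measurable_fun_pair.
  apply: (measurableT_comp mphi); apply/measurable_fun_pair => //=.
  exact/measurable_fun_pair.
have Phi0 q : 0 <= Phi q by rewrite mule_ge0.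
have mPhis s : measurable_fun setT (fun p => Phi (s, p)).
  by apply: (measurableT_comp mPhi); exact: pair1_measurable.
have mphis s x : measurable_fun setT (fun y => phi ((s, x), y)).
  by apply: (measurableT_comp mphi); exact: pair1_measurable.
pose h (q : S * rn) := \int[leb n]_x (Phi (q.1, (x, q.2)) * ball_ind t (x, q.2)).
exists h; split.
- apply: (@measurable_integral_parameter _ _ _ _ _ (leb n) (fun q : (S * rn) * rn =>
    Phi (q.1.1, (q.2, q.1.2)) * ball_ind t (q.2, q.1.2))); last first.
    by move=> q; rewrite mule_ge0// ball_ind_ge0.
  apply: emeasurable_funM.
    apply: (measurableT_comp mPhi); apply/measurable_fun_pair => //=.
    exact/measurable_fun_pair.
  by apply: (measurableT_comp (measurable_ball_ind t)); apply/measurable_fun_pair.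
- by move=> q; apply: integral_ge0 => x _; rewrite mule_ge0// ball_ind_ge0.
- move=> s; apply: le_trans (@slice_average _ _ _ _ _ (fun p => Phi (s, p)) t0 uw vz _ _) _ => //.
  have vol0 : 0 <= ball_volume (t *+ 2).
    by apply: integral_ge0 => y _; exact: ball_ind_ge0.
  rewrite -[leRHS]mule1; apply: lee_wpmul2l => //; apply: le_trans (psi1 s).
  apply: le_mixed_norm => //.
  + exact: (@measurable_mixed_norm _ _ _ _ _ (fun p => Phi (s, p))).
  + by apply: (measurableT_comp mpsi); exact: pair1_measurable.
  + by move=> x; exact: mixed_norm_ge0.
  + move=> x; rewrite /Phi /= mixed_norm_ge0Z// -[leRHS]mule1.
    by apply: lee_wpmul2l.
- move=> s; rewrite /slice -[RHS](psiE s).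
  pose J (p : rn * rn) := Phi (s, p) * ball_ind t p * F (s, p.2).
  have mJ : measurable_fun setT J.
    apply: emeasurable_funM.
      by apply: emeasurable_funM => //; exact: measurable_ball_ind.
    by apply: (measurableT_comp (mFs s)); exact: measurable_snd.
  have J0 p : 0 <= J p by rewrite !mule_ge0// ball_ind_ge0.
  transitivity (\int[leb n]_y \int[leb n]_x J (x, y)).
    apply: eq_integral => y _; rewrite -ge0_integralZr//.
    + apply: emeasurable_funM.
        by apply: (measurableT_comp (mPhis s)); exact: pair2_measurable.
      by apply: (measurableT_comp (measurable_ball_ind t)); exact: pair2_measurable.
    + by move=> x _; rewrite mule_ge0// ball_ind_ge0.
  rewrite -(@fubini_tonelli _ _ _ _ _ (leb n) (leb n) J mJ J0).
  apply: eq_integral => x _; rewrite /N -phiE -ge0_integralZl//.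
  + by apply: eq_integral => y _; rewrite /J /Phi /G /= -!muleA; congr (_ * (_ * _)); rewrite muleC.
  + apply: emeasurable_funM => //.
    by apply: (measurableT_comp mG); exact: pair1_measurable.
  + by move=> y _; rewrite mule_ge0.
Qed.

End slice.

(** * Sequence norms *)

(** Sequence norms are norms for the counting measure, and [Lnorm_extremal] takes a sigma-finite
    measure. *)
HB.instance Definition _ (R : realType) :=
  Measure_isSigmaFinite.Build _ _ _ (@counting nat R) (sigma_finite_counting R).

Section sequence_norms.
Context {R : realType}.
Implicit Types a b : nat -> \bar R.
Local Notation count := (@counting nat R).

(* What is needed of the outermost norms of a Herz space and of its dual; both
   (l^p, l^p') for 1 < p and (l^p, l^oo) for p <= 1 qualify. *)
Record sequence_duality (rho sigma : (nat -> \bar R) -> \bar R) : Prop := {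
  sd_ge0 : forall a, (forall k, 0 <= a k) -> 0 <= rho a ;
  sd_le : forall a b, (forall k, 0 <= a k) -> (forall k, a k <= b k) -> rho a <= rho b ;
  sd_Z : forall (c : R) a, (0 <= c)%R -> (forall k, 0 <= a k) ->
    rho (fun k => c%:E * a k) = c%:E * rho a ;
  sd_hoelder : forall a b, (forall k, 0 <= a k) -> (forall k, 0 <= b k) ->
    \sum_(k <oo) (a k * b k) <= rho a * sigma b ;
  sd_extremal : forall b m, (forall k, 0 <= b k) -> (forall k, b k < +oo) ->
    (forall k, (m <= k)%N -> b k = 0) ->
    exists a, [/\ forall k, 0 <= a k, rho a <= 1 & sigma b = \sum_(k <oo) (a k * b k)] ;
  sd_fin : forall b m, (forall k, 0 <= b k) -> (forall k, b k < +oo) ->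
    (forall k, (m <= k)%N -> b k = 0) -> rho b < +oo /\ sigma b < +oo ;
  sd_dominated : forall (h : nat -> nat -> \bar R) a,
    (forall m k, 0 <= h m k) -> (forall m k, h m k <= a k) -> rho a < +oo ->
    (forall k, a k < +oo -> vanishes (h ^~ k)) -> vanishes (fun m => rho (h m)) ;
  sd_sup : forall h : nat -> nat -> \bar R, (forall m k, 0 <= h m k) ->
    (forall k, nondecreasing_seq (h ^~ k)) ->
    sigma (fun k => ereal_sup (range (h ^~ k))) =
    ereal_sup (range (fun m => sigma (h m))) ;
  sd_weight : exists2 a : nat -> R, forall k, (0 < a k)%R & rho (EFin \o a) < +oo
}.

Lemma nneseries_finite b m : (forall k, 0 <= b k) -> (forall k, b k < +oo) ->
  (forall k, (m <= k)%N -> b k = 0) -> \sum_(k <oo) b k < +oo.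
Proof.
move=> b0 boo bm; rewrite (@nneseries_split R b 0 m)// add0n [X in _ + X]eseries0; last first.
  by move=> k mk _; exact: bm.
by rewrite adde0; apply: lte_sum_pinfty => k _.
Qed.

Lemma Lnorm_counting_finite (p : R) b m : (0 < p)%R -> (forall k, 0 <= b k) ->
  (forall k, b k < +oo) -> (forall k, (m <= k)%N -> b k = 0) ->
  Lnorm count p%:E b < +oo.
Proof.
move=> p0 b0 boo bm; rewrite Lnorm_ge0E// ge0_integral_count; last first.
  by move=> k; exact: poweR_ge0.
apply: poweR_lty; apply: (@nneseries_finite _ m).
- by move=> k; exact: poweR_ge0.
- by move=> k; exact: poweR_lty.
- by move=> k /bm ->; rewrite poweR0r// gt_eqF.
Qed.

Lemma nneseries_single b k0 : (forall k, 0 <= b k) -> (forall k, k != k0 -> b k = 0) ->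
  \sum_(k <oo) b k = b k0.
Proof.
move=> b0 bk; rewrite (@nneseries_split R b 0 k0.+1)// add0n [X in _ + X]eseries0; last first.
  by move=> k kk _; apply: bk; rewrite gtn_eqF.
rewrite adde0 big_nat_recr//= big_nat big1 ?add0e// => k /andP[_ kk].
by apply: bk; rewrite ltn_eqF.
Qed.

Lemma nneseries_ge b k0 : (forall k, 0 <= b k) -> b k0 <= \sum_(k <oo) b k.
Proof.
move=> b0; rewrite (@nneseries_split R b 0 k0.+1)// add0n big_nat_recr//= -addeA addeCA.
rewrite -[leLHS]adde0; apply: leeD => //; apply: adde_ge0; first exact: sume_ge0.
exact: nneseries_ge0.
Qed.

(** For the supremum norm, the unit sequence at such an index is extremal. *)
Lemma finite_support_max b m : (forall k, 0 <= b k) -> (forall k, (m <= k)%N -> b k = 0) ->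
  exists k0, forall k, b k <= b k0.
Proof.
move=> b0; elim: m => [|m IH] in b b0 * => bm.
  by exists 0%N => k; rewrite bm.
have [|k|k1 k1max] := IH (fun k => if k == m then 0 else b k).
- by move=> k; case: ifP.
- by move=> mk; case: ifPn => // km; apply: bm; rewrite ltn_neqAle eq_sym km.
have [bmk|bmk] := leP (b m) (b k1).
  exists k1 => k; have := k1max k; case: (eqVneq k m) => [->//|_] /le_trans; apply.
  by case: ifP.
exists m => k; have := k1max k; case: (eqVneq k m) => [->//|_] /le_trans; apply.
by case: ifP => // _; exact: ltW.
Qed.

Lemma Lnorm_counting_weight (p : R) : (0 < p)%R ->
  exists2 a : nat -> R, forall k, (0 < a k)%R & Lnorm count p%:E (EFin \o a) < +oo.
Proof.
(* The p-th powers are [1 / 2 ^ k.+1], whose sum is at most 1. *)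
move=> p0; exists (fun k => (1 / (2 ^ k.+1)%:R) `^ p^-1)%R.
  by move=> k; apply: powR_gt0; rewrite divr_gt0// ltr0n expn_gt0.
rewrite Lnorm_ge0E; last by move=> k; rewrite lee_fin powR_ge0.
rewrite ge0_integral_count; last by move=> k; exact: poweR_ge0.
apply: poweR_lty; apply: (@le_lt_trans _ _ 1%:E); last exact: ltry.
apply: le_trans (epsilon_trick0 xpredT ler01); rewrite le_eqVlt; apply/orP; left.
apply/eqP; apply: eq_eseriesr => k _.
by rewrite /= -powRrM mulVf ?gt_eqF// powRr1// divr_ge0.
Qed.

Lemma sequence_duality_Lnorm (p q : R) : (1 < p)%R -> (1 < q)%R -> (p^-1 + q^-1 = 1)%R ->
  sequence_duality (Lnorm count p%:E) (Lnorm count q%:E).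
Proof.
move=> p1 q1 pq; have p0 : (0 < p)%R by exact: lt_trans p1.
have q0 : (0 < q)%R by exact: lt_trans q1.
split.
- by move=> a a0; exact: Lnorm_ge0.
- by move=> a b a0 ab; apply: le_Lnorm.
- by move=> c a c0 a0; apply: Lnorm_ge0Z.
- move=> a b a0 b0; rewrite -ge0_integral_count; last by move=> k; rewrite mule_ge0.
  exact: ehoelder.
- move=> b m b0 boo bm.
  have mb : measurable_fun setT (fun z : unit * nat => b z.2).
    by apply: (@measurableT_comp _ _ _ _ _ _ b) => //; exact: measurable_snd.
  have [phi [mphi phi0 phi1 phiE]] := @Lnorm_extremal _ _ unit nat R count _ _
    (fun z : unit * nat => b z.2) p0 q1 pq mb (fun z => b0 _)
    (fun _ => Lnorm_counting_finite q0 b0 boo bm).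
  exists (fun k => phi (tt, k)); split => //.
  by rewrite -ge0_integral_count ?(phiE tt)// => k; rewrite mule_ge0.
- move=> b m b0 boo bm.
  by split; [exact: Lnorm_counting_finite p0 b0 boo bm|
             exact: Lnorm_counting_finite q0 b0 boo bm].
- by move=> h a h0 ha aoo hv; apply: (Lnorm_dominated p0 _ _ h0 ha aoo).
- by move=> h h0 ndh; apply: Lnorm_ereal_sup.
- exact: Lnorm_counting_weight.
Qed.

(** Each [a k] is at most the norm [A], so [a k = a k ^ p * a k ^ (1 - p) <= a k ^ p * A ^ (1 - p)];
    the right-hand sides sum to [A ^ p * A ^ (1 - p) = A]. *)
Lemma nneseries_le_Lnorm (p : R) a : (0 < p)%R -> (p <= 1)%R -> (forall k, 0 <= a k) ->
  \sum_(k <oo) a k <= Lnorm count p%:E a.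
Proof.
move=> p0 p1 a0; set A := Lnorm count p%:E a.
have A0 : 0 <= A by exact: Lnorm_ge0.
have sumA : \sum_(k <oo) (a k `^ p) = A `^ p.
  rewrite /A Lnorm_ge0E// ge0_integral_count; last by move=> k; exact: poweR_ge0.
  by rewrite poweRVK ?gt_eqF//; apply: nneseries_ge0 => k _ _; exact: poweR_ge0.
have aA k : a k <= A.
  rewrite -[leLHS](@poweRK _ _ p) ?gt_eqF// -[leRHS](@poweRK _ _ p) ?gt_eqF//.
  apply: le_poweR; [by rewrite invr_ge0 ltW|exact: poweR_ge0|].
  by rewrite -sumA; apply: (@nneseries_ge (fun k => a k `^ p)) => j; exact: poweR_ge0.
have [Aoo|Aoo] := eqVneq A +oo; first by rewrite Aoo leey.
have split (r : R) (x : \bar R) : (r <= 1)%R -> (0 < r)%R -> 0 <= x -> x = x `^ r * x `^ (1 - r).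
  move=> r1 r0 x0; rewrite -poweRD; first by rewrite addrC subrK poweRe1.
  by apply: add_neq0_poweRD_def; rewrite addrC subrK oner_eq0.
have finA : A \is a fin_num by rewrite ge0_fin_numE// ltey.
rewrite [leRHS](split p)// -sumA muleC -[in leRHS](fineK finA) poweR_EFin.
rewrite -nneseriesZl; last by move=> k _; exact: poweR_ge0.
apply: lee_nneseries => // k _; rewrite [leLHS](split p)// muleC.
apply: lee_wpmul2r; first exact: poweR_ge0.
by rewrite -poweR_EFin fineK//; apply: le_poweR => //; rewrite subr_ge0.
Qed.

(** For p at most 1 the embedding of l^p into l^1 gives Hoelder's inequality against the supremum,
    and a unit sequence is extremal. *)
Lemma sequence_duality_sup (p : R) : (0 < p)%R -> (p <= 1)%R ->
  sequence_duality (Lnorm count p%:E) (fun b => ereal_sup (range b)).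
Proof.
move=> p0 p1; split.
- by move=> a a0; exact: Lnorm_ge0.
- by move=> a b a0 ab; apply: le_Lnorm.
- by move=> c a c0 a0; apply: Lnorm_ge0Z.
- move=> a b a0 b0.
  have sup0 : 0 <= ereal_sup (range b).
    by apply: (le_trans (b0 0%N)); apply: ereal_sup_ubound; exists 0%N.
  apply: (@le_trans _ _ (\sum_(k <oo) (ereal_sup (range b) * a k))).
    apply: lee_nneseries => [k _ _|k _]; first by rewrite mule_ge0.
    by rewrite muleC; apply: lee_wpmul2r => //; apply: ereal_sup_ubound; exists k.
  (* The supremum of [b] may be infinite; with a zero norm the product is then 0, and all terms
     [a k] have to vanish. *)
  have [az|az] := eqVneq (Lnorm count p%:E a) 0.
    rewrite az mul0e eseries0// => k _ _; suff -> : a k = 0 by rewrite mule0.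
    apply/eqP; rewrite eq_le a0 andbT -az.
    by apply: le_trans (nneseries_le_Lnorm p0 p1 a0); exact: nneseries_ge.
  rewrite muleC; case: (ereal_sup (range b)) sup0 => [r r0| _|//].
    by rewrite nneseriesZl//; apply: lee_wpmul2l => //; exact: nneseries_le_Lnorm.
  by rewrite gt0_mulye ?leey// lt0e az Lnorm_ge0.
- move=> b m b0 boo bm; have [k0 k0max] := finite_support_max b0 bm.
  pose a k : \bar R := (k == k0)%:R%:E.
  have a0 k : 0 <= a k by rewrite lee_fin.
  exists a; split => //.
    rewrite Lnorm_ge0E// ge0_integral_count; last by move=> k; exact: poweR_ge0.
    rewrite (@nneseries_single _ k0); last 2 first.
    - by move=> k; exact: poweR_ge0.
    - by move=> k /negPf kk; rewrite /a kk poweR0r// gt_eqF.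
    by rewrite /a eqxx !poweR1r.
  rewrite (@nneseries_single _ k0); last 2 first.
  - by move=> k; rewrite mule_ge0.
  - by move=> k /negPf kk; rewrite /a kk mul0e.
  rewrite /a eqxx mul1e; apply/eqP; rewrite eq_le; apply/andP; split.
    by apply: ge_ereal_sup => _ [k _ <-].
  by apply: ereal_sup_ubound; exists k0.
- move=> b m b0 boo bm; split; first exact: Lnorm_counting_finite p0 b0 boo bm.
  have [k0 k0max] := finite_support_max b0 bm; apply: le_lt_trans (boo k0).
  by apply: ge_ereal_sup => _ [k _ <-].
- by move=> h a h0 ha aoo hv; apply: (Lnorm_dominated p0 _ _ h0 ha aoo).
- move=> h h0 ndh; apply/eqP; rewrite eq_le; apply/andP; split.
    apply: ge_ereal_sup => _ [k _ <-]; apply: ge_ereal_sup => _ [m _ <-].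
    apply: (@le_trans _ _ (ereal_sup (range (h m)))).
      by apply: ereal_sup_ubound; exists k.
    by apply: ereal_sup_ubound; exists m.
  apply: ge_ereal_sup => _ [m _ <-]; apply: ge_ereal_sup => _ [k _ <-].
  apply: (@le_trans _ _ (ereal_sup (range (h ^~ k)))).
    by apply: ereal_sup_ubound; exists m.
  by apply: ereal_sup_ubound; exists k.
- exact: Lnorm_counting_weight.
Qed.

End sequence_norms.

(** * Herz norms over a family of shells *)

Section herz.
Context {R : realType} {n : nat}.
Local Notation rn := (rn R n).
Local Notation ball_volume := (@ball_volume R n).
Variables (t : R) (t0 : (0 < t)%R) (u w v z : n.-tuple R).
Hypotheses (uw : conjugate_exponents u w) (vz : conjugate_exponents v z).
Variables (rho sigma : (nat -> \bar R) -> \bar R) (rs : sequence_duality rho sigma).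
Variables (E : nat -> set rn) (c d : nat -> R) (kappa : R).
Hypotheses (mE : forall k, measurable (E k)) (tE : trivIset setT E).
Hypothesis Ebox : forall k, exists2 a : R, (0 <= a)%R & forall y, E k y -> box a y = 1%R.
Hypothesis Ecover : {ae leb n, forall y, exists k, E k y}.
Hypotheses (c0 : forall k, (0 < c k)%R) (d0 : forall k, (0 < d k)%R).
Hypotheses (cd : forall k, (c k * d k = kappa)%R).
Implicit Types f g : rn -> \bar R.

Let u0 := conjugate_exponents_gt0 uw.
Let v0 := conjugate_exponents_gt0 vz.
Let w0 := conjugate_exponents_gt0 (conjugate_exponents_sym uw).
Let z0 := conjugate_exponents_gt0 (conjugate_exponents_sym vz).

Definition restrict_to k f (y : rn) : \bar R := f y * (\1_(E k) y)%:E.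

(** The weights [e] will also contain the denominators of the slice norms. Of the weights [c] and
    [d] only the common product [kappa] enters the constants. *)
Definition herz (tau : (nat -> \bar R) -> \bar R) (e : nat -> R) u' v' f : \bar R :=
  tau (fun k => (e k)%:E * slice u' v' t (restrict_to k f)).

Let ind_ge0 k y : 0 <= (\1_(E k) y)%:E :> \bar R.
Proof. by rewrite lee_fin indicE. Qed.

Let ind_le1 k y : (\1_(E k) y)%:E <= 1 :> \bar R.
Proof. by rewrite lee_fin indicE lern1 leq_b1. Qed.

Let measurable_ind k : measurable_fun setT (fun y => (\1_(E k) y)%:E : \bar R).
Proof. by apply/measurable_EFinP; exact: measurable_indic. Qed.

Lemma measurable_restrict_to k f : measurable_fun setT f ->
  measurable_fun setT (restrict_to k f).
Proof. by move=> mf; exact: emeasurable_funM. Qed.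

Lemma restrict_ge0 k f y : (forall y, 0 <= f y) -> 0 <= restrict_to k f y.
Proof. by move=> f0; rewrite mule_ge0. Qed.

Lemma restrict_in k f y : E k y -> restrict_to k f y = f y.
Proof. by move=> Ey; rewrite /restrict_to indicE mem_set// mule1. Qed.

Lemma restrict_out k f y : ~ E k y -> restrict_to k f y = 0.
Proof. by move=> Ey; rewrite /restrict_to indicE memNset// mule0. Qed.

Lemma le_restrict k f g y : (forall y, f y <= g y) -> restrict_to k f y <= restrict_to k g y.
Proof. by move=> fg; apply: lee_wpmul2r. Qed.

Let le_term (e : nat -> R) u' v' k f g : (0 < e k)%R ->
  (forall i, 0 < tnth u' i)%R -> (forall i, 0 < tnth v' i)%R ->
  measurable_fun setT f -> measurable_fun setT g ->
  (forall x, 0 <= f x) -> (forall x, f x <= g x) ->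
  (e k)%:E * slice u' v' t (restrict_to k f) <= (e k)%:E * slice u' v' t (restrict_to k g).
Proof.
move=> e0 u'0 v'0 mf mg f0 fg; apply: lee_wpmul2l; first by rewrite lee_fin ltW.
apply: le_slice => //; try exact: measurable_restrict_to.
- by move=> y; exact: restrict_ge0.
- by move=> y; exact: le_restrict.
Qed.

Let term_ge0 (e : nat -> R) u' v' k f : (0 < e k)%R ->
  0 <= (e k)%:E * slice u' v' t (restrict_to k f).
Proof. by move=> e0; rewrite mule_ge0 ?slice_ge0// lee_fin ltW. Qed.

Lemma le_herz f g : measurable_fun setT f -> measurable_fun setT g ->
  (forall x, 0 <= f x) -> (forall x, f x <= g x) ->
  herz rho c u v f <= herz rho c u v g.
Proof.
move=> mf mg f0 fg; apply: (sd_le rs) => k; first exact: term_ge0.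
exact: le_term.
Qed.

Lemma herz_Z (a : R) f : (0 <= a)%R -> measurable_fun setT f -> (forall x, 0 <= f x) ->
  herz rho c u v (fun x => a%:E * f x) = a%:E * herz rho c u v f.
Proof.
move=> a0 mf f0; rewrite /herz -(sd_Z rs)//; last by move=> k; exact: term_ge0.
congr rho; apply/funext => k; rewrite muleCA; congr (_ * _).
rewrite -slice_ge0Z//.
- by congr slice; apply/funext => y; rewrite /restrict_to muleA.
- exact: measurable_restrict_to.
- by move=> y; exact: restrict_ge0.
Qed.

Lemma herz_dominated (h : nat -> rn -> \bar R) f :
  (forall m, measurable_fun setT (h m)) -> measurable_fun setT f ->
  (forall m x, 0 <= h m x) -> (forall m x, h m x <= f x) ->
  herz rho c u v f < +oo -> (forall x, vanishes (h ^~ x)) ->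
  vanishes (fun m => herz rho c u v (h m)).
Proof.
move=> mh mf h0 hf foo hv.
have f0 x : 0 <= f x by exact: le_trans (hf 0%N x).
apply: (sd_dominated rs (h := fun m k => (c k)%:E * slice u v t (restrict_to k (h m))) _ _ foo).
- by move=> m k; exact: term_ge0.
- by move=> m k; exact: le_term.
move=> k ck; apply: vanishesZ; [exact: ltW|by move=> m; exact: slice_ge0|].
apply: (slice_dominated u0 v0 (f := restrict_to k f)).
- by move=> m; exact: measurable_restrict_to.
- exact: measurable_restrict_to.
- by move=> m x; exact: restrict_ge0.
- by move=> m x; exact: le_restrict.
- move: ck; case: (slice _ _ _ _) => [r _|/=|//]; first exact: ltry.
  by rewrite gt0_muley ?lte_fin.
move=> x _; apply: le_vanishes (hv x) => m.
by rewrite -[leRHS]mule1; apply: lee_wpmul2l.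
Qed.

Lemma ereal_sup_mull (r : R) (a : nat -> \bar R) : (0 <= r)%R -> (forall m, 0 <= a m) ->
  ereal_sup (range (fun m => r%:E * a m)) = r%:E * ereal_sup (range a).
Proof.
move=> r0 a0; have [->|rn0] := eqVneq r 0%R.
  rewrite mul0e; apply/eqP; rewrite eq_le; apply/andP; split.
    by apply: ge_ereal_sup => _ [m _ <-]; rewrite mul0e.
  by apply: ereal_sup_ubound; exists 0%N => //; rewrite mul0e.
have rgt0 : (0 < r)%R by rewrite lt_neqAle eq_sym rn0.
apply/eqP; rewrite eq_le; apply/andP; split.
  apply: ge_ereal_sup => _ [m _ <-]; apply: lee_wpmul2l; first by rewrite lee_fin.
  by apply: ereal_sup_ubound; exists m.
rewrite -lee_pdivlMl//; apply: ge_ereal_sup => _ [m _ <-].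
rewrite lee_pdivlMl//; apply: ereal_sup_ubound; by exists m.
Qed.

Lemma herz_dual_ereal_sup (f : nat -> rn -> \bar R) :
  (forall m, measurable_fun setT (f m)) -> (forall m x, 0 <= f m x) ->
  (forall x, nondecreasing_seq (f ^~ x)) ->
  herz sigma d w z (fun x => ereal_sup (range (f ^~ x))) =
  ereal_sup (range (fun m => herz sigma d w z (f m))).
Proof.
move=> mf f0 ndf; rewrite /herz -(sd_sup rs).
- congr sigma; apply/funext => k; rewrite ereal_sup_mull; last 2 first.
  + exact: ltW.
  + by move=> m; exact: slice_ge0.
  congr (_ * _); rewrite -slice_ereal_sup//.
  + congr slice; apply/funext => y; have [yE|yE] := pselect (E k y).
      rewrite restrict_in//; congr ereal_sup; apply: eq_imagel => m _.
      by rewrite restrict_in.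
    rewrite restrict_out//; apply/esym/eqP; rewrite eq_le; apply/andP; split.
      by apply: ge_ereal_sup => _ [m _ <-]; rewrite restrict_out.
    by apply: ereal_sup_ubound; exists 0%N => //; rewrite restrict_out.
  + by move=> m; exact: measurable_restrict_to.
  + by move=> m x; exact: restrict_ge0.
  + by move=> x m j mj; apply: lee_wpmul2r => //; exact: ndf.
- by move=> m k; exact: term_ge0.
- move=> k m j mj; apply: le_term => // x; exact: ndf.
Qed.

Let kappa0 : (0 < kappa)%R.
Proof. by rewrite -(cd 0%N) mulr_gt0. Qed.

(** Almost every point lies in exactly one shell, so the restrictions of [f] add up to [f] almost
    everywhere. *)
Lemma integral_shells f : measurable_fun setT f -> (forall y, 0 <= f y) ->
  \int[leb n]_y f y = \sum_(k <oo) \int[leb n]_y restrict_to k f y.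
Proof.
move=> mf f0; rewrite -integral_nneseries//; last 2 first.
- by move=> k; exact: measurable_restrict_to.
- by move=> k y _; exact: restrict_ge0.
apply: ae_eq_integral => //.
  apply: ge0_emeasurable_sum => [k y _ _|k _]; first exact: restrict_ge0.
  exact: measurable_restrict_to.
apply: filterS Ecover => y [k Ek] _.
rewrite (@nneseries_single _ (fun k => restrict_to k f y) k); last 2 first.
- by move=> j; exact: restrict_ge0.
- move=> j jk; apply: restrict_out => Ej; have : (E j `&` E k) y by [].
  by move/trivIsetP : tE => /(_ j k I I jk) ->.
by rewrite restrict_in.
Qed.

Lemma herz_hoelder f g : measurable_fun setT f -> measurable_fun setT g ->
  (forall y, 0 <= f y) -> (forall y, 0 <= g y) ->
  kappa%:E * ball_volume t * \int[leb n]_y (f y * g y) <=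
  herz rho c u v f * herz sigma d w z g.
Proof.
move=> mf mg f0 g0; apply: le_trans (sd_hoelder rs _ _); last 2 first.
- by move=> k; exact: term_ge0.
- by move=> k; exact: term_ge0.
have finv : ball_volume t \is a fin_num.
  by rewrite ge0_fin_numE ?ball_volume_lty// ltW// ball_volume_gt0.
have fv0 : (0 <= fine (ball_volume t))%R by rewrite fine_ge0// ltW// ball_volume_gt0.
rewrite integral_shells; last 2 first.
- exact: emeasurable_funM.
- by move=> y; rewrite mule_ge0.
rewrite -(fineK finv) -EFinM -nneseriesZl; last first.
  by move=> k _; apply: integral_ge0 => y _; rewrite restrict_ge0// => x; rewrite mule_ge0.
apply: lee_nneseries => k _.
  move=> _; rewrite mule_ge0 ?lee_fin ?mulr_ge0 ?(ltW kappa0)//.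
  by apply: integral_ge0 => y _; rewrite restrict_ge0// => x; rewrite mule_ge0.
rewrite EFinM fineK// -(cd k) [X in X * _ * _]EFinM [leRHS]muleACA -[leLHS]muleA.
apply: lee_wpmul2l; first by rewrite mule_ge0// lee_fin ltW.
apply: le_trans (slice_hoelder t uw vz _ _ _ _).
- apply: lee_wpmul2l; first by rewrite ltW// ball_volume_gt0.
  rewrite le_eqVlt; apply/orP; left; apply/eqP; apply: eq_integral => y _.
  have [yE|yE] := pselect (E k y); first by rewrite !restrict_in.
  by rewrite !restrict_out// mule0.
- exact: measurable_restrict_to.
- exact: measurable_restrict_to.
- by move=> y; exact: restrict_ge0.
- by move=> y; exact: restrict_ge0.
Qed.

(* Dual extremals on the finitely many shells that meet the truncated function are
   glued with the weights of an extremal sequence. *)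
Lemma herz_converse g (K : R) : measurable_fun setT g -> (forall y, 0 <= g y) ->
  (0 <= K)%R ->
  (forall f, measurable_fun setT f -> (forall y, 0 <= f y) ->
     herz rho c u v f <= 1 -> \int[leb n]_y (f y * g y) <= K%:E) ->
  herz sigma d w z g <= kappa%:E * ball_volume (t *+ 2) * K%:E.
Proof.
move=> mg g0 K0 gK.
have t20 : (0 < t *+ 2)%R by rewrite pmulrn_lgt0.
pose V := fine (ball_volume (t *+ 2)).
have VE : V%:E = ball_volume (t *+ 2).
  by rewrite fineK// ge0_fin_numE ?ball_volume_lty// ltW// ball_volume_gt0.
have V0 : (0 < V)%R by rewrite -lte_fin VE ball_volume_gt0.
(* Besides being truncated, [G m] lives on the first [m] shells only, so its sequence of slice norms
   has finite support, as [sd_extremal] asks. *)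
pose G m y := truncation g m y * (\1_(\bigcup_(k < m) E k) y)%:E.
have mU m : measurable (\bigcup_(k < m) E k) by apply: bigcup_measurable => k _; exact: mE.
have mG m : measurable_fun setT (G m).
  apply: emeasurable_funM; first exact: measurable_truncation.
  by apply/measurable_EFinP; exact: measurable_indic.
have G0 m y : 0 <= G m y by rewrite mule_ge0 ?truncation_ge0// lee_fin indicE.
have Gtr m y : G m y <= truncation g m y.
  rewrite -[leRHS]mule1; apply: lee_wpmul2l; first exact: truncation_ge0.
  by rewrite lee_fin indicE lern1 leq_b1.
have Gg m y : G m y <= g y by apply: le_trans (Gtr m y) _; exact: truncation_le.
have ndG y : nondecreasing_seq (G ^~ y).
  move=> i j ij; apply: lee_pmul.
  - exact: truncation_ge0.
  - by rewrite lee_fin indicE.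
  - exact: nondecreasing_truncation.
  rewrite lee_fin !indicE ler_nat; have [|] := boolP (y \in _); last by [].
  rewrite inE => -[k /= ki Ek]; rewrite mem_set//; exists k => //=.
  exact: leq_trans ki ij.
suff H m : herz sigma d w z (G m) <= kappa%:E * ball_volume (t *+ 2) * K%:E.
  apply: (@le_trans _ _ (herz sigma d w z (fun y => ereal_sup (range (G ^~ y))))).
    rewrite le_eqVlt; apply/orP; left; apply/eqP; congr sigma; apply/funext => k.
    congr (_ * slice _ _ _ _); apply/funext => y.
    have [yE|yE] := pselect (E k y); last by rewrite !restrict_out.
    rewrite !restrict_in// -[LHS](truncation_sup y g0).
    apply/eqP; rewrite eq_le; apply/andP; split; last first.
      apply: ge_ereal_sup => _ [m _ <-]; apply: (le_trans (Gtr m y)).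
      by apply: ereal_sup_ubound; exists m.
    apply: ge_ereal_sup => _ [m _ <-].
    (* From index [k.+1] on, shell [k] is among the shells kept, and there [G] agrees with the
       truncation. *)
    apply: (@le_trans _ _ (truncation g (maxn m k.+1) y)).
      by apply: nondecreasing_truncation => //; exact: leq_maxl.
    apply: ereal_sup_ubound; exists (maxn m k.+1) => //.
    rewrite /G indicE mem_set ?mule1//; exists k => //=.
    exact: leq_maxr.
  rewrite herz_dual_ereal_sup//; apply: ge_ereal_sup => _ [m _ <-]; exact: H.
have {}ext k : exists h : rn -> \bar R, [/\ measurable_fun setT h, forall y, 0 <= h y,
    slice u v t h <= V%:E &
    \int[leb n]_y (h y * restrict_to k (G m) y) = slice w z t (restrict_to k (G m))].
  have [||h [mh h0 h1 hE]] := @slice_extremal R n _ unit u w v z t m%:R m%:R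
    (fun p => restrict_to k (G m) p.2) t0 uw vz (ler0n _ _) (ler0n _ _) _
    (fun p => restrict_ge0 k p.2 (G0 m)) _.
  - by apply: measurableT_comp; [exact: measurable_restrict_to|exact: measurable_snd].
  - move=> s y /=; apply: le_trans (truncation_le_box g m y); apply: le_trans (Gtr m y).
    by rewrite -[leRHS]mule1; apply: lee_wpmul2l.
  exists (fun y => h (tt, y)); split => //.
  - by apply: (measurableT_comp mh); exact: pair1_measurable.
  - by rewrite VE; exact: h1.
have /choice[h hP] := ext.
have mh k : measurable_fun setT (h k) by have [] := hP k.
have h0 k y : 0 <= h k y by have [] := hP k.
have h1 k : slice u v t (h k) <= V%:E by have [] := hP k.
have hE k : \int[leb n]_y (h k y * restrict_to k (G m) y) = slice w z t (restrict_to k (G m)).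
  by have [] := hP k.
pose b k := (d k)%:E * slice w z t (restrict_to k (G m)).
have [a [a0 a1 sb]] : exists a, [/\ forall k, 0 <= a k, rho a <= 1 &
    sigma b = \sum_(k <oo) (a k * b k)].
  apply: (@sd_extremal _ _ _ rs b m).
  - by move=> k; exact: term_ge0.
  - move=> k; apply: lte_mul_pinfty; rewrite ?lee_fin ?(ltW (d0 k))//.
    apply: (@slice_box_lty _ _ _ _ _ m%:R m%:R) => //.
    + exact: measurable_restrict_to.
    + by move=> y; exact: restrict_ge0.
    + move=> y; apply: le_trans (truncation_le_box g m y); apply: le_trans (Gtr m y).
      by rewrite -[leRHS]mule1; apply: lee_wpmul2l.
  - move=> k mk; rewrite /b (_ : restrict_to k (G m) = fun y => 0 * G m y).
      by rewrite slice_ge0Z// mul0e mule0.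
    apply/funext => y; rewrite mul0e; have [yE|yE] := pselect (E k y); last first.
      by rewrite restrict_out.
    rewrite restrict_in// /G indicE memNset ?mule0// => -[j /= jm Ej].
    have : (E j `&` E k) y by [].
    have jk : j != k by rewrite ltn_eqF// (leq_trans jm).
    by move/trivIsetP : tE => /(_ j k I I jk) ->.
(* Chosen so that [c k * e k * V = a k] for the coefficients [e] below, since [c k * d k = kappa];
   hence the glued function has norm at most [rho a <= 1]. *)
pose lam := (V * kappa)^-1%R.
have lam0 : (0 < lam)%R by rewrite invr_gt0 mulr_gt0.
pose e k := a k * (lam * d k)%:E.
have e0 k : 0 <= e k by rewrite mule_ge0// lee_fin mulr_ge0// ltW.
pose F k y := e k * restrict_to k (h k) y.
have mF k : measurable_fun setT (F k).
  by apply: emeasurable_funM => //; exact: measurable_restrict_to.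
have F0 k y : 0 <= F k y by rewrite mule_ge0// restrict_ge0.
pose f y := \sum_(k <oo) F k y.
have mf : measurable_fun setT f.
  by apply: ge0_emeasurable_sum => [k y _ _|k _].
have f0 y : 0 <= f y by apply: nneseries_ge0.
have fE k y : E k y -> f y = e k * h k y.
  move=> Ek; rewrite /f (@nneseries_single _ (fun k => F k y) k)//.
    by rewrite /F restrict_in.
  move=> j jk; rewrite /F restrict_out ?mule0// => Ej; have : (E j `&` E k) y by [].
  by move/trivIsetP : tE => /(_ j k I I jk) ->.
have hf1 : herz rho c u v f <= 1.
  apply: le_trans a1; apply: (sd_le rs) => k; first exact: term_ge0.
  apply: (@le_trans _ _ ((c k)%:E * (e k * V%:E))).
    apply: lee_wpmul2l; first by rewrite lee_fin ltW.
    apply: (@le_trans _ _ (slice u v t (fun y => e k * h k y))).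
      apply: le_slice => //.
      - exact: measurable_restrict_to.
      - exact: emeasurable_funM.
      - by move=> y; exact: restrict_ge0.
      move=> y; have [yE|yE] := pselect (E k y).
        by rewrite restrict_in// (fE k).
      by rewrite restrict_out// mule_ge0.
    by rewrite slice_ge0Z//; apply: lee_wpmul2l.
  rewrite /e -muleA -EFinM muleCA -EFinM.
  rewrite (_ : c k * (lam * d k * V) = lam * (V * (c k * d k)))%R; last by ring.
  by rewrite cd mulVf ?mule1// gt_eqF// mulr_gt0.
have : \int[leb n]_y (f y * G m y) <= K%:E.
  apply: le_trans (gK f mf f0 hf1); apply: ge0_le_integral => //.
  - by move=> y _; rewrite mule_ge0.
  - exact: emeasurable_funM.
  - exact: emeasurable_funM.
  - by move=> y _; exact: lee_wpmul2l.
rewrite integral_shells; last 2 first.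
- exact: emeasurable_funM.
- by move=> y; rewrite mule_ge0.
have -> : \sum_(k <oo) \int[leb n]_y restrict_to k (fun y => f y * G m y) y =
    \sum_(k <oo) (lam%:E * (a k * b k)).
  apply: eq_eseriesr => k _.
  transitivity (\int[leb n]_y (e k * (h k y * restrict_to k (G m) y))).
    apply: eq_integral => y _; have [yE|yE] := pselect (E k y).
      rewrite !restrict_in//; transitivity (f y * G m y) => //.
      by rewrite (fE _ _ yE) [RHS]muleA.
    by rewrite !restrict_out// !mule0.
  rewrite ge0_integralZl//; last 2 first.
  - by apply: emeasurable_funM => //; exact: measurable_restrict_to.
  - by move=> y _; rewrite mule_ge0// restrict_ge0.
  by rewrite hE /e /b EFinM !muleA [a k * lam%:E]muleC.
rewrite nneseriesZl; last by move=> k _; rewrite mule_ge0// term_ge0.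
rewrite -sb -lee_pdivlMl// invrK -EFinM => H.
by rewrite -VE -!EFinM [(kappa * V)%R]mulrC.
Qed.

(** The function is constant on each shell, with values small enough for the weighted norms to stay
    below the sequence of [sd_weight], and it is 1 off the shells, so that it is positive
    everywhere. *)
Lemma herz_weight : exists g : rn -> R, [/\ measurable_fun setT g,
  forall y, (0 < g y)%R & herz rho c u v (EFin \o g) < +oo].
Proof.
have [a a0 aoo] := sd_weight rs.
pose N k := slice u v t (fun y => (\1_(E k) y)%:E).
have N0 k : 0 <= N k by exact: slice_ge0.
have Nfin k : N k \is a fin_num.
  rewrite ge0_fin_numE//; have [r r0 Er] := Ebox k.
  rewrite /N; apply: (@slice_box_lty _ _ _ _ _ r 1%R) => // y; rewrite mul1r lee_fin indicE.
  have [|] := boolP (y \in E k); last by rewrite box_ge0.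
  by rewrite inE => /Er ->.
(* Adding 1 keeps the denominator positive when the shell has norm 0. *)
pose e k := (a k / (c k * (1 + fine (N k))))%R.
have e0 k : (0 < e k)%R.
  by rewrite divr_gt0// mulr_gt0// ltr_pwDl// fine_ge0.
pose s y : \bar R := \sum_(k <oo) ((e k)%:E * (\1_(E k) y)%:E).
have ms : measurable_fun setT s.
  apply: ge0_emeasurable_sum => [k y _ _|k _]; first by rewrite mule_ge0// lee_fin ltW.
  exact: emeasurable_funM.
have sE k y : E k y -> s y = (e k)%:E.
  move=> Ek; rewrite /s (@nneseries_single _ (fun k => (e k)%:E * (\1_(E k) y)%:E) k).
  - by rewrite indicE mem_set// mule1.
  - by move=> j; rewrite mule_ge0// lee_fin ltW.
  move=> j jk; rewrite indicE memNset ?mule0// => Ej; have : (E j `&` E k) y by [].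
  by move/trivIsetP : tE => /(_ j k I I jk) ->.
have mU : measurable (\bigcup_k E k) by apply: bigcup_measurable.
exists (fun y => fine (s y) + \1_(~` \bigcup_k E k) y)%R; split.
- apply: measurable_funD; first exact: measurableT_comp.
  by apply: measurable_indic; exact: measurableC.
- move=> y; have [[k _ Ek]|nE] := pselect ((\bigcup_k E k) y).
    by rewrite (sE k)//= ltr_pwDl// indicE.
  rewrite indicE mem_set// ltr_wpDl// fine_ge0//; apply: nneseries_ge0 => k _ _.
  by rewrite mule_ge0// lee_fin ltW.
apply: le_lt_trans aoo; apply: (sd_le rs) => k; first exact: term_ge0.
rewrite (_ : restrict_to k _ = fun y => (e k)%:E * (\1_(E k) y)%:E); last first.
  apply/funext => y; have [yE|yE] := pselect (E k y); last first.
    by rewrite restrict_out// indicE memNset// mule0.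
  rewrite restrict_in//= (sE k)//= !indicE (mem_set yE) mule1 memNset ?addr0//.
  by apply; exists k.
have ek0 : 0 <= (e k)%:E by rewrite lee_fin ltW.
rewrite slice_ge0Z// -/(N k) -(fineK (Nfin k)) -!EFinM lee_fin.
have Nk0 : (0 <= fine (N k))%R by rewrite fine_ge0.
have N10 : (0 < 1 + fine (N k))%R by rewrite ltr_pwDl.
rewrite (_ : c k * (e k * fine (N k)) = a k * (fine (N k) / (1 + fine (N k))))%R; last first.
  by rewrite /e; field; rewrite !gt_eqF.
by apply: ler_piMr; [exact: ltW|rewrite ler_pdivrMr// mul1r lerDr].
Qed.

(** Paired with Hoelder's inequality, this makes functions of finite norm integrable over sets that
    meet finitely many shells. *)
Lemma herz_indic_lty (A : set rn) m : measurable A ->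
  (forall k y, (m <= k)%N -> A y -> ~ E k y) ->
  herz rho c u v (fun y => (\1_A y)%:E) < +oo /\
  herz sigma d w z (fun y => (\1_A y)%:E) < +oo.
Proof.
move=> mA AE.
have mi : measurable_fun setT (fun y => (\1_A y)%:E : \bar R).
  by apply/measurable_EFinP; exact: measurable_indic.
have i0 y : 0 <= (\1_A y)%:E :> \bar R by rewrite lee_fin indicE.
have fin u' v' k : (forall i, 0 < tnth u' i)%R -> (forall i, 0 < tnth v' i)%R ->
    slice u' v' t (restrict_to k (fun y => (\1_A y)%:E)) < +oo.
  move=> u'0 v'0; have [r r0 Er] := Ebox k.
  apply: (@slice_box_lty _ _ _ _ _ r 1%R) => //.
  - exact: measurable_restrict_to.
  - by move=> y; exact: restrict_ge0.
  move=> y; rewrite mul1r; have [yE|yE] := pselect (E k y).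
    by rewrite restrict_in// (Er _ yE) lee_fin indicE lern1 leq_b1.
  by rewrite restrict_out// lee_fin box_ge0.
have out u' v' k : (forall i, 0 < tnth u' i)%R -> (forall i, 0 < tnth v' i)%R ->
    (m <= k)%N -> slice u' v' t (restrict_to k (fun y => (\1_A y)%:E)) = 0.
  move=> u'0 v'0 mk; rewrite (_ : restrict_to k _ = fun y => 0 * (\1_A y)%:E).
    by rewrite slice_ge0Z// mul0e.
  apply/funext => y; rewrite mul0e; have [yE|yE] := pselect (E k y); last first.
    by rewrite restrict_out.
  by rewrite restrict_in// indicE memNset// => /AE; apply; first exact: mk.
have main (e : nat -> R) u' v' : (forall k, 0 < e k)%R ->
    (forall i, 0 < tnth u' i)%R -> (forall i, 0 < tnth v' i)%R ->
    herz rho e u' v' (fun y => (\1_A y)%:E) < +oo /\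
    herz sigma e u' v' (fun y => (\1_A y)%:E) < +oo.
  move=> e0 u'0 v'0; apply: (@sd_fin _ _ _ rs _ m).
  - by move=> k; exact: term_ge0.
  - by move=> k; apply: lte_mul_pinfty; rewrite ?fin// lee_fin ltW.
  - by move=> k mk; rewrite out// mule0.
by split; [have [] := main c u v c0 u0 v0|have [] := main d w z d0 w0 z0].
Qed.

End herz.

(** * Duality for order continuous function norms *)

Import HBNNSimple.

Lemma measurable_funV_ge0 d (T : measurableType d) (R : realType) (f : T -> R) :
  measurable_fun setT f -> (forall x, 0 <= f x)%R ->
  measurable_fun setT (fun x => (f x)^-1%R).
Proof.
move=> mf f0; rewrite (_ : (fun x => _) = fun x => (f x `^ (- 1))%R).
  exact: (measurableT_comp (measurable_powR _) mf).
by apply/funext => x; rewrite powRN powRr1.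
Qed.

Lemma lee_vanishes0 (R : realType) (x : R) (a : nat -> \bar R) :
  (forall m, `|x|%:E <= a m) -> vanishes a -> x = 0%R.
Proof.
move=> xa va; apply/eqP; rewrite -normr_eq0 eq_le normr_ge0 andbT.
apply/ler_addgt0Pr => e e0; rewrite add0r -lee_fin.
by have [M aM] := va e e0; apply: le_trans (xa M) (aM M _).
Qed.

Lemma vanishesD (R : realType) (a b : nat -> \bar R) :
  vanishes a -> vanishes b -> vanishes (fun m => a m + b m).
Proof.
move=> va vb e e0; have e20 : (0 < e / 2)%R by rewrite divr_gt0.
have [M aM] := va _ e20; have [M' bM] := vb _ e20.
exists (maxn M M') => m; rewrite geq_max => /andP[Mm M'm].
by rewrite [e]splitr EFinD; apply: leeD; [exact: aM|exact: bM].
Qed.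

Section duality.
Context {R : realType} {n : nat}.
Local Notation rn := (rn R n).
Local Notation mu := (@leb R n).
Implicit Types f h : rn -> \bar R.
Variables N N' : (rn -> \bar R) -> \bar R.
Hypothesis N_ge0 : forall f, 0 <= N f.
Hypothesis N'_ge0 : forall f, 0 <= N' f.
Hypothesis le_N : forall f h, measurable_fun setT f -> measurable_fun setT h ->
  (forall x, 0 <= f x) -> (forall x, f x <= h x) -> N f <= N h.
Hypothesis N_Z : forall (a : R) f, (0 <= a)%R -> measurable_fun setT f ->
  (forall x, 0 <= f x) -> N (fun x => a%:E * f x) = a%:E * N f.
Hypothesis N_null : forall f, measurable_fun setT f -> (forall x, 0 <= f x) ->
  \int[mu]_x f x = 0 -> N f = 0.
Hypothesis N_dominated : forall (h : nat -> rn -> \bar R) f,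
  (forall m, measurable_fun setT (h m)) -> measurable_fun setT f ->
  (forall m x, 0 <= h m x) -> (forall m x, h m x <= f x) -> N f < +oo ->
  (forall x, vanishes (h ^~ x)) -> vanishes (fun m => N (h m)).
Variables (A B : R).
Hypotheses (A0 : (0 < A)%R) (B0 : (0 < B)%R).
Hypothesis N_hoelder : forall f h, measurable_fun setT f -> measurable_fun setT h ->
  (forall x, 0 <= f x) -> (forall x, 0 <= h x) ->
  \int[mu]_x (f x * h x) <= A%:E * (N f * N' h).
Hypothesis N_converse : forall h (K : R), measurable_fun setT h -> (forall x, 0 <= h x) ->
  (0 <= K)%R ->
  (forall f, measurable_fun setT f -> (forall y, 0 <= f y) -> N f <= 1 ->
     \int[mu]_x (f x * h x) <= K%:E) -> N' h <= (B * K)%:E.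
Variable g0 : rn -> R.
Hypotheses (mg0 : measurable_fun setT g0) (g0_gt0 : forall x, (0 < g0 x)%R).
Hypothesis Ng0 : N (EFin \o g0) < +oo.

Definition norm_of (M : (rn -> \bar R) -> \bar R) (g : rn -> R) := M (fun x => `|g x|%:E).

Definition space_of (M : (rn -> \bar R) -> \bar R) : set (rn -> R) :=
  [set g | measurable_fun setT g /\ norm_of M g < +oo].

Local Notation X := (space_of N).
Local Notation Y := (space_of N').

Let mabs (g : rn -> R) : measurable_fun setT g ->
  measurable_fun setT (fun x => `|g x|%:E : \bar R).
Proof. by move=> mg; apply/measurable_EFinP; exact: measurableT_comp. Qed.

Let abs0 (g : rn -> R) x : 0 <= `|g x|%:E :> \bar R.
Proof. by rewrite lee_fin. Qed.

Let norm_ofZ (a : R) g : measurable_fun setT g ->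
  norm_of N (fun x => a * g x)%R = `|a|%:E * norm_of N g.
Proof.
move=> mg; rewrite /norm_of -N_Z//; last exact: mabs.
by congr N; apply/funext => x; rewrite normrM EFinM.
Qed.

Let le_norm_of (g h : rn -> R) : measurable_fun setT g -> measurable_fun setT h ->
  (forall x, `|g x| <= `|h x|)%R -> norm_of N g <= norm_of N h.
Proof. by move=> mg mh gh; apply: le_N => //; exact: mabs. Qed.

Let X_le (g h : rn -> R) : measurable_fun setT g -> X h ->
  (forall x, `|g x| <= `|h x|)%R -> X g.
Proof. by move=> mg [mh hoo] gh; split => //; apply: le_lt_trans hoo; exact: le_norm_of. Qed.

Let X_Z (a : R) g : X g -> X (fun x => a * g x)%R.
Proof.
move=> [mg goo]; split; first exact: measurable_funM.
by rewrite norm_ofZ//; apply: lte_mul_pinfty; rewrite ?lee_fin.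
Qed.

Let X_g0 : X g0.
Proof.
split => //; rewrite /norm_of (_ : (fun x => _) = EFin \o g0)//.
by apply/funext => x /=; rewrite gtr0_norm.
Qed.

Let X_bounded (a : R) (g : rn -> R) : measurable_fun setT g ->
  (forall x, `|g x| <= a * g0 x)%R -> X g.
Proof.
move=> mg ga; apply: (X_le mg (X_Z a X_g0)) => x.
by rewrite (le_trans (ga x))// ler_norm.
Qed.

Let integral_pairing_le (L g : rn -> R) : measurable_fun setT L -> measurable_fun setT g ->
  \int[mu]_x `|(L x * g x)%:E| <= A%:E * (norm_of N g * norm_of N' L).
Proof.
move=> mL mg; apply: le_trans (N_hoelder (mabs mg) (mabs mL) (abs0 _) (abs0 _)).
rewrite le_eqVlt; apply/orP; left; apply/eqP; apply: eq_integral => x _.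
by rewrite /= normrM mulrC EFinM.
Qed.

Let integrable_pairing (L g : rn -> R) : Y L -> X g ->
  mu.-integrable setT (EFin \o (L \* g)%R).
Proof.
move=> [mL Loo] [mg goo]; apply/integrableP; split.
  by apply/measurable_EFinP; exact: measurable_funM.
apply: le_lt_trans (integral_pairing_le mL mg) _.
have g0' : 0 <= norm_of N g by exact: N_ge0.
apply: lte_mul_pinfty; rewrite ?lee_fin ?(ltW A0)//.
by apply: lte_mul_pinfty => //; rewrite ge0_fin_numE.
Qed.

Let pairing_le (L g : rn -> R) : Y L -> X g ->
  `|pairing L g|%:E <= A%:E * (norm_of N g * norm_of N' L).
Proof.
move=> LY gX; have iLg := integrable_pairing LY gX.
have [mL _] := LY; have [mg _] := gX.
apply: le_trans (integral_pairing_le mL mg).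
have := le_abse_integral mu measurableT (measurable_int mu iLg).
rewrite /pairing /Rintegral -[X in `|X|%E <= _ -> _]fineK//.
exact: integrable_fin_num.
Qed.

Let pairingD (L : rn -> R) (a : R) (f g : rn -> R) : Y L -> X f -> X g ->
  pairing L (a \*o f \+ g)%R = (a * pairing L f + pairing L g)%R.
Proof.
move=> LY fX gX; have iLf := integrable_pairing LY fX.
have iLg := integrable_pairing LY gX.
rewrite /pairing -RintegralZl// -RintegralD//; last exact: (integrableZl measurableT a iLf).
by congr Rintegral; apply/funext => x /=; ring.
Qed.

Let pairingB (L f g : rn -> R) : Y L -> X f -> X g ->
  (pairing L f - pairing L g)%R = pairing L (fun x => f x - g x)%R.
Proof.
move=> LY fX gX; rewrite /pairing -RintegralB//; try exact: integrable_pairing.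
by congr Rintegral; apply/funext => x /=; ring.
Qed.

Let pairing_continuous L : Y L ->
  continuous_linear_functional X (norm_of N) (pairing L).
Proof.
move=> LY; have [mL Loo] := LY.
have nL0 : 0 <= norm_of N' L by exact: N'_ge0.
have finL : norm_of N' L \is a fin_num by rewrite ge0_fin_numE.
have L0 : (0 <= fine (norm_of N' L))%R by rewrite fine_ge0.
split => [a f g fX gX|f fX e e0]; first exact: pairingD.
have K0 : (0 < A * (fine (norm_of N' L) + 1))%R by rewrite mulr_gt0// ltr_wpDl.
(* The summand 1 covers the case where [L] has norm 0. *)
exists (e / (A * (fine (norm_of N' L) + 1)))%R; first exact: divr_gt0.
move=> g gX gf; rewrite pairingB//.
have [mf _] := fX; have [mg _] := gX.
(* The difference lies in [X] because its norm is below the chosen radius, without a triangle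
   inequality. *)
have gfX : X (fun x => g x - f x)%R.
  by split; [exact: measurable_funB|exact: lt_trans gf (ltry _)].
have gf0 : 0 <= norm_of N (fun x => g x - f x)%R by exact: N_ge0.
have fingf : norm_of N (fun x => g x - f x)%R \is a fin_num.
  by rewrite ge0_fin_numE//; case: gfX.
rewrite -lte_fin; apply: le_lt_trans (pairing_le LY gfX) _.
move: gf; rewrite -(fineK fingf) -(fineK finL) -!EFinM !lte_fin => gf.
have r0 : (0 <= fine (norm_of N (fun x => g x - f x)%R))%R by rewrite fine_ge0.
apply: (@le_lt_trans _ _ (fine (norm_of N (fun x => g x - f x)%R) *
  (A * (fine (norm_of N' L) + 1))))%R; last by rewrite -ltr_pdivlMr.
by rewrite mulrCA ler_wpM2l// ler_wpM2l ?(ltW A0)// lerDl.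
Qed.

(* Against [f >= 0] of norm at most 1, test with [sgn L * min (f, m g0)]. *)
Let dual_bound (L : rn -> R) (K : R) : measurable_fun setT L -> (0 <= K)%R ->
  mu.-integrable setT (EFin \o (L \* g0)%R) ->
  (forall (m : nat) (g : rn -> R), measurable_fun setT g -> (forall x, `|g x| <= m%:R * g0 x)%R ->
     norm_of N g <= 1 -> (pairing L g <= K)%R) ->
  norm_of N' L <= (B * K)%:E.
Proof.
move=> mL K0 iL LK; apply: N_converse => //; first exact: mabs.
move=> f mf f0 Nf1.
pose f_ m x := mine (f x) (m%:R * g0 x)%:E.
have mf_ m : measurable_fun setT (f_ m).
  apply: measurable_mine => //; apply/measurable_EFinP.
  exact: measurable_funM.
have f_0 m x : 0 <= f_ m x by rewrite le_min f0 lee_fin mulr_ge0// ltW.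
have f_fin m x : f_ m x \is a fin_num.
  rewrite ge0_fin_numE// (@le_lt_trans _ _ (m%:R * g0 x)%:E) ?ltry//.
  by rewrite ge_min lexx orbT.
have ndf x : nondecreasing_seq (f_ ^~ x).
  move=> i j ij; rewrite le_min ge_min lexx /= ge_min lee_fin.
  by rewrite ler_wpM2r ?orbT ?ler_nat// ltW.
have supf x : ereal_sup (range (f_ ^~ x)) = f x.
  apply/eqP; rewrite eq_le; apply/andP; split.
    by apply: ge_ereal_sup => _ [m _ <-]; rewrite ge_min lexx.
  case fxE : (f x) => [r| |]; last by have := f0 x; rewrite fxE.
    pose m := (Num.truncn (r / g0 x)).+1.
    apply: (@le_trans _ _ (f_ m x)); last by apply: ereal_sup_ubound; exists m.
    by rewrite le_min fxE lexx lee_fin -ler_pdivrMr// ltW// truncnS_gt.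
  rewrite leye_eq; apply/eqP/eq_infty => r.
  pose m := (Num.truncn (r / g0 x)).+1.
  apply: (@le_trans _ _ (f_ m x)); last by apply: ereal_sup_ubound; exists m.
  by rewrite le_min fxE leey lee_fin -ler_pdivrMr// ltW// truncnS_gt.
rewrite (_ : (fun x => _) = fun x => ereal_sup (range (fun m => f_ m x * `|L x|%:E))); last first.
  apply/funext => x; rewrite -[in LHS]supf muleC -ereal_sup_mull//.
  by congr ereal_sup; apply: eq_imagel => m _; rewrite muleC.
have mfL m : measurable_fun setT (fun x => f_ m x * `|L x|%:E).
  by apply: emeasurable_funM => //; exact: mabs.
rewrite (@integral_ereal_sup _ _ _ mu (fun m x => f_ m x * `|L x|%:E))//; last first.
- by move=> x i j ij; apply: lee_wpmul2r => //; exact: ndf.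
- by move=> m x; rewrite mule_ge0.
apply: ge_ereal_sup => _ [m _ <-].
(* The first two factors give the sign of [L x], which is 0 where [L] vanishes. *)
pose g x := (L x * `|L x|^-1 * fine (f_ m x))%R.
have gabs x : (`|g x| <= fine (f_ m x))%R.
  rewrite !normrM normfV normr_id (ger0_norm (fine_ge0 (f_0 m x))).
  have [->|L0] := eqVneq (L x) 0%R; first by rewrite normr0 !mul0r fine_ge0.
  by rewrite divff ?normr_eq0// mul1r.
have fine_le x : (fine (f_ m x) <= m%:R * g0 x)%R.
  by rewrite -lee_fin fineK// ge_min lexx orbT.
have mg : measurable_fun setT g.
  apply: measurable_funM; last exact: measurableT_comp.
  apply: measurable_funM => //; apply: measurable_funV_ge0 => //.
  exact: measurableT_comp.
have Ng1 : norm_of N g <= 1.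
  apply: le_trans Nf1; apply: le_N => //; first exact: mabs.
  move=> x; apply: (@le_trans _ _ (f_ m x)); last by rewrite ge_min lexx.
  by rewrite -[leRHS]fineK// lee_fin.
have := LK m g mg (fun x => le_trans (gabs x) (fine_le x)) Ng1.
rewrite -lee_fin; apply: le_trans.
have E x : f_ m x * `|L x|%:E = (L x * g x)%:E.
  rewrite -[f_ m x]fineK// -EFinM /g; congr (_%:E).
  have [->|L0] := eqVneq (L x) 0%R; first by rewrite normr0 !(mulr0, mul0r).
  rewrite mulrC !mulrA -expr2 -real_normK ?num_real// expr2 mulfK//.
  by rewrite normr_eq0.
(* [pairing] is the finite part of an integral, so [L * g] has to be integrable; this follows from
   the integrability of [L * g0]. *)
rewrite /pairing /Rintegral fineK; last first.
  apply: integrable_fin_num => //.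
  apply: (le_integrable measurableT _ _ (integrableZl measurableT m%:R iL)).
    by apply/measurable_EFinP; exact: measurable_funM.
  move=> x _ /=; rewrite lee_fin.
  apply: (@le_trans _ _ (`|L x| * (m%:R * g0 x)))%R.
    by rewrite normrM ler_wpM2l// (le_trans (gabs x)).
  by rewrite mulrCA !normrM normr_nat (gtr0_norm (g0_gt0 x)).
by rewrite le_eqVlt; apply/orP; left; apply/eqP; apply: eq_integral => x _; rewrite E.
Qed.

Let indic_le1 (S : set rn) x : (`|\1_S x : R| <= 1)%R.
Proof. by rewrite indicE ger0_norm// lern1 leq_b1. Qed.

(** * Representation of a continuous functional *)

Section representation.
Variable T : (rn -> R) -> R.
Hypothesis Tc : continuous_linear_functional X (norm_of N) T.

Let T_linear (a : R) (f g : rn -> R) : X f -> X g ->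
  T (fun x => a * f x + g x)%R = (a * T f + T g)%R.
Proof. by move=> fX gX; have [lin _] := Tc; exact: lin. Qed.

Let X0 : X (fun=> 0%R).
Proof. by apply: (X_bounded (a := 0%R)) => // x; rewrite normr0 mul0r. Qed.

Let T0 : T (fun=> 0%R) = 0%R.
Proof.
have := T_linear 1%R X0 X0; rewrite (_ : (fun x => _) = fun=> 0%R); last first.
  by apply/funext => x; rewrite mulr0 addr0.
by rewrite mul1r => /eqP; rewrite addrC -subr_eq subrr => /eqP.
Qed.

Let TZ (a : R) (f : rn -> R) : X f -> T (fun x => a * f x)%R = (a * T f)%R.
Proof.
move=> fX; rewrite -[RHS]addr0 -T0 -T_linear//; congr T.
by apply/funext => x; rewrite addr0.
Qed.

Let TD (f g : rn -> R) : X f -> X g -> T (fun x => f x + g x)%R = (T f + T g)%R.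
Proof.
move=> fX gX; rewrite -[T f]mul1r -T_linear//; congr T.
by apply/funext => x; rewrite mul1r.
Qed.

(** Continuity at 0 gives a radius [d]; scaling [g] into that ball gives the bound with constant
    [2 / d]. *)
Let T_bound : exists2 K : R, (0 <= K)%R &
  forall g, X g -> `|T g|%:E <= K%:E * norm_of N g.
Proof.
have [_ /(_ _ X0 _ ltr01)[d d0 dT]] := Tc.
exists (2 / d)%R; first by rewrite divr_ge0// ltW.
move=> g gX; have [mg goo] := gX.
have nfin : norm_of N g \is a fin_num by rewrite ge0_fin_numE//; exact: N_ge0.
have n0 : (0 <= fine (norm_of N g))%R by rewrite fine_ge0//; exact: N_ge0.
rewrite -(fineK nfin) -EFinM lee_fin; apply/ler_addgt0Pr => e e0.
(* Positive even if [g] has norm 0. Scaling by [d / (2 * r)] yields a norm of at most [d / 2], and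
   the resulting bound [2 * r / d] exceeds the wanted one by exactly [e]. *)
pose r := (fine (norm_of N g) + e * d / 2)%R.
have r0 : (0 < r)%R by rewrite ltr_wpDl// divr_gt0// mulr_gt0.
have a0 : (0 < d / (2 * r))%R by rewrite divr_gt0// mulr_gt0.
have -> : (2 / d * fine (norm_of N g) + e = 2 * r / d)%R.
  by rewrite /r; field; rewrite gt_eqF.
have small : norm_of N ((fun x => d / (2 * r) * g x) \- (fun=> 0))%R < d%:E.
  rewrite (_ : _ \- _ = fun x => d / (2 * r) * g x)%R; last first.
    by apply/funext => x /=; rewrite subr0.
  rewrite norm_ofZ// gtr0_norm// -(fineK nfin) -EFinM lte_fin.
  apply: (@le_lt_trans _ _ (d / (2 * r) * r))%R.
    by rewrite ler_wpM2l// ?(ltW a0)// /r lerDl ltW// divr_gt0// mulr_gt0.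
  rewrite (_ : _ * r = d / 2)%R; last by field; rewrite gt_eqF.
  by rewrite ltr_pdivrMr// ltr_pMr// ltr1n.
have := dT _ (X_Z _ gX) small.
rewrite T0 subr0 TZ// normrM gtr0_norm// => Tg; apply: ltW.
by rewrite -ltr_pdivlMl// invf_div mulr1 in Tg.
Qed.

(** Identities for [T] extend by this lemma from approximating functions to their pointwise limits:
    [|g - g_ m| <= |g|] provides the majorant for order continuity, and [T_bound] carries the
    convergence over to [T]. *)
Let T_limit (g : rn -> R) (g_ : nat -> rn -> R) (s : R) : X g ->
  (forall m, measurable_fun setT (g_ m)) -> (forall m x, `|g x - g_ m x| <= `|g x|)%R ->
  (forall x, vanishes (fun m => `|g x - g_ m x|%:E)) ->
  vanishes (fun m => `|T (g_ m) - s|%:E) -> T g = s.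
Proof.
move=> gX mg_ gg_ vg vT; have [mg goo] := gX.
have [K K0 TK] := T_bound.
have mD m : measurable_fun setT (fun x => g x - g_ m x)%R by exact: measurable_funB.
have DX m : X (fun x => g x - g_ m x)%R by apply: (X_le (mD m) gX).
(* [|g_ m| <= 2 |g|], so monotonicity and homogeneity of the norm suffice. *)
have g_X m : X (g_ m).
  apply: (X_le (mg_ m) (X_Z 2%R gX)) => x; rewrite normrM ger0_norm// mulr_natl mulr2n.
  rewrite -[g_ m x](subKr (g x)); apply: le_trans (ler_normB _ _) _.
  by rewrite lerD2l.
apply/eqP; rewrite -subr_eq0; apply/eqP.
apply: (@lee_vanishes0 _ _ (fun m => K%:E * norm_of N (fun x => g x - g_ m x)%R +
    `|T (g_ m) - s|%:E)).
- move=> m; apply: (@le_trans _ _ (`|T (fun x => g x - g_ m x)%R|%:E + `|T (g_ m) - s|%:E)).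
    rewrite -EFinD lee_fin; apply: le_trans (ler_normD _ _).
    rewrite addrA -TD//; rewrite (_ : (fun x => _) = g)//.
    by apply/funext => x; rewrite subrK.
  by apply: leeD => //; exact: TK.
- apply: vanishesD => //; apply: vanishesZ => // [m|]; first exact: N_ge0.
  apply: (N_dominated (f := fun x => `|g x|%:E)) => //.
  + by move=> m; exact: mabs.
  + exact: mabs.
Qed.

Let weighted (phi : rn -> R) x := (g0 x * phi x)%R.

Let measurable_weighted phi : measurable_fun setT phi -> measurable_fun setT (weighted phi).
Proof. by move=> mphi; exact: measurable_funM. Qed.

Let X_weighted (phi : rn -> R) (a : R) : measurable_fun setT phi ->
  (forall x, `|phi x| <= a)%R -> X (weighted phi).
Proof.
move=> mphi phia; apply: (X_bounded (a := a)); first exact: measurable_weighted.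
by move=> x; rewrite normrM gtr0_norm// mulrC ler_wpM2r// ltW.
Qed.

Let X_weighted_indic S : measurable S -> X (weighted \1_S).
Proof. by move=> mS; apply: (@X_weighted _ 1%R) => //; exact: measurable_indic. Qed.

Let nu_fun (S : set rn) : \bar R := (T (weighted \1_S))%:E.

Let nu0 : nu_fun set0 = 0.
Proof.
rewrite /nu_fun (_ : weighted _ = fun=> 0%R) ?T0//.
by apply/funext => x; rewrite /weighted indic0 mulr0.
Qed.

Let nu_fin S : measurable S -> nu_fun S \is a fin_num.
Proof. by []. Qed.

Let nu_sum (F : nat -> set rn) m : (forall i, measurable (F i)) -> trivIset setT F ->
  \sum_(0 <= i < m) nu_fun (F i) = nu_fun (\big[setU/set0]_(i < m) F i).
Proof.
move=> mF tF; elim: m => [|m IH]; first by rewrite big_nil big_ord0 nu0.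
rewrite big_nat_recr//= IH big_ord_recr /= /nu_fun -EFinD -TD; last 2 first.
- by apply: X_weighted_indic; exact: bigsetU_measurable.
- exact: X_weighted_indic.
congr (T _)%:E; apply/funext => x; rewrite /weighted -mulrDr; congr (_ * _)%R.
have tF' : trivIset (fun i => xpredT i) F by exact: (sub_trivIset _ tF).
have UF := trivIset_bigsetUI tF' (n := m) (m := m) isT (leqnn m).
rewrite !indicE; have [xU|xU] := pselect ((\big[setU/set0]_(i < m) F i) x).
  have xUF : (\big[setU/set0]_(i < m) F i `|` F m) x by left.
  rewrite (mem_set xU) (mem_set xUF) memNset ?addr0// => xF.
  have : (\big[setU/set0]_(i < m) F i `&` F m) x by [].
  by rewrite UF.
rewrite (memNset xU) add0r; congr (_%:R); congr nat_of_bool.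
by apply/idP/idP; rewrite !inE; [right|case].
Qed.

(** The remainders [g0 * \1_(V \ U m)] are dominated by [g0] and are eventually 0 at each point, so
    their norms vanish. *)
Let nu_sigma_additive : semi_sigma_additive nu_fun.
Proof.
move=> F mF tF mUF.
under eq_fun do rewrite nu_sum//.
apply/fine_cvgP; split; first exact: nearW.
apply/cvgrPdist_le => e e0; have [K K0 TK] := T_bound.
pose U m := \big[setU/set0]_(i < m) F i.
pose V := \bigcup_i F i.
have mU m : measurable (U m) by exact: bigsetU_measurable.
have UV m : U m `<=` V by move=> x; rewrite /U -bigcup_mkord => -[k _ Fk]; exists k.
have UE x : V x -> exists M, forall m, (M <= m)%N -> U m x.
  move=> [k _ Fk]; exists k.+1 => m km; rewrite /U -bigcup_mkord; exists k => //.
have [M HM] : exists M, forall m, (M <= m)%N -> K%:E * norm_of N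
    (fun x => weighted \1_V x - weighted \1_(U m) x)%R <= e%:E.
  move: e e0; apply: vanishesZ => // [m|]; first exact: N_ge0.
  have mD m : measurable_fun setT (fun x => weighted \1_V x - weighted \1_(U m) x)%R.
    by apply: measurable_funB; apply: measurable_weighted; exact: measurable_indic.
  have DE m x : (weighted \1_V x - weighted \1_(U m) x = g0 x * \1_(V `\` U m) x)%R.
    rewrite /weighted -mulrBr; congr (_ * _)%R; rewrite !indicE.
    have [xU|xU] := pselect (U m x).
      rewrite (mem_set xU) (mem_set (UV _ _ xU)) subrr memNset//.
      by move=> [].
    rewrite (memNset xU) subr0; congr (_%:R); congr nat_of_bool.
    by apply/idP/idP; rewrite !inE; [move=> ?; split|case].
  apply: (N_dominated (f := EFin \o g0)) => //.
  - by move=> m; exact: mabs.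
  - exact/measurable_EFinP.
  - move=> m x /=; rewrite DE lee_fin normrM gtr0_norm// ler_piMr// ltW//.
  - move=> x; have [xV|xV] := pselect (V x).
      have [M UM] := UE _ xV; move=> e e0; exists M => m /UM xU.
      by rewrite DE indicE memNset ?mulr0 ?normr0 ?lee_fin ?ltW// => -[].
    move=> e e0; exists 0%N => m _.
    by rewrite DE indicE memNset ?mulr0 ?normr0 ?lee_fin ?ltW// => -[].
exists M => // m /= Mm; rewrite -lee_fin; apply: le_trans (HM m Mm).
rewrite (_ : T _ - T _ = T (fun x => weighted \1_V x - weighted \1_(U m) x))%R.
  apply: TK; apply: (X_bounded (a := 1%R)).
    by apply: measurable_funB; apply: measurable_weighted; exact: measurable_indic.
  move=> x; rewrite /weighted -mulrBr normrM gtr0_norm// mul1r.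
  apply: ler_piMr; first exact: ltW.
  have [xU|xU] := pselect (U m x).
    by rewrite !indicE (mem_set xU) (mem_set (UV _ _ xU)) subrr normr0.
  by rewrite [X in (_ - X)%R]indicE (memNset xU) subr0 indic_le1.
rewrite -[X in _ = T X](_ : (fun x => -1 * weighted \1_(U m) x + weighted \1_V x) = _)%R.
  by rewrite T_linear ?mulN1r ?(addrC (- _)%R)//; exact: X_weighted_indic.
by apply/funext => x; rewrite mulN1r addrC.
Qed.

Let nu := HB.pack_for (charge rn R) nu_fun
  (isCharge.Build _ _ _ nu_fun nu0 nu_fin nu_sigma_additive).

Let nu_dominated : nu `<< mu.
Proof.
apply/null_content_dominatesP => S mS S0.
have [K K0 TK] := T_bound.
suff TS : T (weighted \1_S) = 0%R by rewrite /= /nu_fun TS.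
apply/eqP; rewrite -normr_eq0 eq_le normr_ge0 andbT -lee_fin.
apply: le_trans (TK _ (X_weighted_indic mS)) _.
have mw : measurable_fun setT (weighted \1_S).
  by apply: measurable_weighted; exact: measurable_indic.
rewrite /norm_of N_null ?mule0//; first exact: mabs.
rewrite (ae_eq_integral (cst 0)) ?integral0//; first exact: mabs.
exists S; split => // x /= /not_implyP[_ h]; apply: contrapT => xS; apply: h.
by rewrite /weighted indicE memNset// mulr0 normr0.
Qed.

Let l : rn -> R := fine \o Radon_Nikodym nu mu.

Let il : mu.-integrable setT (EFin \o l).
Proof.
rewrite (_ : _ \o _ = Radon_Nikodym nu mu); first exact: Radon_Nikodym_integrable.
by apply/funext => x /=; rewrite fineK// Radon_Nikodym_fin_num.
Qed.

Let ml : measurable_fun setT l.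
Proof. by apply/measurable_EFinP; exact: measurable_int il. Qed.

Let bounded_measurable (phi : rn -> R) :=
  measurable_fun setT phi /\ exists a : R, forall x, (`|phi x| <= a)%R.

(** The identity holds for indicators by the Radon-Nikodym theorem and extends to all bounded
    measurable functions by linearity and limits. *)
Let represented phi := T (weighted phi) = (\int[mu]_x (l x * phi x))%R.

Let il_bounded phi : bounded_measurable phi ->
  mu.-integrable setT (EFin \o (fun x => l x * phi x)%R).
Proof.
move=> [mphi [a phia]].
apply: (le_integrable measurableT _ _ (integrableZl measurableT a il)).
  by apply/measurable_EFinP; exact: measurable_funM.
move=> x _ /=; rewrite lee_fin !normrM mulrC ler_wpM2r//.
by rewrite (le_trans (phia x))// ler_norm.
Qed.

Let X_bounded_measurable phi : bounded_measurable phi -> X (weighted phi).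
Proof. by move=> [mphi [a phia]]; exact: X_weighted phia. Qed.

Let represented_indic S : measurable S -> represented \1_S.
Proof.
move=> mS; rewrite /represented.
have := Radon_Nikodym_integral nu_dominated mS; rewrite /= /nu_fun integral_mkcond.
move=> /(congr1 fine) /= ->; rewrite /Rintegral; congr fine.
apply: eq_integral => x _; rewrite patchE indicE; case: ifPn => xS.
  by rewrite mulr1 /l /= fineK// Radon_Nikodym_fin_num.
by rewrite mulr0.
Qed.

Let bounded_measurableD (a : R) phi psi : bounded_measurable phi ->
  bounded_measurable psi -> bounded_measurable (fun x => a * phi x + psi x)%R.
Proof.
move=> [mphi [b phib]] [mpsi [c psic]]; split.
  by apply: measurable_funD => //; exact: measurable_funM.
exists (`|a| * b + c)%R => x; apply: le_trans (ler_normD _ _) _.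
by apply: lerD => //; rewrite normrM ler_wpM2l.
Qed.

Let representedD (a : R) phi psi : bounded_measurable phi -> bounded_measurable psi ->
  represented phi -> represented psi -> represented (fun x => a * phi x + psi x)%R.
Proof.
move=> bphi bpsi rphi rpsi; rewrite /represented.
transitivity (a * T (weighted phi) + T (weighted psi))%R.
  rewrite -T_linear//; try exact: X_bounded_measurable.
  by congr T; apply/funext => x; rewrite /weighted; ring.
rewrite rphi rpsi -RintegralZl//; last exact: il_bounded.
rewrite -RintegralD//; last 2 first.
- exact: (integrableZl measurableT a (il_bounded bphi)).
- exact: il_bounded.
by congr Rintegral; apply/funext => x; ring.
Qed.

(** The left-hand side converges by [T_limit]; the right-hand side by [Lnorm_dominated] with
    exponent 1 and majorant [|a * l|], where [a] bounds [phi]. *)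
Let represented_limit (phi : rn -> R) (phi_ : nat -> rn -> R) :
  bounded_measurable phi -> (forall m, bounded_measurable (phi_ m)) ->
  (forall m x, `|phi x - phi_ m x| <= `|phi x|)%R ->
  (forall x, vanishes (fun m => `|phi x - phi_ m x|%:E)) ->
  (forall m, represented (phi_ m)) -> represented phi.
Proof.
move=> bphi bphi_ le_phi vphi rphi_; have [mphi [a phia]] := bphi.
have mphi_ m : measurable_fun setT (phi_ m) by have [] := bphi_ m.
apply: (@T_limit _ (fun m => weighted (phi_ m))).
- exact: X_bounded_measurable.
- by move=> m; exact: measurable_weighted.
- by move=> m x; rewrite /weighted -mulrBr !normrM ler_wpM2l.
- move=> x; rewrite (_ : (fun m => _) = fun m => `|g0 x|%:E * `|phi x - phi_ m x|%:E).
    exact: vanishesZ.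
  by apply/funext => m; rewrite /weighted -mulrBr normrM EFinM.
have mD m : measurable_fun setT (fun x => `|(l x * (phi x - phi_ m x))%R|%:E : \bar R).
  apply: mabs; apply: measurable_funM => //; exact: measurable_funB.
apply: (@le_vanishes _ _ (fun m => Lnorm mu 1%:E (fun x => `|(l x * (phi x - phi_ m x))%R|%:E))).
  move=> m; rewrite rphi_ -RintegralB//; try exact: il_bounded.
  rewrite Lnorm1; have iD : mu.-integrable setT
      (EFin \o (fun x => l x * phi_ m x - l x * phi x)%R).
    exact: (integrableB measurableT (il_bounded (bphi_ m)) (il_bounded bphi)).
  have := le_abse_integral mu measurableT (measurable_int mu iD).
  rewrite /Rintegral -[X in `|X|%E <= _ -> _]fineK; last exact: integrable_fin_num.
  move=> /le_trans; apply; rewrite le_eqVlt; apply/orP; left; apply/eqP.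
  apply: eq_integral => x _ /=; rewrite normr_id -mulrBr !normrM.
  by rewrite distrC.
have mf : measurable_fun setT (fun x => `|(a * l x)%R|%:E : \bar R).
  by apply: mabs; exact: measurable_funM.
apply: (Lnorm_dominated (f := fun x => `|(a * l x)%R|%:E) ltr01) => //.
- move=> m x; rewrite lee_fin !normrM mulrC ler_wpM2r//.
  by rewrite (le_trans (le_phi m x))// (le_trans (phia x))// ler_norm.
- rewrite Lnorm1.
  have := integrableZl measurableT a il => /integrableP[_].
  apply: le_lt_trans; rewrite le_eqVlt; apply/orP; left; apply/eqP.
  by apply: eq_integral => x _ /=; rewrite normr_id.
- move=> x _; rewrite (_ : (fun m => _) = fun m => `|l x|%:E * `|phi x - phi_ m x|%:E).
    exact: vanishesZ.
  by apply/funext => m; rewrite normrM EFinM.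
Qed.

Let represented_sum (s : seq R) (S : R -> set rn) : (forall y, measurable (S y)) ->
  bounded_measurable (fun x => \sum_(y <- s) y * \1_(S y) x)%R /\
  represented (fun x => \sum_(y <- s) y * \1_(S y) x)%R.
Proof.
move=> mS; have bind S' : measurable S' -> bounded_measurable \1_S'.
  by move=> mS'; split; [exact: measurable_indic|exists 1%R].
elim: s => [|y s [bs rs]].
  rewrite (_ : (fun x => _) = \1_set0).
    by split; [exact: bind|exact: represented_indic].
  by apply/funext => x; rewrite big_nil indic0.
rewrite (_ : (fun x => _) =
    (fun x => y * \1_(S y) x + \sum_(z <- s) z * \1_(S z) x))%R; last first.
  by apply/funext => x; rewrite big_cons.
split; first exact: bounded_measurableD (bind _ (mS y)) bs.
by apply: representedD => //; [exact: bind|exact: represented_indic].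
Qed.

Let represented_simple (h : {nnsfun rn >-> R}) :
  bounded_measurable h /\ represented h.
Proof.
have mh y : measurable (h @^-1` [set y]) by exact: measurable_sfunP.
have hE : (fun x => \sum_(y <- finmap.enum_fset (fset_set (range h)))
    y * \1_(h @^-1` [set y]) x)%R = h.
  by apply/funext => x; rewrite [RHS]fimfunE fsbig_finite.
have [bh rh] := represented_sum (finmap.enum_fset (fset_set (range h))) mh.
by split; rewrite -hE.
Qed.

(** Simple functions that approximate [phi] from below satisfy [|phi - h m| <= |phi|], the condition
    of [represented_limit]. *)
Let represented_ge0 phi : bounded_measurable phi -> (forall x, 0 <= phi x)%R ->
  represented phi.
Proof.
move=> bphi phi0; have [mphi _] := bphi.
have mEphi : measurable_fun setT (EFin \o phi) by exact/measurable_EFinP.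
pose h := nnsfun_approx measurableT mEphi.
have hcvg x : h m x @[m --> \oo] --> phi x.
  have /fine_cvgP[_] :=
    cvg_nnsfun_approx measurableT mEphi (fun x _ => phi0 x) (x := x) I.
  exact.
have hle m x : (h m x <= phi x)%R.
  rewrite -(cvg_lim (@Rhausdorff R) (hcvg x)); apply: nondecreasing_cvgn_le.
    by move=> i j ij; have /lefP := nd_nnsfun_approx measurableT mEphi ij; apply.
  by apply/cvg_ex; exists (phi x).
apply: (@represented_limit _ (fun m => h m)) => //.
- by move=> m; have [] := represented_simple (h m).
- by move=> m x; rewrite !ger0_norm// ?subr_ge0// lerBlDr lerDl.
- move=> x e e0; have /cvgrPdist_le/(_ e e0)[M _ HM] := hcvg x.
  by exists M => m Mm; rewrite lee_fin; exact: HM.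
- by move=> m; have [] := represented_simple (h m).
Qed.

Let represented_bounded phi : bounded_measurable phi -> represented phi.
Proof.
move=> [mphi [a phia]].
have bpos : bounded_measurable (fun x => Num.max (phi x) 0)%R.
  split; first by apply: measurable_maxr.
  exists a => x; rewrite ger0_norm ?le_max ?lexx ?orbT// ge_max.
  by rewrite (le_trans (ler_norm _) (phia x)) (le_trans _ (phia x)).
have bneg : bounded_measurable (fun x => Num.max (- phi x) 0)%R.
  split; first by apply: measurable_maxr => //; exact: measurableT_comp.
  exists a => x; rewrite ger0_norm ?le_max ?lexx ?orbT// ge_max.
  by rewrite (le_trans (ler_norm _)) ?normrN// (le_trans _ (phia x)).
have := @representedD (-1)%R _ _ bneg bpos
  (represented_ge0 bneg (fun x => _)) (represented_ge0 bpos (fun x => _)).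
rewrite (_ : (fun x => _) = phi); last first.
  apply/funext => x; have [p0|p0] := leP 0%R (phi x).
    by rewrite (@max_r _ _ (- phi x)%R 0%R) ?oppr_le0// mulr0 add0r.
  by rewrite (@max_l _ _ (- phi x)%R 0%R) ?oppr_ge0 ?ltW// mulN1r opprK addr0.
by apply => x; rewrite le_max lexx orbT.
Qed.

Lemma functional_representation :
  exists2 L, Y L & forall g, X g -> T g = pairing L g.
Proof.
have [K K0 TK] := T_bound.
have mg0V : measurable_fun setT (fun x => (g0 x)^-1%R).
  by apply: measurable_funV_ge0 => // x; exact: ltW.
pose L x := (l x / g0 x)%R.
have mL : measurable_fun setT L by exact: measurable_funM.
have repL (m : R) (g : rn -> R) : measurable_fun setT g ->
    (forall x, `|g x| <= m * g0 x)%R -> T g = pairing L g.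
  move=> mg gm; have bphi : bounded_measurable (fun x => g x / g0 x)%R.
    split; first exact: measurable_funM.
    exists m => x; rewrite normrM normfV (gtr0_norm (g0_gt0 x)).
    by rewrite ler_pdivrMr.
  have := represented_bounded bphi; rewrite /represented.
  rewrite (_ : weighted _ = g); last first.
    by apply/funext => x; rewrite /weighted mulrC divfK// gt_eqF.
  by move=> ->; congr Rintegral; apply/funext => x; rewrite /L; ring.
(* [dual_bound] tests only with functions bounded by a multiple of [g0], for which [T] is already
   known to be the pairing with [L]. *)
have LY : Y L.
  split => //; apply: le_lt_trans (ltry (B * K)%R); apply: dual_bound => //.
    rewrite (_ : _ \o _ = EFin \o l)//; apply/funext => x /=.
    by rewrite /L divfK// gt_eqF.
  move=> m g mg gm Ng1; rewrite -(repL _ _ mg gm).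
  apply: le_trans (ler_norm _) _; rewrite -lee_fin.
  apply: le_trans (TK _ (X_bounded mg gm)) _.
  by rewrite -[leRHS]mule1; apply: lee_wpmul2l.
exists L => // g gX; have [mg goo] := gX.
(* On [S m] the function [g] is bounded by a multiple of [g0], so [repL] applies to its restriction;
   as [g0] is positive, these sets exhaust the space. *)
pose S (m : nat) := [set x | (`|g x| <= m%:R * g0 x)%R].
have mS m : measurable (S m).
  have mg1 : measurable_fun setT (fun x => `|g x|%R) by exact: measurableT_comp.
  have mg2 : measurable_fun setT (fun x => m%:R * g0 x)%R by exact: measurable_funM.
  by rewrite -[X in measurable X]setTI; exact: (measurable_fun_ler mg1 mg2).
pose g_ m x := (g x * \1_(S m) x)%R.
have mg_ m : measurable_fun setT (g_ m).
  by apply: measurable_funM => //; exact: measurable_indic.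
have g_in m x : S m x -> g_ m x = g x by move=> Sx; rewrite /g_ indicE mem_set// mulr1.
have g_out m x : ~ S m x -> g_ m x = 0%R.
  by move=> Sx; rewrite /g_ indicE memNset// mulr0.
have g_g m x : (`|g x - g_ m x| <= `|g x|)%R.
  have [xS|xS] := pselect (S m x); first by rewrite g_in// subrr normr0.
  by rewrite g_out// subr0.
have vg x : vanishes (fun m => `|g x - g_ m x|%:E).
  move=> e e0; exists (Num.truncn (`|g x| / g0 x)).+1 => m mM.
  rewrite g_in ?subrr ?normr0 ?lee_fin ?ltW// /S /=.
  rewrite -ler_pdivrMr// (le_trans (ltW (truncnS_gt _)))// ler_nat.
  exact: mM.
have gmX m : X (g_ m).
  apply: (X_le (mg_ m) gX) => x; rewrite normrM ler_piMr//.
have mD m : measurable_fun setT (fun x => g_ m x - g x)%R by exact: measurable_funB.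
have DX m : X (fun x => g_ m x - g x)%R.
  by apply: (X_le (mD m) gX) => x; rewrite distrC.
apply: (T_limit gX mg_ g_g vg).
have finL : norm_of N' L \is a fin_num.
  by rewrite ge0_fin_numE; [case: LY|exact: N'_ge0].
have nL0 : (0 <= fine (norm_of N' L))%R by rewrite fine_ge0//; exact: N'_ge0.
apply: (@le_vanishes _ _ (fun m => (A * fine (norm_of N' L))%:E *
    norm_of N (fun x => g_ m x - g x)%R)).
  move=> m; rewrite (repL m%:R)//; last first.
    move=> x; have [xS|xS] := pselect (S m x); first by rewrite g_in.
    by rewrite g_out// normr0 mulr_ge0// ltW.
  rewrite pairingB//; apply: le_trans (pairing_le LY (DX m)) _.
  by rewrite EFinM fineK// -muleA [X in _ * X <= _]muleC.
apply: vanishesZ; [by rewrite mulr_ge0// ltW|by move=> m; exact: N_ge0|].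
apply: (N_dominated (f := fun x => `|g x|%:E)) => //.
- by move=> m; exact: mabs.
- exact: mabs.
- by move=> m x; rewrite distrC lee_fin.
- by move=> x; apply: le_vanishes (vg x) => m; rewrite distrC.
Qed.

End representation.

(** Testing with the sign of [L - L'] times [g0] shows that [|L - L'| * g0] has integral 0, and [g0]
    is positive. *)
Lemma pairing_inj (L L' : rn -> R) : Y L -> Y L' ->
  (forall g, X g -> pairing L g = pairing L' g) -> {ae mu, forall x, L x = L' x}.
Proof.
move=> LY L'Y LL'; have [mL _] := LY; have [mL' _] := L'Y.
pose D x := (L x - L' x)%R.
have mD : measurable_fun setT D by exact: measurable_funB.
pose g x := (D x * `|D x|^-1 * g0 x)%R.
have sgD x : (`|D x * `|D x|^-1| <= 1)%R.
  rewrite normrM normfV normr_id; have [->|D0] := eqVneq (D x) 0%R.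
    by rewrite normr0 mul0r.
  by rewrite divff// normr_eq0.
have gX : X g.
  apply: (X_bounded (a := 1%R)).
    apply: measurable_funM => //; apply: measurable_funM => //.
    apply: measurable_funV_ge0 => //; exact: measurableT_comp.
  by move=> x; rewrite normrM (gtr0_norm (g0_gt0 x)) ler_wpM2r// ltW.
have iL := integrable_pairing LY gX; have iL' := integrable_pairing L'Y gX.
have Dg x : (L x * g x - L' x * g x = `|D x| * g0 x)%R.
  rewrite -mulrBl -/(D x) /g; have [->|D0] := eqVneq (D x) 0%R.
    by rewrite normr0 !mul0r.
  rewrite !mulrA; congr (_ * _)%R.
  by rewrite -expr2 -real_normK ?num_real// expr2 mulfK// normr_eq0.
have D0R : (\int[mu]_x (L x * g x - L' x * g x) = 0)%R.
  by rewrite RintegralB//; apply/eqP; rewrite subr_eq0; apply/eqP; exact: LL'.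
have iD : mu.-integrable setT (EFin \o (fun x => L x * g x - L' x * g x)%R).
  exact: (integrableB measurableT iL iL').
have D0 : \int[mu]_x (`|D x| * g0 x)%:E = 0.
  transitivity (\int[mu]_x (L x * g x - L' x * g x)%:E).
    by apply: eq_integral => x _; rewrite Dg.
  rewrite -[LHS]fineK; last exact: integrable_fin_num.
  by congr (_%:E); exact: D0R.
have mDg : measurable_fun setT (fun x => (`|D x| * g0 x)%:E : \bar R).
  apply/measurable_EFinP; apply: measurable_funM => //; exact: measurableT_comp.
have absD0 : \int[mu]_x `|(`|D x| * g0 x)%:E| = 0.
  rewrite -D0; apply: eq_integral => x _; rewrite gee0_abs// lee_fin mulr_ge0// ltW//.
have := (ae_eq_integral_abs mu measurableT mDg).1 absD0; apply: filterS => x /(_ I) [] /eqP.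
by rewrite mulf_eq0 normr_eq0 subr_eq0 (gt_eqF (g0_gt0 x)) orbF => /eqP.
Qed.

(** The upper bound is Hoelder's inequality. It makes the dual norm finite, so the dual norm can
    serve as the constant [K] of [dual_bound], which gives the lower bound. *)
Lemma dual_norm_equivalence (L : rn -> R) : Y L ->
  (B^-1%:E * norm_of N' L <= dual_norm X (norm_of N) (pairing L)) /\
  (dual_norm X (norm_of N) (pairing L) <= A%:E * norm_of N' L).
Proof.
move=> LY; have [mL Loo] := LY.
have nL0 : 0 <= norm_of N' L by exact: N'_ge0.
have finL : norm_of N' L \is a fin_num by rewrite ge0_fin_numE.
have up : dual_norm X (norm_of N) (pairing L) <= A%:E * norm_of N' L.
  apply: ge_ereal_sup => _ [g [gX Ng1] <-]; apply: le_trans (pairing_le LY gX) _.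
  apply: lee_wpmul2l; first by rewrite lee_fin ltW.
  by rewrite -[leRHS]mul1e; apply: lee_wpmul2r.
split => //.
have dn0 : 0 <= dual_norm X (norm_of N) (pairing L).
  apply: (@le_trans _ _ `|pairing L (fun=> 0%R)|%:E); first by rewrite lee_fin.
  have X0 : X (fun=> 0%R) by apply: (X_bounded (a := 0%R)) => // x; rewrite normr0 mul0r.
  apply: ereal_sup_ubound; exists (fun=> 0%R) => //; split => //.
  suff -> : norm_of N (fun=> 0%R) = 0 by exact: lee01.
  apply: N_null => //.
  by rewrite integral0_eq// => x _; rewrite normr0.
have dnfin : dual_norm X (norm_of N) (pairing L) \is a fin_num.
  rewrite ge0_fin_numE//; apply: le_lt_trans up _.
  by rewrite -(fineK finL) -EFinM ltry.
rewrite lee_pdivrMl// -(fineK dnfin) -EFinM; apply: dual_bound => //.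
- by rewrite fine_ge0.
- exact: integrable_pairing.
move=> m g mg gm Ng1; rewrite -lee_fin [leRHS]fineK//.
apply: (@le_trans _ _ `|pairing L g|%:E); first by rewrite lee_fin ler_norm.
by apply: ereal_sup_ubound; exists g => //; split => //; exact: X_bounded gm.
Qed.

Theorem dual_space_of : dual_space_is X (norm_of N) Y (norm_of N').
Proof.
split.
- move=> L LY; split; last exact: pairing_continuous.
  by move=> g gX; exact: integrable_pairing.
- by move=> T Tc; exact: functional_representation.
- by move=> L L' LY L'Y LL'; exact: pairing_inj.
- exists B^-1%R, A; split => //; first by rewrite invr_gt0.
  by move=> L LY; exact: dual_norm_equivalence.
Qed.

End duality.

(** * Null functions and dyadic shells *)

Section null_functions.
Context {R : realType}.
Local Notation lebesgue := (@lebesgue_measure R).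

Lemma Lnorm_null d (T : measurableType d) (mu : {measure set T -> \bar R}) (p : R) f :
  (0 < p)%R -> measurable_fun setT f -> (forall x, 0 <= f x) ->
  \int[mu]_x f x = 0 -> Lnorm mu p%:E f = 0.
Proof.
move=> p0 mf f0 If; rewrite Lnorm_ge0E// (ae_eq_integral (cst 0)) ?integral0//.
- by rewrite poweR0r// invr_neq0// gt_eqF.
- exact: measurable_poweR_fun.
have : \int[mu]_x `|f x| = 0 by rewrite -If; apply: eq_integral => x _; rewrite gee0_abs.
move/((ae_eq_integral_abs mu measurableT mf).1).
by apply: filterS => x /(_ I) /= -> _; rewrite poweR0r// gt_eqF.
Qed.

(** By Tonelli's theorem almost every inner integral is 0, so the inner norm is 0 almost everywhere
    and the induction hypothesis applies to it. *)
Lemma mixed_norm_null n (u : n.-tuple R) f : (forall i, 0 < tnth u i)%R ->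
  measurable_fun setT f -> (forall x, 0 <= f x) -> \int[leb n]_x f x = 0 ->
  mixed_norm u f = 0.
Proof.
elim: n u f => [|n IH] u f u0 mf f0 If.
  by move: If; rewrite integral_leb0//= => ->; rewrite abse0.
have [uh ut] := tuple_cons_gt0 u0; rewrite mixed_normS; apply: IH => //.
- exact: measurable_inner_norm.
- by move=> y; exact: inner_norm_ge0.
have mI : measurable_fun setT (fun y : rn R n => \int[lebesgue]_x f (rn_cons (x, y))).
  apply: (@measurable_integral_parameter _ _ _ _ _ lebesgue
    (fun z : rn R n * measurableTypeR R => f (rn_cons (z.2, z.1)))) => //.
  apply: (measurableT_comp mf); apply: measurable_fun_rn_cons.
    exact: measurable_snd.
  exact: measurable_fst.
rewrite (ae_eq_integral (cst 0)) ?integral0//; first exact: measurable_inner_norm.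
rewrite integral_leb_cons// in If.
have absI : \int[leb n]_y `|\int[lebesgue]_x f (rn_cons (x, y))| = 0.
  by rewrite -If; apply: eq_integral => y _; rewrite gee0_abs// integral_ge0.
have := (ae_eq_integral_abs (leb n) measurableT mI).1 absI; apply: filterS => y /(_ I) /= Iy _; apply: Lnorm_null => //.
exact: measurable_section.
Qed.

Lemma slice_null n (u v : n.-tuple R) t f : (forall i, 0 < tnth u i)%R ->
  (forall i, 0 < tnth v i)%R -> measurable_fun setT f -> (forall x, 0 <= f x) ->
  \int[leb n]_x f x = 0 -> slice u v t f = 0.
Proof.
move=> u0 v0 mf f0 If; rewrite /slice (_ : local_norm v t f = cst 0).
  by apply: mixed_norm_null => //; rewrite integral0.
apply/funext => x; apply: mixed_norm_null => //.
- exact: measurable_ball_section.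
- by move=> y; exact: ball_section_ge0.
apply/eqP; rewrite eq_le; apply/andP; split; last first.
  by apply: integral_ge0 => y _; exact: ball_section_ge0.
rewrite -If; apply: ge0_le_integral => //.
- by move=> y _; exact: ball_section_ge0.
- exact: measurable_ball_section.
- by move=> y _; rewrite -[leRHS]mule1; apply: lee_wpmul2l => //; exact: ball_ind_le1.
Qed.

End null_functions.

(** The enumeration 0, -1, 1, -2, 2, and so on. A large index means a large absolute value, so a
    bounded set away from the origin meets shells of bounded index only. *)
Definition int_of_nat (i : nat) : int := if odd i then Negz i./2 else Posz i./2.

Lemma int_of_nat_bij : bijective int_of_nat.
Proof.
exists (fun k => match k with Posz m => m.*2 | Negz m => m.*2.+1 end).
- move=> i; rewrite /int_of_nat; case: ifPn => io.
    by rewrite -[RHS]odd_double_half io.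
  by rewrite -[RHS]odd_double_half (negPf io).
- case=> m; rewrite /int_of_nat /=; first by rewrite odd_double doubleK.
  by rewrite odd_double /= uphalf_double.
Qed.

(** * Geometry of the dyadic shells *)

Section dyadic_shells.
Context {R : realType} {n : nat}.
Local Notation rn := (rn R n).
Implicit Types x y : rn.

Definition shell (i : nat) : set rn := dyadic_shell (int_of_nat i).

Lemma measurable_dyadic_ball (k : int) : measurable (dyadic_ball k : set rn).
Proof.
rewrite -[X in measurable X]setTI; apply: (@measurable_fun_ler _ _ _ setT
  (fun y => euclid_dist (@origin R n) y) (cst (2 ^ k)%R)) => //.
exact: (measurableT_comp measurable_euclid_dist (pair1_measurable _)).
Qed.

Lemma measurable_shell i : measurable (shell i).
Proof. by apply: measurableD; exact: measurable_dyadic_ball. Qed.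

Lemma dyadic_ball_homo (j k : int) : (j <= k)%R -> dyadic_ball j `<=` (dyadic_ball k : set rn).
Proof. by move=> jk y /le_trans; apply; apply: ler_weXz2l => //; rewrite ler1n. Qed.

Lemma trivIset_shell : trivIset setT shell.
Proof.
apply/trivIsetP => i j _ _ ij; rewrite -subset0 => y [[yi nyi] [yj nyj]].
have : int_of_nat i != int_of_nat j.
  by apply: contra ij => /eqP /(bij_inj int_of_nat_bij) ->.
case: ltgtP => // ijlt _.
  by apply: nyj; apply: dyadic_ball_homo yi; rewrite lerBrDr lezD1.
by apply: nyi; apply: dyadic_ball_homo yj; rewrite lerBrDr lezD1.
Qed.

Lemma euclid_dist_ge0 x y : (0 <= euclid_dist x y)%R.
Proof. exact: sqrtr_ge0. Qed.

Lemma euclid_dist_sqr x y :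
  (euclid_dist x y ^+ 2 = \sum_(i < n) (tnth x i - tnth y i) ^+ 2)%R.
Proof. by rewrite sqr_sqrtr//; apply: sumr_ge0 => i _; exact: sqr_ge0. Qed.

Lemma coord_le_dist y i : (`|tnth y i| <= euclid_dist (@origin R n) y)%R.
Proof.
rewrite -(@ler_pXn2r _ 2) ?nnegrE ?euclid_dist_ge0// real_normK ?num_real//.
rewrite euclid_dist_sqr (bigD1 i)//= tnth_mktuple sub0r sqrrN lerDl.
by apply: sumr_ge0 => j _; exact: sqr_ge0.
Qed.

Lemma euclid_dist_quasi x y (z : rn) :
  (euclid_dist x z ^+ 2 <= 2 * euclid_dist x y ^+ 2 + 2 * euclid_dist y z ^+ 2)%R.
Proof.
rewrite !euclid_dist_sqr !mulr_sumr -big_split/=; apply: ler_sum => i _.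
set a := tnth x i; set b := tnth y i; set c := tnth z i.
rewrite -subr_ge0 (_ : (_ - _ = (a - b - (b - c)) ^+ 2)%R) ?sqr_ge0//; ring.
Qed.

Lemma shell_box i : exists2 a : R, (0 <= a)%R & forall y, shell i y -> box a y = 1%R.
Proof.
exists (2 ^ int_of_nat i)%R; first by rewrite exprz_ge0.
by move=> y [yi _]; apply: box1 => j; apply: le_trans yi; exact: coord_le_dist.
Qed.

Lemma euclid_dist_gt0 x : x != @origin R n -> (0 < euclid_dist (@origin R n) x)%R.
Proof.
move=> x0; rewrite lt_neqAle euclid_dist_ge0 andbT eq_sym; apply: contra x0 => /eqP d0.
apply/eqP; apply: eq_from_tnth => i; rewrite tnth_mktuple; apply/eqP.
by rewrite -normr_eq0 eq_le normr_ge0 andbT -d0 coord_le_dist.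
Qed.

Lemma pow2_unbounded (r : R) : exists N : nat, (r < 2 ^ (N : int))%R.
Proof.
exists (Num.truncn r).+1; apply: lt_le_trans (truncnS_gt r) _.
by rewrite -exprnP -natrX ler_nat ltnW// ltn_expl.
Qed.

Lemma pow2_small (r : R) : (0 < r)%R -> exists N : nat, (2 ^ (- (N : int)) < r)%R.
Proof.
move=> r0; have [N rN] := pow2_unbounded r^-1; exists N.
by rewrite -invr_expz -[ltRHS]invrK ltf_pV2 ?posrE ?invr_gt0// exprz_gt0.
Qed.

Lemma shell_cover x : x != @origin R n -> exists i, shell i x.
Proof.
move=> x0; have d0 := euclid_dist_gt0 x0; set d := euclid_dist _ _ in d0.
have [N1 dN1] := pow2_unbounded d; have [N2 dN2] := pow2_small d0.
(* The shell of [x] is given by the least exponent [k] with [d <= 2 ^ k]. The shift by [N2] makes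
   this a search among natural numbers, and the least [m] is not 0 because [2 ^ (- N2) < d]. *)
have ex : exists m : nat, (d <= 2 ^ ((m : int) - (N2 : int)))%R.
  by exists (N1 + N2)%N; rewrite PoszD addrK ltW.
have := ex_minnP ex; case: ex_minnP => m dm mmin _.
have [g _ eg] := int_of_nat_bij.
exists (g ((m : int) - (N2 : int))%R); rewrite /shell eg; split => //=.
rewrite -/d => dm1; case: m => [|m] in dm mmin dm1 *.
  move: dm; rewrite sub0r => dm; by have := le_lt_trans dm dN2; rewrite ltxx.
have := mmin m; rewrite -/d (_ : _ - 1 = (m : int) - (N2 : int))%R in dm1 *; last first.
  by rewrite intS; ring.
by move=> /(_ dm1); rewrite ltnn.
Qed.

(** Let [d] be the distance from [x] to the origin. In the ball of radius [d / 2] around [x], the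
    inequality [euclid_dist_quasi] keeps the distance to the origin between [d / 2] and [2 * d],
    which only finitely many shells allow. *)
Lemma shell_local x : x != @origin R n -> exists2 r : R, (0 < r)%R &
  exists m, forall i y, (m <= i)%N -> oball x r y -> ~ shell i y.
Proof.
move=> x0; have d0 := euclid_dist_gt0 x0; set d := euclid_dist _ _ in d0.
have d20 : (0 < d / 2)%R by rewrite divr_gt0.
exists (d / 2)%R => //.
have [N1 dN1] := pow2_unbounded (2 * d)%R; have [N2 dN2] := pow2_small d20.
(* Doubling undoes the halving in [int_of_nat]. The successor of [N1] accounts for the inner radius
   of the shell of exponent [k], which is [2 ^ (k - 1)]. *)
exists (maxn N1.+1 N2).*2 => i y im /= xy [yi nyi].
have xy2 : (euclid_dist x y ^+ 2 < (d / 2) ^+ 2)%R.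
  by rewrite ltr_pXn2r ?nnegrE ?euclid_dist_ge0// ltW.
set e := euclid_dist (@origin R n) y.
have e0 : (0 <= e)%R by exact: euclid_dist_ge0.
have q1 := euclid_dist_quasi (@origin R n) x y.
have q2 := euclid_dist_quasi (@origin R n) y x.
rewrite -/d -/e (euclid_distC y x) in q1 q2.
have dsq : ((d / 2) ^+ 2 = d ^+ 2 / 4)%R by field.
have e1 : (d / 2 <= e)%R.
  rewrite -(@ler_pXn2r _ 2) ?nnegrE ?(ltW d20)//; lra.
have e2 : (e <= 2 * d)%R.
  rewrite -(@ler_pXn2r _ 2) ?nnegrE ?mulr_ge0 ?(ltW d0)//.
  rewrite exprMn; have : (0 <= d ^+ 2)%R by exact: sqr_ge0.
  by lra.
have ih : (maxn N1.+1 N2 <= i./2)%N by rewrite -[X in (X <= _)%N]doubleK half_leq.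
move: yi nyi; rewrite /shell /int_of_nat; case: (odd i) => yi nyi.
  have : (e < d / 2)%R; last by rewrite ltNge e1.
  apply: le_lt_trans yi _; apply: le_lt_trans dN2; apply: ler_weXz2l; first by rewrite ler1n.
  by rewrite NegzE lerN2 lez_nat ltnW// ltnS (leq_trans (leq_maxr N1.+1 N2)).
apply: nyi => /=; apply: (le_trans e2); apply: (le_trans (ltW dN1)).
apply: ler_weXz2l; first by rewrite ler1n.
rewrite lerBrDr -[1%R]/(1%:Z) -PoszD addn1 lez_nat.
exact: leq_trans (leq_maxl _ _) ih.
Qed.

(** Only the origin is missed, and it lies in cubes of volume [(2 a) ^ n]. In dimension 0 that point
    would carry the whole mass. *)
Lemma shell_cover_ae : (0 < n)%N -> {ae leb n, forall y, exists i, shell i y}.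
Proof.
move=> n0; pose C : set rn := ~` \bigcup_i shell i.
have mC : measurable C.
  by apply: measurableC; apply: bigcup_measurable => i _; exact: measurable_shell.
exists C; split => //; last first.
  by move=> y /= ny [i _ yi]; apply: ny; exists i.
have CE y : C y -> y = @origin R n.
  move=> Cy; apply/eqP; apply: contrapT => /negP y0; apply: Cy.
  by have [i yi] := shell_cover y0; exists i.
apply/eqP; rewrite eq_le measure_ge0 andbT.
apply/lee_addgt0Pr => e e0; rewrite add0e.
(* Then [2 a] is at most both 1 and [e], hence [(2 a) ^ n <= 2 a <= e]. *)
pose a := (Num.min e 1 / 2)%R.
have a0 : (0 < a)%R by rewrite divr_gt0// lt_min e0 ltr01.
have a2 : (a *+ 2 = Num.min e 1)%R by rewrite /a -mulr_natr divfK.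
apply: (@le_trans _ _ (\int[leb n]_y (box a y)%:E)).
  rewrite -[leLHS]mul1e -integral_cst// integral_mkcond; apply: ge0_le_integral => //.
  - by move=> y _; rewrite patchE; case: ifP.
  - apply/(measurable_restrictT _ _).1 => //.
  - by apply/measurable_EFinP; exact: measurable_box.
  - move=> y _; rewrite patchE; case: ifPn => [|_]; last by rewrite lee_fin box_ge0.
    rewrite inE => /CE ->; rewrite box1// => i.
    by rewrite tnth_mktuple normr0 ltW.
rewrite integral_box ?(ltW a0)// a2 lee_fin.
apply: (@le_trans _ _ (Num.min e 1)%R); last by rewrite ge_min lexx.
case: n n0 => // k _; rewrite exprS; apply: ler_piMr; first by rewrite le_min ltW//=.
by apply: exprn_ile1; [rewrite le_min ltW//=|rewrite ge_min lexx orbT].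
Qed.

End dyadic_shells.

(** * Herz-slice spaces *)

Section herz_slice_norms.
Context {R : realType} {n : nat}.
Local Notation rn := (rn R n).
Implicit Types (u v : n.-tuple R) (t b : R) (rho sigma : (nat -> \bar R) -> \bar R).

Definition dyadic_weight b (i : nat) : R := (2 `^ ((int_of_nat i)%:~R * b))%R.

Definition shell_restrict i (f : rn -> \bar R) := restrict_to (@shell R n) i f.

(* [herz_slice_norm] with outer norm [rho], summed along an enumeration of [int]. *)
Definition herz_functional rho u v t b (f : rn -> \bar R) : \bar R :=
  rho (fun i => (dyadic_weight b i)%:E *
    mixed_norm u (fun x => local_norm v t (shell_restrict i f) x /
      mixed_norm v (fun y => ball_ind t (x, y)))).

Lemma slice_norm_functional u v t (f : rn -> R) i :
  slice_norm u v t (f \* \1_(shell i))%R =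
  mixed_norm u (fun x => local_norm v t (shell_restrict i (fun y => `|f y|%:E)) x /
      mixed_norm v (fun y => ball_ind t (x, y))).
Proof.
congr mixed_norm; apply/funext => x; congr (_ / _).
rewrite -mixed_norm_abse; congr mixed_norm; apply/funext => y /=.
by rewrite /shell_restrict /restrict_to /ball_ind -!EFinM !normrM !(@ger0_norm _ (\1_ _ _))// indicE.
Qed.

Lemma herz_slice_norm_EFin u v t b (r : R) (f : rn -> R) : (0 < r)%R ->
  herz_slice_norm u v t b r%:E f =
  norm_of (herz_functional (Lnorm (@counting nat R) r%:E) u v t b) f.
Proof.
move=> r0; rewrite /herz_slice_norm /norm_of /herz_functional.
pose S k := slice_norm u v t (f \* \1_(dyadic_shell k))%R.
have S0 k : 0 <= S k by exact: mixed_norm_ge0.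
rewrite Lnorm_ge0E; last first.
  by move=> i; rewrite mule_ge0 ?lee_fin ?powR_ge0//; exact: mixed_norm_ge0.
congr (_ `^ _); rewrite ge0_integral_count; last by move=> i; exact: poweR_ge0.
rewrite (@reindex_esum _ _ _ setT setT int_of_nat); last first.
  by rewrite setTT_bijective; exact: int_of_nat_bij.
rewrite nneseries_esumT; last by move=> i; exact: poweR_ge0.
apply: eq_esum => i _; rewrite -slice_norm_functional poweRM ?lee_fin ?powR_ge0//.
  by rewrite poweR_EFin -powRrM.
exact: S0.
Qed.

Lemma herz_slice_norm_pinfty u v t b (f : rn -> R) :
  herz_slice_norm u v t b +oo f =
  norm_of (herz_functional (fun a => ereal_sup (range a)) u v t b) f.
Proof.
rewrite /herz_slice_norm /norm_of /herz_functional; congr ereal_sup.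
have [g _ eg] := int_of_nat_bij; apply/seteqP; split => _ /= [k _ <-].
  by exists (g k) => //; rewrite -slice_norm_functional /dyadic_weight /shell eg.
by exists (int_of_nat k) => //; rewrite -slice_norm_functional.
Qed.

(** By translation invariance the denominator is the same for all centers, so it can be moved into
    the weights. *)
Lemma herz_functionalE rho u v z t b f : (0 < t)%R -> (forall i, 0 < tnth u i)%R ->
  conjugate_exponents v z -> measurable_fun setT f -> (forall y, 0 <= f y) ->
  herz_functional rho u v t b f =
  herz t (@shell R n) rho
    (fun i => dyadic_weight b i / fine (ball_norm v t))%R u v f.
Proof.
move=> t0 u0 vz mf f0; have v0 := conjugate_exponents_gt0 vz.
have bgt0 := ball_norm_gt0 vz t0; have blty := ball_norm_lty v0 t0.
have bfin : ball_norm v t \is a fin_num by rewrite ge0_fin_numE// ltW.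
have bf0 : (0 < fine (ball_norm v t))%R by rewrite fine_gt0// bgt0.
congr rho; apply/funext => i; rewrite EFinM -muleA; congr (_ * _).
have ms : measurable_fun setT (shell_restrict i f).
  by apply: emeasurable_funM => //; apply/measurable_EFinP;
    apply: measurable_indic; exact: measurable_shell.
have s0 y : 0 <= shell_restrict i f y by rewrite mule_ge0// lee_fin indicE.
rewrite -mixed_norm_ge0Z//.
- congr mixed_norm; apply/funext => x; rewrite mixed_norm_ball_ind// muleC.
  by rewrite -[X in X^-1](fineK bfin) inver gt_eqF.
- by rewrite lee_fin invr_ge0 ltW.
- exact: measurable_local_norm.
- by move=> x; exact: local_norm_ge0.
Qed.

Lemma conj_expP (p : R) : (1 < p)%R -> (1 < conj_exp p)%R /\ (p^-1 + (conj_exp p)^-1 = 1)%R.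
Proof.
move=> p1; have p10 : (0 < p - 1)%R by rewrite subr_gt0.
split; first by rewrite ltr_pdivlMr// mul1r gtrBl.
by rewrite invf_div; field; rewrite gt_eqF// (lt_trans ltr01).
Qed.

Lemma conj_exps_conjugate u : (forall i, 1 < tnth u i)%R ->
  conjugate_exponents u (conj_exps u).
Proof. by move=> u1 i; rewrite tnth_map; have [] := conj_expP (u1 i). Qed.

End herz_slice_norms.

(** * Duality of the Herz-slice spaces *)

Section herz_slice_duality.
Context {R : realType} {n : nat} (n0 : (0 < n)%N).
Local Notation rn := (rn R n).
Variables (t b : R) (t0 : (0 < t)%R) (u w v z : n.-tuple R).
Hypotheses (uw : conjugate_exponents u w) (vz : conjugate_exponents v z).
Variables (rho sigma : (nat -> \bar R) -> \bar R) (rs : sequence_duality rho sigma).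
Hypothesis sigma_ge0 : forall a, (forall i, 0 <= a i) -> 0 <= sigma a.

Let N := herz_functional rho u v t b.
Let N' := herz_functional sigma w z t (- b).

Let zv := conjugate_exponents_sym vz.
Let u0 := conjugate_exponents_gt0 uw.
Let v0 := conjugate_exponents_gt0 vz.
Let w0 := conjugate_exponents_gt0 (conjugate_exponents_sym uw).
Let z0 := conjugate_exponents_gt0 zv.
Let bv := fine (ball_norm v t).
Let bz := fine (ball_norm z t).

Let bv0 : (0 < bv)%R.
Proof. by rewrite fine_gt0// (ball_norm_gt0 vz t0)/= ball_norm_lty. Qed.

Let bz0 : (0 < bz)%R.
Proof. by rewrite fine_gt0// (ball_norm_gt0 zv t0)/= ball_norm_lty. Qed.

Let c i := (dyadic_weight b i / bv)%R.
Let d i := (dyadic_weight (- b) i / bz)%R.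
Let kappa := (bv * bz)^-1%R.

Let c0 i : (0 < c i)%R.
Proof. by rewrite divr_gt0// powR_gt0. Qed.

Let d0 i : (0 < d i)%R.
Proof. by rewrite divr_gt0// powR_gt0. Qed.

Let kappa0 : (0 < kappa)%R.
Proof. by rewrite invr_gt0 mulr_gt0. Qed.

(** The dyadic weights for [b] and [- b] cancel, and only the two denominators remain. *)
Let cd i : (c i * d i = kappa)%R.
Proof.
rewrite /c /d mulrACA /kappa invfM /dyadic_weight -powRD; last by apply/implyP.
by rewrite mulrN subrr powRr0 mul1r.
Qed.

Let NE f : measurable_fun setT f -> (forall y, 0 <= f y) ->
  N f = herz t (@shell R n) rho c u v f.
Proof. by move=> mf f0; exact: (herz_functionalE _ _ t0 u0 vz). Qed.

Let N'E f : measurable_fun setT f -> (forall y, 0 <= f y) ->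
  N' f = herz t (@shell R n) sigma d w z f.
Proof. by move=> mf f0; exact: (herz_functionalE _ _ t0 w0 zv). Qed.

Let mS := @measurable_shell R n.
Let tS := @trivIset_shell R n.
Let bS := @shell_box R n.
Let aS := @shell_cover_ae R n n0.

Let vol := fine (@ball_volume R n t).
Let vol2 := fine (@ball_volume R n (t *+ 2)).

Let volE (r : R) : (0 < r)%R -> (fine (@ball_volume R n r))%:E = @ball_volume R n r.
Proof.
by move=> r0; rewrite fineK// ge0_fin_numE ?ball_volume_lty// ltW// ball_volume_gt0.
Qed.

Let vol_gt0 (r : R) : (0 < r)%R -> (0 < fine (@ball_volume R n r))%R.
Proof. by move=> r0; rewrite -lte_fin volE// ball_volume_gt0. Qed.

Let N_hoelder f h : measurable_fun setT f -> measurable_fun setT h ->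
  (forall x, 0 <= f x) -> (forall x, 0 <= h x) ->
  \int[leb n]_x (f x * h x) <= ((kappa * vol)^-1)%:E * (N f * N' h).
Proof.
move=> mf mh f0 h0; have k0 : (0 < kappa * vol)%R by rewrite mulr_gt0// vol_gt0.
rewrite -[leLHS]mul1e -(mulVf (lt0r_neq0 k0)) EFinM -muleA.
apply: lee_wpmul2l; first by rewrite lee_fin invr_ge0 ltW.
rewrite NE// N'E// EFinM volE//.
exact: (herz_hoelder t0 uw vz rs mS tS aS c0 d0 cd).
Qed.

Lemma loc_integrable_of_norm (M : (rn -> \bar R) -> \bar R) (f : rn -> R) :
  (forall A : set rn, measurable A ->
    (exists m, forall i y, (m <= i)%N -> A y -> ~ shell i y) ->
    \int[leb n]_y (`|f y|%:E * (\1_A y)%:E) < +oo) ->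
  measurable_fun setT f -> loc_integrable_off0 f.
Proof.
move=> H mf; split => // x /shell_local[r r0 rl]; exists r => //.
have mB : measurable (oball x r).
  rewrite -[X in measurable X]setTI; apply: (@measurable_fun_ltr _ _ _ setT
    (fun y => euclid_dist x y) (cst r)) => //.
  exact: (measurableT_comp measurable_euclid_dist (pair1_measurable _)).
apply/integrableP; split; first by apply/measurable_EFinP; exact: measurable_funTS.
apply: le_lt_trans (H _ mB rl); rewrite integral_mkcond le_eqVlt; apply/orP; left.
apply/eqP; apply: eq_integral => y _; rewrite patchE indicE.
by case: ifP => yB; rewrite ?mule1 ?mule0.
Qed.

Theorem herz_functional_dual :
  dual_space_is
    [set f : rn -> R | loc_integrable_off0 f /\ norm_of N f < +oo] (norm_of N)
    [set f : rn -> R | loc_integrable_off0 f /\ norm_of N' f < +oo] (norm_of N').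
Proof.
have [g0 [mg0 g00 Ng0]] := herz_weight t0 uw vz rs mS tS bS c0.
have mabs (f : rn -> R) : measurable_fun setT f ->
    measurable_fun setT (fun x => `|f x|%:E : \bar R).
  by move=> mf; apply/measurable_EFinP; exact: measurableT_comp.
have ab0 (f : rn -> R) y : 0 <= `|f y|%:E :> \bar R by rewrite lee_fin.
have fin_indic A : measurable A ->
    (exists m, forall i y, (m <= i)%N -> A y -> ~ @shell R n i y) ->
    N (fun y => (\1_A y)%:E) < +oo /\ N' (fun y => (\1_A y)%:E) < +oo.
  move=> mA [m mE].
  have mi : measurable_fun setT (fun y => (\1_A y)%:E : \bar R).
    by apply/measurable_EFinP; exact: measurable_indic.
  have i0 y : 0 <= (\1_A y)%:E :> \bar R by rewrite lee_fin indicE.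
  rewrite NE// N'E//; exact: (herz_indic_lty t0 uw vz rs mS bS c0 d0 mA mE).
have N_ge0 f : 0 <= N f.
  by apply: (sd_ge0 rs) => i; rewrite mule_ge0 ?lee_fin ?powR_ge0//; exact: mixed_norm_ge0.
have N'_ge0 f : 0 <= N' f.
  by apply: sigma_ge0 => i; rewrite mule_ge0 ?lee_fin ?powR_ge0//; exact: mixed_norm_ge0.
have mul_lty (x y : \bar R) : 0 <= x -> x < +oo -> 0 <= y -> y < +oo ->
    ((kappa * vol)^-1)%:E * (x * y) < +oo.
  move=> x0 xoo y0 yoo; rewrite -(@fineK _ x) ?ge0_fin_numE//.
  by rewrite -(@fineK _ y) ?ge0_fin_numE// -!EFinM ltry.
(* A measurable function of finite norm is integrable off the origin, by Hoelder's inequality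
   against indicators of sets that meet finitely many shells. Local integrability thus adds only
   measurability to the finiteness of the norm. *)
rewrite (_ : [set f | _ /\ norm_of N f < +oo] = space_of N); last first.
  apply/seteqP; split => f [mf foo]; first by split => //; case: mf.
  split => //; apply: (@loc_integrable_of_norm N) => // A mA AE.
  have [_ iA] := fin_indic _ mA AE.
  apply: le_lt_trans (N_hoelder (mabs _ mf) _ (ab0 _) _) _.
  - by apply/measurable_EFinP; exact: measurable_indic.
  - by move=> y; rewrite lee_fin indicE.
  - exact: mul_lty.
rewrite (_ : [set f | _ /\ norm_of N' f < +oo] = space_of N'); last first.
  apply/seteqP; split => f [mf foo]; first by split => //; case: mf.
  split => //; apply: (@loc_integrable_of_norm N') => // A mA AE.
  have [iA _] := fin_indic _ mA AE.
  under eq_integral do rewrite muleC.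
  apply: le_lt_trans (N_hoelder _ (mabs _ mf) _ (ab0 _)) _.
  - by apply/measurable_EFinP; exact: measurable_indic.
  - by move=> y; rewrite lee_fin indicE.
  - exact: mul_lty.
(* The two constants are those of Hoelder's inequality and of its converse; the latter has the ball
   of radius [2 t] because of [slice_average]. *)
apply: (@dual_space_of R n N N' _ _ _ _ _ _ (kappa * vol)^-1%R (kappa * vol2)%R _ _ _ _ g0) => //.
- move=> f h mf mh f0 fh; have h0 x : 0 <= h x by exact: le_trans (fh x).
  by rewrite !NE//; exact: (le_herz t uw vz rs mS c0).
- move=> a f a0 mf f0; rewrite !NE//.
    exact: (herz_Z t uw vz rs mS c0).
  + exact: emeasurable_funM.
  + by move=> x; rewrite mule_ge0.
- move=> f mf f0 If; rewrite NE// /herz.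
  (* In this form the homogeneity [sd_Z] evaluates [rho] at the zero sequence. *)
  rewrite (_ : (fun k => _) = fun k => 0%:E * 0); last first.
    apply/funext => k; rewrite mul0e slice_null ?mule0//.
    + exact: measurable_restrict_to.
    + by move=> y; exact: restrict_ge0.
    apply/eqP; rewrite eq_le; apply/andP; split; last first.
      by apply: integral_ge0 => y _; exact: restrict_ge0.
    rewrite -If; apply: ge0_le_integral => //.
    + by move=> y _; exact: restrict_ge0.
    + exact: measurable_restrict_to.
    + move=> y _; rewrite -[leRHS]mule1; apply: lee_wpmul2l => //.
      by rewrite lee_fin indicE lern1 leq_b1.
  by rewrite (sd_Z rs)// mul0e.
- move=> h f mh mf h0 hf foo hv; have f0 x : 0 <= f x by exact: le_trans (hf 0%N x).
  rewrite (_ : (fun m => N (h m)) = fun m => herz t (@shell R n) rho c u v (h m)).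
    by apply: (herz_dominated uw vz rs mS c0 mh mf h0 hf) => //; rewrite -NE.
  by apply/funext => m; rewrite NE.
- by rewrite invr_gt0 mulr_gt0// vol_gt0.
- by rewrite mulr_gt0// vol_gt0// pmulrn_lgt0.
- move=> h K mh h0 K0 hK; rewrite N'E// !EFinM volE ?pmulrn_lgt0//.
  apply: (herz_converse t0 uw vz rs mS tS aS c0 d0 cd mh h0 K0) => f mf f0.
  by rewrite -NE//; exact: hK.
- by rewrite NE// => [|x]; [exact/measurable_EFinP|rewrite lee_fin ltW].
Qed.

End herz_slice_duality.

Local Close Scope ereal_scope.

Theorem theorem3p1 (R : realType) (n : nat) (hn : (0 < n)%N)
    (beta t s : R) (ht : 0 < t) (hs : 0 < s) (u v : n.-tuple R)
    (hu : forall i, 1 < tnth u i) (hv : forall i, 1 < tnth v i) :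
  (1 < s ->
     dual_space_is (herz_slice u v t beta s%:E)
       (herz_slice_norm u v t beta s%:E)
       (herz_slice (conj_exps u) (conj_exps v) t (- beta) (conj_exp s)%:E)
       (herz_slice_norm (conj_exps u) (conj_exps v) t (- beta)
          (conj_exp s)%:E)) /\
  (s <= 1 ->
     dual_space_is (herz_slice u v t beta s%:E)
       (herz_slice_norm u v t beta s%:E)
       (herz_slice (conj_exps u) (conj_exps v) t (- beta) +oo%E)
       (herz_slice_norm (conj_exps u) (conj_exps v) t (- beta) +oo%E)).
Proof.
have uw := conj_exps_conjugate hu; have vz := conj_exps_conjugate hv.
have normE b (u' v' : n.-tuple R) r : 0 < r -> herz_slice_norm u' v' t b r%:E =
    norm_of (herz_functional (Lnorm (@counting nat R) r%:E) u' v' t b).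
  by move=> r0; apply/funext => f; exact: herz_slice_norm_EFin.
rewrite /herz_slice; split => s1.
  have [s'1 ss'] := conj_expP s1.
  rewrite !normE ?(lt_trans ltr01 s'1)//.
  apply: (herz_functional_dual hn beta ht uw vz (sequence_duality_Lnorm s1 s'1 ss')).
  by move=> a a0; exact: Lnorm_ge0.
rewrite normE// (_ : herz_slice_norm _ _ _ _ +oo%E =
    norm_of (herz_functional (fun a => ereal_sup (range a))
      (conj_exps u) (conj_exps v) t (- beta))); last first.
  by apply/funext => f; exact: herz_slice_norm_pinfty.
apply: (herz_functional_dual hn beta ht uw vz (sequence_duality_sup hs s1)).
by move=> a a0; apply: (le_trans (a0 0%N)); apply: ereal_sup_ubound; exists 0%N.
Qed.
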